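(* Let $m_1,m_2,m_3>0$, let $\beta=27\,\dfrac{m_1m_2+m_2m_3+m_1m_3}{(m_1+m_2+m_3)^2}\in(0,9]$ and let $\alpha\in[0,2)$. The Morse index of the Lagrangian circular solution $\gamma_{\alpha,\beta}$ is $$ i_{\mathrm{Morse}}(\gamma_{\alpha,\beta})=\begin{cases}0 & \text{if }\alpha\in[1,2),\\[4pt] 2 & \text{if }\beta\ge\dfrac{36(1-\alpha)}{(\alpha+2)^2}\text{ and }\alpha\in[0,1),\\[8pt] 4 & \text{if }0<\beta<\dfrac{36(1-\alpha)}{(\alpha+2)^2}.\end{cases}$$
   Context: Planar three-body-type problem: let $X=\{q=(q_1,q_2,q_3)\in(\mathbb{R}^2)^3: q_i\ne q_j\ \forall i\ne j\}$ and $\hat X=\{q\in X:\sum_i m_iq_i=0\}$. The potential $U$ on $X$ is $U(q)=\sum_{i<j}m_im_j|q_i-q_j|^{-\alpha}$ if $\alpha\in(0,2)$ and $U(q)=-\sum_{i<j}m_im_j\log|q_i-q_j|$ if $\alpha=0$ (the value $\alpha=0$ always denotes the logarithmic potential). Newton's equations are $m_i\ddot q_i=\partial U/\partial q_i$. The Lagrangian on $T\hat X$ is $\mathcal{L}(q,v)=\frac12\sum_i m_i|v_i|^2+U(q)$ and the action functional on $W^{1,2}(\mathbb{R}/2\pi\mathbb{Z},\hat X)$ is $\mathbb{A}(\gamma)=\int_0^{2\pi}\mathcal{L}(\gamma(t),\dot\gamma(t))\,dt$; its critical points are the $2\pi$-periodic classical solutions. $\gamma_{\alpha,\beta}$ denotes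 the Lagrangian circular solution: the three bodies sit at the vertices of an equilateral triangle of constant size which rotates rigidly about the barycentre (the origin) with constant angular speed $1$ (minimal period $2\pi$). The Morse index of a critical point $\gamma$ is the maximal dimension of a subspace of $W^{1,2}(\mathbb{R}/2\pi\mathbb{Z},\{\xi\in\mathbb{R}^6:\sum_i m_i\xi_i=0\})$ on which the second variation $\mathrm{d}^2\mathbb{A}(\gamma)$ is negative definite. *)

(* Defs.v *)
From HB Require Import structures.
From mathcomp Require Import all_boot all_order all_algebra.
From mathcomp Require Import all_classical all_reals all_analysis.
Set Implicit Arguments.
Unset Strict Implicit.
Unset Printing Implicit Defensive.
Import Order.TTheory GRing.Theory Num.Theory.
Import numFieldNormedType.Exports.
Local Open Scope classical_set_scope.
Local Open Scope ring_scope.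

(* A configuration (q_1, q_2, q_3) in (R^2)^3 is a matrix whose i-th row is the
   position of the i-th body; velocities and variations have the same type. *)
Notation config R := 'M[R]_(3, 2).

(* The Euclidean norm; the norm `|v| of a matrix is the supremum norm. *)
Definition enorm (R : realType) (v : 'rV[R]_2) : R :=
  Num.sqrt (\sum_k v 0 k ^+ 2).

Definition body_dist (R : realType) (q : config R) (i j : 'I_3) : R :=
  enorm (row i q - row j q).

Definition collision_free (R : realType) : set (config R) :=
  [set q | forall i j : 'I_3, i != j -> row i q <> row j q].

Definition centered (R : realType) (m : 'I_3 -> R) : set (config R) :=
  [set q | \sum_i m i *: row i q = 0].

(* alpha = 0 stands for the logarithmic potential. *)
Definition potential (R : realType) (m : 'I_3 -> R) (alpha : R)
    (q : config R) : R :=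
  if alpha == 0 then
    - \sum_(i < 3) \sum_(j < 3 | (i < j)%N) m i * m j * ln (body_dist q i j)
  else
    \sum_(i < 3) \sum_(j < 3 | (i < j)%N)
      m i * m j * body_dist q i j `^ (- alpha).

Definition lagrangian (R : realType) (m : 'I_3 -> R) (alpha : R)
    (q v : config R) : R :=
  2^-1 * (\sum_i m i * enorm (row i v) ^+ 2) + potential m alpha q.

(* g is a weak derivative on [0, 2 pi] of the absolutely continuous function
   f. *)
Definition is_weak_deriv (R : realType) (f g : R -> R) : Prop :=
  (@lebesgue_measure R).-integrable `[0, 2 * pi] (EFin \o g) /\
  forall t, 0 <= t <= 2 * pi ->
    f t = f 0 + \int[@lebesgue_measure R]_(s in `[0, t]) g s.

(* W^{1,2}(R/2piZ, R): an element is represented by its continuous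
   representative, a 2pi-periodic function on the line which is the primitive of
   a square integrable function. *)
Definition W12 (R : realType) : set (R -> R) :=
  [set f | periodic f (2 * pi) /\
    exists2 g, is_weak_deriv f g &
      (@lebesgue_measure R).-integrable `[0, 2 * pi] (fun t => (g t ^+ 2)%:E)].

(* A chosen representative, determined up to a null set of [0, 2 pi]. *)
Definition weak_deriv (R : realType) (f : R -> R) : R -> R :=
  xget (cst 0) [set g | is_weak_deriv f g].

Definition velocity (R : realType) (gamma : R -> config R) : R -> config R :=
  fun t => \matrix_(i, k) weak_deriv (fun s => gamma s i k) t.

Definition W12_loop (R : realType) : set (R -> config R) :=
  [set gamma | forall i k, W12 (fun t => gamma t i k)].

Definition variations (R : realType) (m : 'I_3 -> R) : set (R -> config R) :=
  [set xi | W12_loop xi /\ forall t, centered m (xi t)].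

Definition action (R : realType) (m : 'I_3 -> R) (alpha : R)
    (gamma : R -> config R) : R :=
  \int[@lebesgue_measure R]_(t in `[0, 2 * pi])
    lagrangian m alpha (gamma t) (velocity gamma t).

(* The quadratic form xi |-> d^2 A(gamma)(xi, xi). *)
Definition second_variation (R : realType) (m : 'I_3 -> R) (alpha : R)
    (gamma xi : R -> config R) : R :=
  ((fun s : R => action m alpha (gamma + s *: xi))^`(2))%classic 0.

Definition subspace_of_dim (R : realType) (V : lmodType R) (n : nat)
    (E : set V) : Prop :=
  exists e : 'I_n -> V,
    (forall c : 'I_n -> R, \sum_i c i *: e i = 0 -> forall i, c i = 0) /\
    E = [set v | exists c : 'I_n -> R, v = \sum_i c i *: e i].

Definition has_negative_subspace (R : realType) (m : 'I_3 -> R) (alpha : R)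
    (gamma : R -> config R) (n : nat) : Prop :=
  exists E : set (R -> config R),
    [/\ subspace_of_dim n E, E `<=` variations m &
        forall xi, E xi -> xi != 0 -> second_variation m alpha gamma xi < 0].

(* Since an infinite-dimensional subspace contains subspaces of every finite
   dimension, it is enough to compare finite dimensions. *)
Definition morse_index (R : realType) (m : 'I_3 -> R) (alpha : R)
    (gamma : R -> config R) (n : nat) : Prop :=
  has_negative_subspace m alpha gamma n /\
  forall p, has_negative_subspace m alpha gamma p -> (p <= n)%N.

Definition newton_solution (R : realType) (m : 'I_3 -> R) (alpha : R)
    (gamma : R -> config R) : Prop :=
  (forall t, collision_free (gamma t)) /\
  forall t (i : 'I_3) (k : 'I_2),
    let x := fun s : R => gamma s i k in
    [/\ derivable x t 1, derivable (x^`())%classic t 1 &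
        m i * (x^`(2))%classic t = 'D_(delta_mx i k) (potential m alpha) (gamma t)].

Definition rotation (R : realType) (theta : R) : 'M[R]_2 :=
  \matrix_(i, j) if i == j then cos theta
                 else if i == 0 then - sin theta else sin theta.

Definition equilateral (R : realType) (q : config R) : Prop :=
  exists2 r : R, 0 < r & forall i j : 'I_3, i != j -> body_dist q i j = r.

(* The angular speed is 1 in either sense of rotation; the size of the triangle
   is forced by Newton's equations. Positions being rows, the rotation acts on
   the right by its transpose. *)
Definition lagrangian_circular (R : realType) (m : 'I_3 -> R) (alpha : R)
    (gamma : R -> config R) : Prop :=
  newton_solution m alpha gamma /\
  exists (q : config R) (w : R),
    [/\ equilateral q, centered m q, `|w| = 1 &
        forall t, gamma t = q *m (rotation (w * t))^T].

Definition mass_param (R : realType) (m : 'I_3 -> R) : R :=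
  27 * (\sum_(i < 3) \sum_(j < 3 | (i < j)%N) m i * m j) / (\sum_i m i) ^+ 2.

(* Main.v *)
From HB Require Import structures.
From mathcomp Require Import all_boot all_order all_algebra.
From mathcomp Require Import all_classical all_reals all_analysis.
From mathcomp Require Import measurable_realfun ring lra.
Require Import Defs.
Set Implicit Arguments.
Unset Strict Implicit.
Unset Printing Implicit Defensive.
Import Order.TTheory GRing.Theory Num.Theory.
Import numFieldNormedType.Exports.
Local Open Scope classical_set_scope.
Local Open Scope ring_scope.

(** Differentiating twice under the integral, the second variation along the
    circular solution only involves the distances, which are constant, and the
    components of xi_i - xi_j along the sides of the rotating triangle.  In the
    frame rotating with the triangle, and in complex Jacobi coordinates (one for
    homothetic motions, one for changes of shape), it splits into two quadratic
    forms with constant coefficients of the same kind ([kepler_form]), the shape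
    form depending on the masses only through a number k with |k|^2 = 1 - beta/9.

    A periodic function is its mean plus its first Fourier mode plus a rest.  The
    three parts are orthogonal for such a form, the form is nonnegative on the
    means (as |k| <= 1) and on the rests (because of the Wirtinger inequality with
    constant 4), and on the first modes it is an explicit form in four variables
    whose index is 2 if (A + 3)(A - 1) < A^2 |k|^2 and 0 otherwise, A = 1 + alpha/2.
    For k = 1 the condition reads alpha < 1, and for the shape form
    beta < 36 (1 - alpha) / (alpha + 2)^2.  The index is bounded from above by the
    number of linear functionals whose common kernel makes the form nonnegative. *)

(** * Weak derivatives *)

(** The constant A has a single origin. Written as a function phi of the squared distance, the
    potential satisfies x phi''(x) = - A phi'(x), for the logarithm as for the powers, and Newton's
    equations force phi' = - 1 / (2 M) at the squared side, M being the total mass; so exponent and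
    size survive only in A. The constant 4 in the Wirtinger inequality is exactly what the Coriolis
    term 4 x y' costs, because 4 x^2 + 4 x y' + y'^2 is a square. The inequality is proved without
    Fourier series, by comparison with tangents on quarter periods. The analytic obstacle is that
    the second variation is a genuine second derivative in s of an action whose velocities are weak
    derivatives chosen arbitrarily, and separately for each s. This calls for almost everywhere
    uniqueness of weak derivatives, integration by parts for primitives of integrable functions, and
    differentiation under the integral for s so small that no collision can occur. *)

Section Primitives.
Context {R : realType}.
Notation mu := (@lebesgue_measure R).
Implicit Types (f g h : R -> R) (a b c d t : R).

(** On [[0, 2 * pi]] this is [is_weak_deriv]; other endpoints are needed because integrals are cut
    into pieces. *)
Definition primitive_on a b f g : Prop :=
  mu.-integrable `[a, b] (EFin \o g) /\
  forall t, a <= t <= b -> f t = f a + \int[mu]_(s in `[a, t]) g s.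

(** Both sides integrate g(s) h(u) over the triangle u <= s. Extended by 0 outside the interval, the
    integrand is a function on the plane dominated by the integrable |g(s) h(u)|, so Fubini's
    theorem applies. *)
Lemma fubini_triangle a b g h :
  mu.-integrable `[a, b] (EFin \o g) -> mu.-integrable `[a, b] (EFin \o h) ->
  \int[mu]_(s in `[a, b]) (g s * \int[mu]_(u in `[a, s]) h u) =
  \int[mu]_(u in `[a, b]) (h u * \int[mu]_(s in `[u, b]) g s).
Proof.
move=> ig ih.
pose g0 := g \_ `[a, b]; pose h0 := h \_ `[a, b].
have ig0 : mu.-integrable setT (EFin \o g0).
  by rewrite /g0 -restrict_EFin; apply/integrable_restrict => //=; rewrite setTI.
have ih0 : mu.-integrable setT (EFin \o h0).
  by rewrite /h0 -restrict_EFin; apply/integrable_restrict => //=; rewrite setTI.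
have mg0 : measurable_fun setT g0 by apply/measurable_EFinP; exact: measurable_int ig0.
have mh0 : measurable_fun setT h0 by apply/measurable_EFinP; exact: measurable_int ih0.
pose F (p : measurableTypeR R * measurableTypeR R) : \bar R :=
  (g0 p.1 * h0 p.2 * \1_[set q : measurableTypeR R * measurableTypeR R | q.2 <= q.1] p)%:E.
have inS x y : ((x, y) \in [set q : measurableTypeR R * measurableTypeR R | q.2 <= q.1])
    = (y <= x :> R).
  by apply/idP/idP => [/set_mem|] //= yx; exact/mem_set.
have mF : measurable_fun setT F.
  apply/measurable_EFinP; apply: measurable_funM; first apply: measurable_funM.
  - by apply: (measurableT_comp mg0); exact: measurable_fst.
  - by apply: (measurableT_comp mh0); exact: measurable_snd.
  - apply: (@measurable_indic _ _ _ setT).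
    have := @measurable_fun_ler _ _ R setT snd fst measurable_snd measurable_fst.
    by move=> /(_ measurableT [set true] I); rewrite setTI; congr (measurable _); apply/seteqP; split => x /=.
have iF : (mu \x mu)%E.-integrable setT F.
  pose K (p : measurableTypeR R * measurableTypeR R) : \bar R := (g0 p.1 * h0 p.2)%:E.
  apply: (le_integrable measurableT (g := K) mF).
    move=> [x y] _ /=; rewrite lee_fin /= !normrM ler_piMr// indicE.
    by case: (_ \in _); rewrite ?normr1 ?normr0.
  apply/(integrable12ltyP mu mu).
    apply/measurable_EFinP; apply: measurable_funM.
      by apply: (measurableT_comp mg0); exact: measurable_fst.
    by apply: (measurableT_comp mh0); exact: measurable_snd.
  have [_ ig0'] := integrableP _ _ _ ig0; have [_ ih0'] := integrableP _ _ _ ih0.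
  have H x : (\int[mu]_y `|(g0 x * h0 y)%:E| = `|g0 x|%:E * \int[mu]_y `|(h0 y)%:E|)%E.
    rewrite -ge0_integralZl//.
      by apply: eq_integral => y _; rewrite EFinM abseM.
    apply: measurableT_comp => //; exact/measurable_EFinP.
  under eq_integral do rewrite /= H.
  rewrite ge0_integralZr//; last by apply: integral_ge0.
    apply: lte_mul_pinfty => //; first exact: integral_ge0.
    by rewrite ge0_fin_numE//; exact: integral_ge0.
  by apply/measurable_EFinP/measurableT_comp.
have E1 x : `[a, b]%classic x ->
    (\int[mu]_y F (x, y) = (g x * \int[mu]_(u in `[a, x]) h u)%:E)%E.
  rewrite /= in_itv/= => /andP[ax xb].
  have ihx : mu.-integrable `[a, x] (EFin \o h).
    apply: integrableS ih => //; apply: subset_itvl; by rewrite bnd_simp.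
  have ihx0 : mu.-integrable setT (EFin \o h \_ `[a, x]).
    by rewrite -restrict_EFin; apply/integrable_restrict => //=; rewrite setTI.
  rewrite Rintegral_mkcond EFinM /Rintegral fineK; last exact: integrable_fin_num.
  rewrite -integralZl//; apply: eq_integral => y _.
  rewrite /F /g0 /h0/= -EFinM !patchE mem_set/=; last by rewrite in_itv/= ax xb.
  congr EFin; rewrite indicE inS !mem_setE !in_itv/=; case: (lerP y x) => yx.
    by rewrite (le_trans yx xb) andbT/= mulr1.
  by rewrite andbF/= !mulr0.
have E2 y : `[a, b]%classic y ->
    (\int[mu]_x F (x, y) = (h y * \int[mu]_(s in `[y, b]) g s)%:E)%E.
  rewrite /= in_itv/= => /andP[ay yb].
  have igx : mu.-integrable `[y, b] (EFin \o g).
    apply: integrableS ig => //; apply: subset_itvr; by rewrite bnd_simp.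
  have igx0 : mu.-integrable setT (EFin \o g \_ `[y, b]).
    by rewrite -restrict_EFin; apply/integrable_restrict => //=; rewrite setTI.
  rewrite Rintegral_mkcond EFinM /Rintegral fineK; last exact: integrable_fin_num.
  rewrite -integralZl//; apply: eq_integral => x _.
  rewrite /F /g0 /h0/= -EFinM !patchE.
  have -> : y \in `[a, b]%classic by apply/mem_set; rewrite /= in_itv/= ay yb.
  congr EFin; rewrite indicE inS !mem_setE !in_itv/=; case: (lerP y x) => yx.
    by rewrite (le_trans ay yx)/= mulr1 mulrC.
  by rewrite andFb/= !mulr0.
have N1 x : ~ `[a, b]%classic x -> (\int[mu]_y F (x, y) = 0)%E.
  move=> nx; under eq_integral do rewrite /F /= /g0 patchE memNset// !mul0r.
  by rewrite integral0.
have N2 y : ~ `[a, b]%classic y -> (\int[mu]_x F (x, y) = 0)%E.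
  move=> nx; under eq_integral do rewrite /F /= /h0 patchE memNset// mulr0 mul0r.
  by rewrite integral0.
rewrite [LHS]/Rintegral [RHS]/Rintegral; congr fine.
rewrite integral_mkcond [RHS]integral_mkcond.
transitivity (\int[mu]_x \int[mu]_y F (x, y))%E.
  apply: eq_integral => x _; rewrite patchE; case: ifPn => [/set_mem/E1->//|].
  by rewrite notin_setE => /N1.
rewrite (@Fubini _ _ _ _ R mu mu F iF); apply: eq_integral => y _; rewrite patchE.
case: ifPn => [/set_mem/E2->//|].
by rewrite notin_setE => /N2.
Qed.

Lemma integrable_itvS a b c d g : a <= c -> d <= b ->
  mu.-integrable `[a, b] (EFin \o g) -> mu.-integrable `[c, d] (EFin \o g).
Proof.
move=> ac db; apply: integrableS => //.
by apply: subset_itv; rewrite bnd_simp.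
Qed.

Lemma Rintegral_split a c b g : a <= c -> c <= b ->
  mu.-integrable `[a, b] (EFin \o g) ->
  \int[mu]_(s in `[a, b]) g s =
  \int[mu]_(s in `[a, c]) g s + \int[mu]_(s in `[c, b]) g s.
Proof.
move=> ac cb ig; apply/eqP; rewrite addrC -subr_eq; apply/eqP.
rewrite (Rintegral_itvB ig) ?bnd_simp// Rintegral_itv_obnd_cbnd//.
apply: integrableS ig => //.
by apply: subset_itv; rewrite bnd_simp.
Qed.

Lemma primitive_onS a b c d f g : a <= c -> c <= d -> d <= b ->
  primitive_on a b f g -> primitive_on c d f g.
Proof.
move=> ac cd db [ig fE]; split; first exact: integrable_itvS ig.
move=> t /andP[ct td]; rewrite fE ?(le_trans ac ct) ?(le_trans td db)//.
rewrite (fE c) ?ac ?(le_trans cd db)// -addrA (@Rintegral_split a c t)//.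
exact: integrable_itvS (le_trans td db) ig.
Qed.

Lemma primitive_on_cst a b (k : R) : primitive_on a b (cst k) (cst 0).
Proof.
split; first exact: integrable0.
by move=> t _; rewrite /= /Rintegral integral0 addr0.
Qed.

Lemma primitive_onD a b f g f' g' : primitive_on a b f f' ->
  primitive_on a b g g' ->
  primitive_on a b (fun t => f t + g t) (fun t => f' t + g' t).
Proof.
move=> [if' fE] [ig' gE]; split; first exact: (integrableD _ if' ig').
move=> t abt; rewrite fE// gE// RintegralD//; first by rewrite addrACA.
- by apply: integrable_itvS if'; case/andP: abt.
- by apply: integrable_itvS ig'; case/andP: abt.
Qed.

Lemma primitive_onZ a b (k : R) f f' : primitive_on a b f f' ->
  primitive_on a b (fun t => k * f t) (fun t => k * f' t).
Proof.
move=> [if' fE]; split; first exact: (integrableZl _ k if').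
move=> t abt; rewrite fE// RintegralZl//; first by rewrite mulrDr.
by apply: integrable_itvS if'; case/andP: abt.
Qed.

Lemma primitive_on_continuous a b f g : a <= b -> primitive_on a b f g ->
  {within `[a, b], continuous f}.
Proof.
move=> ab [ig fE].
have cI := parameterized_integral_continuous ab ig.
have cJ : {within `[a, b], continuous (fun t => f a + parameterized_integral mu a t g)}.
  by move=> x; apply: cvgD; [exact: cvg_cst|exact: cI].
apply: subspace_eq_continuous cJ => x.
move=> /set_mem/= abx; apply: esym; apply: fE.
by move: abx; rewrite in_itv.
Qed.

Lemma within_continuous_measurable a b f : {within `[a, b], continuous f} ->
  measurable_fun `[a, b] f.
Proof. by move=> cf; apply: subspace_continuous_measurable_fun. Qed.

Lemma within_continuous_bounded a b f : {within `[a, b], continuous f} ->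
  [bounded f x | x in `[a, b]%classic].
Proof.
move=> cf.
have /compact_bounded[M [_ mrt]] := continuous_compact cf (@segment_compact _ a b).
by exists M; split; rewrite ?num_real // => ? ? ? ?; exact: mrt.
Qed.

Lemma integrable_within_continuous a b f : {within `[a, b], continuous f} ->
  mu.-integrable `[a, b] (EFin \o f).
Proof. by apply: continuous_compact_integrable; exact: segment_compact. Qed.

Lemma integrableM_within_continuous a b f g : mu.-integrable `[a, b] (EFin \o f) ->
  {within `[a, b], continuous g} ->
  mu.-integrable `[a, b] (EFin \o (fun t => f t * g t)).
Proof.
move=> intf cg.
have H : mu.-integrable `[a, b] ((EFin \o f) \* (EFin \o g))%E.
  apply: integrableMl => //.
  - exact: within_continuous_measurable.
  - exact: within_continuous_bounded.
exact: H.
Qed.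

(** No pointwise derivative is available. Each function is replaced by its initial value plus an
    integral, and the product of integrals that results is cut along the diagonal of the square by
    [fubini_triangle]. *)
Lemma Rintegral_by_parts a b f f' g g' : a <= b ->
  primitive_on a b f f' -> primitive_on a b g g' ->
  f b * g b - f a * g a =
  \int[mu]_(s in `[a, b]) (f' s * g s) + \int[mu]_(s in `[a, b]) (f s * g' s).
Proof.
move=> ab pf pg; have [if' fE] := pf; have [ig' gE] := pg.
have cf := parameterized_integral_continuous ab if'.
have cg := parameterized_integral_continuous ab ig'.
have -> : \int[mu]_(s in `[a, b]) (f' s * g s) =
    g a * \int[mu]_(s in `[a, b]) f' s +
    \int[mu]_(s in `[a, b]) (f' s * parameterized_integral mu a s g').
  rewrite -RintegralZl// -RintegralD//.
  - apply: eq_Rintegral => s /set_mem/=; rewrite in_itv/= => abs.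
    by rewrite gE// mulrDr mulrC.
  - exact: (integrableZl _ _ if').
  - exact: integrableM_within_continuous.
have -> : \int[mu]_(s in `[a, b]) (f s * g' s) =
    f a * \int[mu]_(s in `[a, b]) g' s +
    \int[mu]_(s in `[a, b]) (g' s * parameterized_integral mu a s f').
  rewrite -RintegralZl// -RintegralD//.
  - apply: eq_Rintegral => s /set_mem/=; rewrite in_itv/= => abs.
    by rewrite fE// mulrDl [in X in _ + X]mulrC.
  - exact: (integrableZl _ _ ig').
  - exact: integrableM_within_continuous.
rewrite /parameterized_integral fubini_triangle//.
have -> : \int[mu]_(u in `[a, b]) (g' u * \int[mu]_(s in `[u, b]) f' s) =
    \int[mu]_(u in `[a, b]) (\int[mu]_(s in `[a, b]) f' s * g' u) -
    \int[mu]_(u in `[a, b]) (g' u * \int[mu]_(s in `[a, u]) f' s).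
  rewrite -RintegralB//.
  - apply: eq_Rintegral => s /set_mem/=; rewrite in_itv/= => /andP[sa sb].
    by rewrite (Rintegral_split sa sb if'); ring.
  - exact: (integrableZl _ _ ig').
  - exact: integrableM_within_continuous.
rewrite RintegralZl// (fE b) ?lexx ?ab// (gE b) ?lexx ?ab//.
by ring.
Qed.

Lemma primitive_onM a b f f' g g' : a <= b ->
  primitive_on a b f f' -> primitive_on a b g g' ->
  primitive_on a b (fun t => f t * g t) (fun t => f' t * g t + f t * g' t).
Proof.
move=> ab pf pg.
have cf := primitive_on_continuous ab pf.
have cg := primitive_on_continuous ab pg.
have i1 := integrableM_within_continuous pf.1 cg.
have i2 : mu.-integrable `[a, b] (EFin \o (fun t => f t * g' t)).
  apply: eq_integrable (integrableM_within_continuous pg.1 cf) => //.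
  by move=> x _ /=; rewrite mulrC.
split; first exact: (integrableD _ i1 i2).
move=> t /andP[at_ tb]; rewrite RintegralD//; last 2 first.
- exact: integrable_itvS i1.
- exact: integrable_itvS i2.
have pft : primitive_on a t f f' by exact: (primitive_onS _ _ _ pf).
have pgt : primitive_on a t g g' by exact: (primitive_onS _ _ _ pg).
by rewrite -(Rintegral_by_parts at_ pft pgt) addrC subrK.
Qed.

Lemma primitive_on_C1 a b f f' : a <= b ->
  (forall t, a <= t <= b -> is_derive t 1 f (f' t)) ->
  {within `[a, b], continuous f'} -> primitive_on a b f f'.
Proof.
move=> ab df cf'; split; first exact: integrable_within_continuous.
move=> t /andP[]; rewrite le_eqVlt => /predU1P[<- _|at_ tb].
  by rewrite set_itv1 Rintegral_set1 addr0.
have cft x : a <= x <= b -> {for x, continuous f}.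
  move=> /df d; apply: differentiable_continuous.
  by apply/derivable1_diffP.
rewrite /Rintegral (@continuous_FTC2 _ f' f)//=.
- by rewrite addrCA subrr addr0.
- apply: continuous_subspaceW cf'; apply: subset_itvl; by rewrite bnd_simp.
- split.
  + move=> x /=; rewrite in_itv/= => /andP[ax xt].
    by have [] : is_derive x 1 f (f' x) by apply: df; rewrite (ltW ax) (le_trans (ltW xt)).
  + by apply: cvg_at_right_filter; apply: cft; rewrite lexx.
  + by apply: cvg_at_left_filter; apply: cft; rewrite (ltW at_).
- move=> x; rewrite in_itv/= => /andP[ax xt]; rewrite derive1E; apply: derive_val.
  by apply: df; rewrite (ltW ax) (le_trans (ltW xt)).
Qed.

(** This makes the arbitrary choice in [weak_deriv] harmless. The indefinite integral of g1 - g2,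
    extended by 0, vanishes identically, and Lebesgue differentiation recovers g1 - g2 from it
    almost everywhere. *)
Lemma primitive_on_ae_unique a b f g1 g2 :
  primitive_on a b f g1 -> primitive_on a b f g2 ->
  ae_eq mu `[a, b]%classic g1 g2.
Proof.
move=> [ig1 fE1] [ig2 fE2].
have ig : mu.-integrable `[a, b] (EFin \o (fun t => g1 t - g2 t)).
  exact: (integrableB _ ig1 ig2).
pose h := (fun t => g1 t - g2 t) \_ `[a, b].
have ih : mu.-integrable setT (EFin \o h).
  by rewrite /h -restrict_EFin; apply/integrable_restrict => //=; rewrite setTI.
have ihx (x : R) : mu.-integrable `]-oo, x] (EFin \o h) by exact: integrableS ih.
have H0 : (fun x : R => \int[mu]_(t in `]-oo, x]) h t) = cst 0.
  apply/funext => x; rewrite -Rintegral_mkcondr.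
  have -> : `]-oo, x]%classic `&` `[a, b]%classic = `[a, Num.min x b]%classic.
    apply/seteqP; split => t /=; rewrite !in_itv/= le_min.
      by move=> [-> /andP[-> ->]].
    by move=> /and3P[-> -> ->].
  have [ax|xa] := leP a (Num.min x b); last first.
    by rewrite set_itv_ge ?Rintegral_set0// bnd_simp -ltNge.
  have xb : Num.min x b <= b by rewrite ge_min lexx orbT.
  rewrite RintegralB//; last 2 first.
  - exact: integrable_itvS ig1.
  - exact: integrable_itvS ig2.
  have := fE1 _ (introT andP (conj ax xb)).
  have := fE2 _ (introT andP (conj ax xb)).
  by move=> -> /addrI ->; rewrite subrr.
have /= := FTC1Ny ihx (integrable_locally (measurable_itv _) ig).
rewrite -/h H0.
apply: (@filterS _ _ (ae_filter_ringOfSetsType mu)) => x; move=> [_ +] abx.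
rewrite derive1_cst /h patchE mem_set// => /esym/eqP.
by rewrite subr_eq0 => /eqP.
Qed.

End Primitives.

(** * Square-integrable functions, Sobolev functions and the scalar product *)

Section SquareIntegrable.
Context {R : realType}.
Notation mu := (@lebesgue_measure R).
Implicit Types (f g h : R -> R) (a b c d t : R).

(** Measurability is listed separately because the square forgets the sign. *)
Definition sqint a b f : Prop :=
  measurable_fun `[a, b] f /\ mu.-integrable `[a, b] (EFin \o (fun t => f t ^+ 2)).

Lemma integrable_itvD a b f g : mu.-integrable `[a, b] (EFin \o f) ->
  mu.-integrable `[a, b] (EFin \o g) ->
  mu.-integrable `[a, b] (EFin \o (fun t => f t + g t)).
Proof. by move=> intf intg; exact: (integrableD _ intf intg). Qed.

Lemma integrable_itvZ a b (k : R) f : mu.-integrable `[a, b] (EFin \o f) ->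
  mu.-integrable `[a, b] (EFin \o (fun t => k * f t)).
Proof. by move=> intf; exact: (integrableZl _ k intf). Qed.

Lemma integrable_itv_le a b f g : measurable_fun `[a, b] f ->
  (forall t, `|f t| <= g t) -> mu.-integrable `[a, b] (EFin \o g) ->
  mu.-integrable `[a, b] (EFin \o f).
Proof.
move=> mf fg; apply: le_integrable => //.
  by apply/measurable_EFinP.
by move=> t _ /=; rewrite lee_fin (le_trans (fg t))// ler_norm.
Qed.

Lemma eq_integrable_itv a b f g : (forall t, a <= t <= b -> f t = g t) ->
  mu.-integrable `[a, b] (EFin \o f) -> mu.-integrable `[a, b] (EFin \o g).
Proof.
move=> fg; apply: eq_integrable => // t /set_mem/=; rewrite in_itv/= => abt.
by rewrite fg.
Qed.

Lemma integrable_sqintM a b f g : sqint a b f -> sqint a b g ->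
  mu.-integrable `[a, b] (EFin \o (fun t => f t * g t)).
Proof.
move=> [mf if2] [mg ig2].
apply: integrable_itv_le (integrable_itvD if2 ig2).
  exact: measurable_funM.
move=> t; rewrite ler_norml.
have := sqr_ge0 (f t + g t); have := sqr_ge0 (f t - g t).
have := sqr_ge0 (f t); have := sqr_ge0 (g t).
rewrite sqrrB sqrrD !mulr2n => *.
by apply/andP; split; lra.
Qed.

Lemma sqintD a b f g : sqint a b f -> sqint a b g -> sqint a b (fun t => f t + g t).
Proof.
move=> sf sg; split; first exact: measurable_funD sf.1 sg.1.
have i := integrable_sqintM sf sg.
have := integrable_itvD sf.2 (integrable_itvD (integrable_itvZ 2 i) sg.2).
by apply: eq_integrable_itv => t _; ring.
Qed.

Lemma sqintZ a b (k : R) f : sqint a b f -> sqint a b (fun t => k * f t).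
Proof.
move=> sf; split; first by apply: measurable_funM => //; exact: sf.1.
have := integrable_itvZ (k ^+ 2) sf.2.
by apply: eq_integrable_itv => t _; ring.
Qed.

Lemma sqint_within_continuous a b f : {within `[a, b], continuous f} -> sqint a b f.
Proof.
move=> cf; split; first exact: within_continuous_measurable.
have := integrableM_within_continuous (integrable_within_continuous cf) cf.
by apply: eq_integrable => // t _ /=; rewrite expr2.
Qed.

Lemma sqint_cst a b (k : R) : sqint a b (cst k).
Proof. by apply: sqint_within_continuous => x; exact: cvg_cst. Qed.

Lemma sqintM_within_continuous a b f g : sqint a b f ->
  {within `[a, b], continuous g} -> sqint a b (fun t => f t * g t).
Proof.
move=> sf cg; split.
  by apply: measurable_funM; [exact: sf.1|exact: within_continuous_measurable].
have cg2 : {within `[a, b], continuous (fun t => g t ^+ 2)}.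
  by move=> x; apply: cvgM; exact: cg.
have := integrableM_within_continuous sf.2 cg2.
by apply: eq_integrable => // t _ /=; rewrite exprMn.
Qed.

Lemma sqintS a b c d f : a <= c -> d <= b -> sqint a b f -> sqint c d f.
Proof.
move=> ac db [mf if2]; split; last exact: integrable_itvS if2.
by apply: measurable_funS mf => //; apply: subset_itv; rewrite bnd_simp.
Qed.

Lemma sqint_ae a b f g : measurable_fun `[a, b] g -> ae_eq mu `[a, b]%classic f g ->
  sqint a b f -> sqint a b g.
Proof.
move=> mg fg [mf /integrableP[mf2 if2]]; split => //; apply/integrableP; split.
  by apply/measurable_EFinP; exact: measurable_funX.
rewrite (@ae_eq_integral _ (measurableTypeR R) R mu `[a, b]%classic
  (fun t => `|(f t ^+ 2)%:E|%E)) => //.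
- apply: measurableT_comp => //; apply/measurable_EFinP; exact: measurable_funX.
- by apply: measurableT_comp.
- by apply: (@filterS _ _ (ae_filter_ringOfSetsType mu)) fg => t /= + abt => ->.
Qed.

Definition sobolev_on a b f g : Prop := primitive_on a b f g /\ sqint a b g.

Lemma sobolev_on_sqint a b f g : a <= b -> sobolev_on a b f g -> sqint a b f.
Proof. by move=> ab [pf _]; apply: sqint_within_continuous (primitive_on_continuous ab pf). Qed.

Lemma sobolev_onS a b c d f g : a <= c -> c <= d -> d <= b ->
  sobolev_on a b f g -> sobolev_on c d f g.
Proof.
by move=> ac cd db [pf sg]; split; [exact: primitive_onS pf|exact: sqintS sg].
Qed.

Lemma sobolev_onD a b f g f' g' : sobolev_on a b f f' -> sobolev_on a b g g' ->
  sobolev_on a b (fun t => f t + g t) (fun t => f' t + g' t).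
Proof. by move=> [? ?] [? ?]; split; [exact: primitive_onD|exact: sqintD]. Qed.

Lemma sobolev_onZ a b (k : R) f f' : sobolev_on a b f f' ->
  sobolev_on a b (fun t => k * f t) (fun t => k * f' t).
Proof. by move=> [? ?]; split; [exact: primitive_onZ|exact: sqintZ]. Qed.

Lemma sobolev_onM a b f g f' g' : a <= b ->
  sobolev_on a b f f' -> sobolev_on a b g g' ->
  sobolev_on a b (fun t => f t * g t) (fun t => f' t * g t + f t * g' t).
Proof.
move=> ab [pf sf] [pg sg]; split; first exact: primitive_onM.
apply: sqintD.
  by apply: sqintM_within_continuous sf (primitive_on_continuous ab pg).
under eq_fun do rewrite mulrC.
by apply: sqintM_within_continuous sg (primitive_on_continuous ab pf).
Qed.

Lemma sobolev_on_C1 a b f f' : a <= b ->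
  (forall t, a <= t <= b -> is_derive t 1 f (f' t)) ->
  {within `[a, b], continuous f'} -> sobolev_on a b f f'.
Proof.
move=> ab df cf'; split; first exact: primitive_on_C1.
exact: sqint_within_continuous.
Qed.

Definition ip a b f g : R := \int[mu]_(t in `[a, b]) (f t * g t).

Lemma ipC a b f g : ip a b f g = ip a b g f.
Proof. by apply: eq_Rintegral => t _; rewrite mulrC. Qed.

Lemma ipDl a b f g h : sqint a b f -> sqint a b g -> sqint a b h ->
  ip a b (fun t => f t + g t) h = ip a b f h + ip a b g h.
Proof.
move=> sf sg sh; rewrite /ip -RintegralD//; try exact: integrable_sqintM.
by apply: eq_Rintegral => t _; rewrite mulrDl.
Qed.

Lemma ipDr a b f g h : sqint a b f -> sqint a b g -> sqint a b h ->
  ip a b h (fun t => f t + g t) = ip a b h f + ip a b h g.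
Proof. by move=> sf sg sh; rewrite ipC ipDl// ipC [in X in _ + X]ipC. Qed.

Lemma ipZl a b (k : R) f g : sqint a b f -> sqint a b g ->
  ip a b (fun t => k * f t) g = k * ip a b f g.
Proof.
move=> sf sg; rewrite /ip -RintegralZl//; try exact: integrable_sqintM.
by apply: eq_Rintegral => t _; rewrite mulrA.
Qed.

Lemma ipZr a b (k : R) f g : sqint a b f -> sqint a b g ->
  ip a b g (fun t => k * f t) = k * ip a b g f.
Proof. by move=> sf sg; rewrite ipC ipZl// ipC. Qed.

Lemma ipNr a b f g : sqint a b f -> sqint a b g ->
  ip a b g (fun t => - f t) = - ip a b g f.
Proof.
move=> sf sg; rewrite -mulN1r -ipZr//; apply: eq_Rintegral => t _.
by rewrite mulN1r.
Qed.

Lemma ipNl a b f g : sqint a b f -> sqint a b g ->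
  ip a b (fun t => - f t) g = - ip a b f g.
Proof. by move=> sf sg; rewrite ipC ipNr// ipC. Qed.

Lemma ip0l a b f : ip a b (cst 0) f = 0.
Proof.
by rewrite /ip; under eq_Rintegral do rewrite mul0r; rewrite /Rintegral integral0.
Qed.

Lemma ip_ge0 a b f : 0 <= ip a b f f.
Proof. by apply: Rintegral_ge0 => t _; rewrite -expr2 sqr_ge0. Qed.

Lemma ip_by_parts a b f g f' g' : a <= b ->
  primitive_on a b f f' -> primitive_on a b g g' ->
  ip a b f' g + ip a b f g' = f b * g b - f a * g a.
Proof. by move=> ab pf pg; rewrite (Rintegral_by_parts ab pf pg). Qed.

(* The square of g + f psi is integrated, psi being a solution of the Riccati
   equation psi' = l^2 + psi^2. *)
Lemma picone a b (l : R) f g (psi psi' : R -> R) : a <= b -> sobolev_on a b f g ->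
  (forall t, a <= t <= b -> is_derive t 1 psi (psi' t)) ->
  (forall t, a <= t <= b -> psi' t = l ^+ 2 + psi t ^+ 2) ->
  f a ^+ 2 * psi a - f b ^+ 2 * psi b <= ip a b g g - l ^+ 2 * ip a b f f.
Proof.
move=> ab sfg dpsi ric.
have cpsi : {within `[a, b], continuous psi}.
  apply: continuous_in_subspaceT => x /set_mem/=; rewrite in_itv/= => /dpsi d.
  by apply: differentiable_continuous; apply/derivable1_diffP.
have cpsi' : {within `[a, b], continuous psi'}.
  have c2 : {within `[a, b], continuous (fun t => l ^+ 2 + psi t ^+ 2)}.
    move=> x; apply: cvgD; first exact: cvg_cst.
    by apply: cvgM; exact: cpsi.
  apply: subspace_eq_continuous c2 => x /set_mem/= abx; apply: esym; apply: ric.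
  by move: abx; rewrite in_itv.
have sf := sobolev_on_sqint ab sfg.
have [pf sg] := sfg.
have cf := primitive_on_continuous ab pf.
have pp := primitive_on_C1 ab dpsi cpsi'.
(* Integrating f^2 psi by parts yields 2 g f psi and, by the Riccati equation, l^2 f^2 + (f psi)^2:
   everything in the expanded square except g^2. *)
have := ip_by_parts ab (primitive_onM ab pf pf) pp.
rewrite -!expr2.
have sfpsi : sqint a b (fun t => f t * psi t) by exact: sqintM_within_continuous.
have -> : ip a b (fun t => g t * f t + f t * g t) psi = 2 * ip a b g (fun t => f t * psi t).
  rewrite -ipZr//; apply: eq_Rintegral => t _; ring.
have -> : ip a b (fun t => f t * f t) psi' =
    l ^+ 2 * ip a b f f + ip a b (fun t => f t * psi t) (fun t => f t * psi t).
  rewrite -ipZl// /ip -RintegralD//.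
  - apply: eq_Rintegral => t /set_mem/=; rewrite in_itv/= => abt.
    by rewrite ric//; ring.
  - by apply: integrable_sqintM => //; exact: sqintZ.
  - exact: integrable_sqintM.
have := ip_ge0 a b (fun t => g t + f t * psi t).
rewrite ipDl ?ipDr//; last exact: sqintD.
rewrite (ipC _ _ (fun t => f t * psi t) g).
lra.
Qed.

End SquareIntegrable.

(** * Wirtinger inequality *)

Section Wirtinger.
Context {R : realType}.
Notation mu := (@lebesgue_measure R).
Implicit Types (f g h : R -> R) (a b c d t : R).

Lemma is_derive1D f g (f' g' t : R) : is_derive t 1 f f' -> is_derive t 1 g g' ->
  is_derive t 1 (fun s => f s + g s) (f' + g').
Proof. by move=> df dg; exact: is_deriveD. Qed.

Lemma is_derive1Z f (k f' t : R) : is_derive t 1 f f' ->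
  is_derive t 1 (fun s => k * f s) (k * f').
Proof. by move=> df; exact: is_deriveZ. Qed.

Lemma is_derive1M f g (f' g' t : R) : is_derive t 1 f f' -> is_derive t 1 g g' ->
  is_derive t 1 (fun s => f s * g s) (f' * g t + f t * g').
Proof.
move=> df dg.
have -> : f' * g t + f t * g' = f t *: g' + g t *: f'.
  by rewrite addrC [f' * _]mulrC.
exact: is_deriveM.
Qed.

Lemma is_derive1_affine (k c t : R) : is_derive t 1 (fun s : R => k * (s + c)) k.
Proof.
suff : is_derive t 1 (fun s : R => k * (s + c)) (k * (1 + 0)) by rewrite addr0 mulr1.
exact: (is_derive1Z k (is_derive1D (is_derive_id t 1) (is_derive_cst c t 1))).
Qed.

(** The solution of the Riccati equation that is fed to [picone]; it lives on an open interval of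
    length pi / l centred at c. *)
Lemma is_derive_tan_scale (l c t : R) : - (pi / 2) < l * (t - c) < pi / 2 ->
  is_derive t 1 (fun s : R => l * tan (l * (s - c)))
    (l ^+ 2 + (l * tan (l * (t - c))) ^+ 2).
Proof.
move=> H; have c0 : cos (l * (t - c)) != 0 by rewrite gt_eqF// cos_gt0_pihalf.
have H2 := is_derive_tan c0.
have H3 : is_derive t 1 (tan \o (fun s : R => l * (s - c))) (l * cos (l * (t - c)) ^- 2).
  rewrite mulrC; apply: is_derive1_comp => //; exact: is_derive1_affine.
have H4 := is_derive1Z l H3.
suff -> : l ^+ 2 + (l * tan (l * (t - c))) ^+ 2 = l * (l * cos (l * (t - c)) ^- 2).
  exact: H4.
rewrite /tan exprMn expr_div_n.
have <- : 1 - cos (l * (t - c)) ^+ 2 = sin (l * (t - c)) ^+ 2.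
  by rewrite -(cos2Dsin2 (l * (t - c))); ring.
by field.
Qed.

Lemma within_continuous_shift a b c d (s : R) f : a <= c + s -> d + s <= b ->
  {within `[a, b], continuous f} -> {within `[c, d], continuous (fun t => f (t + s))}.
Proof.
move=> ac db /subspace_continuousP cf; apply/subspace_continuousP => x xcd P HP.
have xs : `[a, b]%classic (x + s).
  move: xcd; rewrite /= !in_itv/= => /andP[cx xd].
  by rewrite (le_trans ac) ?lerD2r//= (le_trans _ db)// lerD2r.
have N : \forall y \near x + s, `[a, b]%classic y -> P (f y) := cf _ xs P HP.
have cs : (t + s @[t --> x]) --> x + s by apply: cvgD; [exact: cvg_id|exact: cvg_cst].
have := cs _ N; rewrite -/(\forall t \near x, (`[a, b]%classic (t + s) -> P (f (t + s)))).
move=> N'; suff : \forall t \near x, `[c, d]%classic t -> P (f (t + s)) by [].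
apply: (@filterS _ _ (nbhs_filter x) _ _ _ N') => t /= H.
rewrite in_itv/= => /andP[ct td]; apply: H; rewrite in_itv/=.
by rewrite (le_trans ac) ?lerD2r//= (le_trans _ db)// lerD2r.
Qed.

(* The boundary terms of [picone] vanish where f does, and cancel at 0 and 2 pi by periodicity. *)
Lemma wirtinger_vanishing (p t0 : R) f g : p = pi -> 0 <= t0 -> t0 <= p / 2 ->
  sobolev_on 0 (2 * p) f g -> f 0 = f (2 * p) ->
  f t0 = 0 -> f (t0 + p / 2) = 0 -> f (t0 + p) = 0 -> f (t0 + 3 * p / 2) = 0 ->
  4 * ip 0 (2 * p) f f <= ip 0 (2 * p) g g.
Proof.
move=> pE t00 t0p sfg f02 v0 v1 v2 v3.
have pi0 : 0 < p by rewrite pE pi_gt0.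
have tan_der (l c t : R) : - (p / 2) < l * (t - c) -> l * (t - c) < p / 2 ->
    is_derive t 1 (fun s : R => l * tan (l * (s - c)))
      (l ^+ 2 + (l * tan (l * (t - c))) ^+ 2).
  by rewrite pE => h1 h2; apply: is_derive_tan_scale; rewrite h1 h2.
clear pE.
have two0 : 0 <= 2 * p by lra.
(* At l = 2 the tangent is infinite exactly at the ends of an interval of length p / 2. Every l < 2
   is safe, and l then tends to 2. *)
suff H (l : R) : 0 < l < 2 -> l ^+ 2 * ip 0 (2 * p) f f <= ip 0 (2 * p) g g.
  have F0 := ip_ge0 0 (2 * p) f.
  rewrite leNgt; apply/negP => lt4.
  set F := ip _ _ f f in F0 lt4 H *; set G := ip _ _ g g in lt4 H *.
  (* With l = 2 - e the loss is at most 4 e F, below the assumed gap 4 F - G. The bound by 1 keeps l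
     positive, and the added 1 keeps the denominator positive when F = 0. *)
  pose e := Num.min 1 ((4 * F - G) / (8 * F + 1)).
  have Fp : 0 < 8 * F + 1 by lra.
  have e0 : 0 < e by rewrite lt_min ltr01/= divr_gt0//; lra.
  have e1 : e <= 1 by rewrite ge_min lexx.
  have e2 : e * (8 * F + 1) <= 4 * F - G by rewrite -ler_pdivlMr// ge_min lexx orbT.
  have := H (2 - e); have -> : 0 < 2 - e < 2 by apply/andP; split; lra.
  move=> /(_ isT).
  have : 0 <= e ^+ 2 * F by rewrite mulr_ge0// sqr_ge0.
  rewrite sqrrB. clear - e0 e1 e2 F0 lt4 Fp; nra.
move=> /andP[l0 l2].
have quarter a b c : 0 <= a -> a <= b -> b <= 2 * p -> c - p / 4 <= a -> b <= c + p / 4 ->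
    f a ^+ 2 * (l * tan (l * (a - c))) - f b ^+ 2 * (l * tan (l * (b - c))) <=
    ip a b g g - l ^+ 2 * ip a b f f.
  move=> a0 ab b2 ca bc.
  apply: (@picone _ a b l f g (fun t => l * tan (l * (t - c)))
    (fun t => l ^+ 2 + (l * tan (l * (t - c))) ^+ 2) ab).
  - exact: (sobolev_onS a0 ab b2 sfg).
  - move=> t /andP[at_ tb]; apply: tan_der; clear - l0 l2 at_ tb ca bc pi0; nra.
  - by move=> t _.
(* On the circle the zeros cut four arcs of length p / 2. The arc through the origin is met twice,
   with centres t0 - p / 4 and t0 + 7 p / 4 that differ by a full period, so the tangents at 0 and 2
   p agree. *)
have q0 := quarter 0 t0 (t0 - p / 4).
have q1 := quarter t0 (t0 + p / 2) (t0 + p / 4).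
have q2 := quarter (t0 + p / 2) (t0 + p) (t0 + 3 * p / 4).
have q3 := quarter (t0 + p) (t0 + 3 * p / 2) (t0 + 5 * p / 4).
have q4 := quarter (t0 + 3 * p / 2) (2 * p) (t0 + 7 * p / 4).
clear quarter tan_der.
have split5 h : sqint 0 (2 * p) h -> ip 0 (2 * p) h h = ip 0 t0 h h +
    ip t0 (t0 + p / 2) h h + ip (t0 + p / 2) (t0 + p) h h +
    ip (t0 + p) (t0 + 3 * p / 2) h h + ip (t0 + 3 * p / 2) (2 * p) h h.
  move=> sh; have ih := integrable_sqintM sh sh.
  have S b c : 0 <= b -> b <= c -> c <= 2 * p ->
      ip 0 c h h = ip 0 b h h + ip b c h h.
    move=> b0 bc c2; apply: Rintegral_split b0 bc _.
    exact: integrable_itvS (lexx 0) c2 ih.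
  have S4 := S (t0 + 3 * p / 2) (2 * p)
    ltac:(clear - pi0 t00 t0p; lra) ltac:(clear - pi0 t00 t0p; lra)
    ltac:(clear - pi0 t00 t0p; lra).
  have S3 := S (t0 + p) (t0 + 3 * p / 2)
    ltac:(clear - pi0 t00 t0p; lra) ltac:(clear - pi0 t00 t0p; lra)
    ltac:(clear - pi0 t00 t0p; lra).
  have S2 := S (t0 + p / 2) (t0 + p)
    ltac:(clear - pi0 t00 t0p; lra) ltac:(clear - pi0 t00 t0p; lra)
    ltac:(clear - pi0 t00 t0p; lra).
  have S1 := S t0 (t0 + p / 2)
    ltac:(clear - pi0 t00 t0p; lra) ltac:(clear - pi0 t00 t0p; lra)
    ltac:(clear - pi0 t00 t0p; lra).
  by rewrite S4 S3 S2 S1.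
have sf := sobolev_on_sqint two0 sfg.
rewrite (split5 f sf) (split5 g sfg.2).
move: q0 q1 q2 q3 q4; rewrite v0 v1 v2 v3 f02.
have -> : 2 * p - (t0 + 7 * p / 4) = 0 - (t0 - p / 4) by clear; field.
rewrite expr0n/= !mul0r.
move: (ip 0 t0 g g) (ip 0 t0 f f) (ip t0 (t0 + p / 2) g g) (ip t0 (t0 + p / 2) f f)
  (ip (t0 + p / 2) (t0 + p) g g) (ip (t0 + p / 2) (t0 + p) f f)
  (ip (t0 + p) (t0 + 3 * p / 2) g g) (ip (t0 + p) (t0 + 3 * p / 2) f f)
  (ip (t0 + 3 * p / 2) (2 * p) g g) (ip (t0 + 3 * p / 2) (2 * p) f f)
  (f (2 * p) ^+ 2 * (l * tan (l * (0 - (t0 - p / 4))))).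
move=> G0 F0 G1 F1 G2 F2 G3 F3 G4 F4 B q0 q1 q2 q3 q4.
have {}q0 := q0
  ltac:(clear - pi0 t00 t0p; lra) ltac:(clear - pi0 t00 t0p; lra)
  ltac:(clear - pi0 t00 t0p; lra) ltac:(clear - pi0 t00 t0p; lra)
  ltac:(clear - pi0 t00 t0p; lra).
have {}q1 := q1
  ltac:(clear - pi0 t00 t0p; lra) ltac:(clear - pi0 t00 t0p; lra)
  ltac:(clear - pi0 t00 t0p; lra) ltac:(clear - pi0 t00 t0p; lra)
  ltac:(clear - pi0 t00 t0p; lra).
have {}q2 := q2
  ltac:(clear - pi0 t00 t0p; lra) ltac:(clear - pi0 t00 t0p; lra)
  ltac:(clear - pi0 t00 t0p; lra) ltac:(clear - pi0 t00 t0p; lra)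
  ltac:(clear - pi0 t00 t0p; lra).
have {}q3 := q3
  ltac:(clear - pi0 t00 t0p; lra) ltac:(clear - pi0 t00 t0p; lra)
  ltac:(clear - pi0 t00 t0p; lra) ltac:(clear - pi0 t00 t0p; lra)
  ltac:(clear - pi0 t00 t0p; lra).
have {}q4 := q4
  ltac:(clear - pi0 t00 t0p; lra) ltac:(clear - pi0 t00 t0p; lra)
  ltac:(clear - pi0 t00 t0p; lra) ltac:(clear - pi0 t00 t0p; lra)
  ltac:(clear - pi0 t00 t0p; lra).
rewrite !mulrDr.
clear - q0 q1 q2 q3 q4; lra.
Qed.

Lemma sobolev_on_cos a b : a <= b -> sobolev_on a b (@cos R) (fun t => - sin t).
Proof.
move=> ab; apply: sobolev_on_C1 => //.
by apply: continuous_subspaceT => x; apply: cvgN; exact: continuous_sin.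
Qed.

Lemma sobolev_on_sin a b : a <= b -> sobolev_on a b (@sin R) (@cos R).
Proof.
move=> ab; apply: sobolev_on_C1 => //.
by apply: continuous_subspaceT; exact: continuous_cos.
Qed.

Lemma sobolev_on_cst a b (k : R) : sobolev_on a b (cst k) (cst 0).
Proof. by split; [exact: primitive_on_cst|exact: sqint_cst]. Qed.

Lemma two_pi_ge0 : 0 <= 2 * pi :> R. Proof. by rewrite mulr_ge0// pi_ge0. Qed.
Lemma cos_2pi : cos (2 * pi) = 1 :> R. Proof. by rewrite mulr_natl cos2pi. Qed.
Lemma sin_2pi : sin (2 * pi) = 0 :> R. Proof. by rewrite mulr_natl sin2pi. Qed.
Notation ipp := (ip 0 (2 * pi)).

Hint Resolve two_pi_ge0 : core.

Lemma ip_cst (k l : R) : ipp (cst k) (cst l) = 2 * pi * (k * l).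
Proof.
rewrite /ip (_ : (fun t => _) = cst (k * l))// Rintegral_cst//.
have p0 : 0 < 2 * pi :> R by rewrite mulr_gt0// pi_gt0.
have /= := @lebesgue_measure_itv R `[0, 2 * pi].
by rewrite lte_fin p0 sube0 => -> /=; rewrite mulrC.
Qed.

Lemma sqint_cos : sqint 0 (2 * pi) (@cos R).
Proof. exact: (sobolev_on_sqint two_pi_ge0 (sobolev_on_cos two_pi_ge0)). Qed.
Lemma sqint_sin : sqint 0 (2 * pi) (@sin R).
Proof. exact: (sobolev_on_sqint two_pi_ge0 (sobolev_on_sin two_pi_ge0)). Qed.

Hint Resolve sqint_cos sqint_sin sqint_cst : core.

Lemma ip1_cos : ipp (cst 1) (@cos R) = 0.
Proof.
have := ip_by_parts two_pi_ge0 (primitive_on_cst _ _ 1) (sobolev_on_sin two_pi_ge0).1.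
by rewrite sin_2pi sin0 !mulr0 subrr ip0l add0r.
Qed.

Lemma ip1_sin : ipp (cst 1) (@sin R) = 0.
Proof.
have := ip_by_parts two_pi_ge0 (primitive_on_cst _ _ 1) (sobolev_on_cos two_pi_ge0).1.
rewrite cos_2pi cos0 subrr ip0l add0r ipNr// => /eqP.
by rewrite oppr_eq0 => /eqP.
Qed.

Lemma ip_cos_sin : ipp (@cos R) (@sin R) = 0.
Proof.
have := ip_by_parts two_pi_ge0 (sobolev_on_sin two_pi_ge0).1 (sobolev_on_sin two_pi_ge0).1.
by rewrite sin_2pi sin0 !mul0r subrr (ipC _ _ sin cos) => ?; lra.
Qed.

Lemma ip_cos_cos_sin_sin : ipp (@cos R) (@cos R) = pi /\ ipp (@sin R) (@sin R) = pi.
Proof.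
have := ip_by_parts two_pi_ge0 (sobolev_on_cos two_pi_ge0).1 (sobolev_on_sin two_pi_ge0).1.
rewrite sin_2pi sin0 !mulr0 subrr.
rewrite ipNl// => E1.
have E2 : ipp (@cos R) (@cos R) + ipp (@sin R) (@sin R) = ipp (cst 1) (cst 1).
  rewrite /ip -RintegralD//; try exact: integrable_sqintM.
  by apply: eq_Rintegral => t _; rewrite -!expr2 cos2Dsin2 expr1n.
move: E2; rewrite ip_cst !mulr1 => E2.
by split; lra.
Qed.

(** Integration by parts, with boundary terms that cancel by periodicity. Orthogonality to
    trigonometric polynomials of order one thus passes from f to g. *)
Lemma ip_vanish (f g : R -> R) : sobolev_on 0 (2 * pi) f g -> f 0 = f (2 * pi) ->
  [/\ ipp (cst 1) g = 0, ipp cos g = ipp sin f & ipp sin g = - ipp cos f].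
Proof.
move=> sfg f02; have sf := sobolev_on_sqint two_pi_ge0 sfg.
have [pf sg] := sfg.
split.
- have := ip_by_parts two_pi_ge0 (primitive_on_cst _ _ 1) pf.
  by rewrite ip0l add0r f02 subrr.
- have := ip_by_parts two_pi_ge0 (sobolev_on_cos two_pi_ge0).1 pf.
  by rewrite cos_2pi cos0 f02 subrr ipNl// => /eqP; rewrite addrC subr_eq0 => /eqP.
- have := ip_by_parts two_pi_ge0 (sobolev_on_sin two_pi_ge0).1 pf.
  by rewrite sin_2pi sin0 !mul0r subrr => /eqP; rewrite addrC addr_eq0 => /eqP.
Qed.

Definition trig1 (q r w : R) : R -> R := fun t => q + (r * cos t + w * sin t).

Lemma sobolev_on_trig1 a b (q r w : R) : a <= b ->
  sobolev_on a b (trig1 q r w) (trig1 0 w (- r)).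
Proof.
move=> ab.
have -> : trig1 0 w (- r) = (fun t => cst 0 t + (r * (- sin t) + w * cos t)).
  by apply/funext => t; rewrite /trig1 /=; ring.
apply: sobolev_onD; first exact: sobolev_on_cst.
by apply: sobolev_onD; apply: sobolev_onZ; [exact: sobolev_on_cos|exact: sobolev_on_sin].
Qed.

Lemma sqint_trig1 (q r w : R) : sqint 0 (2 * pi) (trig1 q r w).
Proof. exact: sobolev_on_sqint (sobolev_on_trig1 q r w _). Qed.

Hint Resolve sqint_trig1 : core.

Lemma ip_trig1 (q r w : R) h : sqint 0 (2 * pi) h ->
  ipp (trig1 q r w) h = q * ipp (cst 1) h + (r * ipp cos h + w * ipp sin h).
Proof.
move=> sh; have sZ (k : R) h' : sqint 0 (2 * pi) h' -> sqint 0 (2 * pi) (fun t => k * h' t).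
  exact: sqintZ.
rewrite -!ipZl// -!ipDl//; try (by apply: sqintD; apply: sZ); try exact: sZ.
by apply: eq_Rintegral => t _; rewrite /trig1/= mulr1.
Qed.

Lemma ip_trig1_trig1 (q r w q' r' w' : R) :
  ipp (trig1 q r w) (trig1 q' r' w') = pi * (2 * (q * q') + r * r' + w * w').
Proof.
have [cc ss] := ip_cos_cos_sin_sin.
rewrite ip_trig1// (ipC _ _ (cst 1)) (ipC _ _ cos) (ipC _ _ sin) !ip_trig1//.
rewrite ip_cst (ipC _ _ cos (cst 1)) (ipC _ _ sin (cst 1)) (ipC _ _ sin cos).
by rewrite ip1_cos ip1_sin ip_cos_sin cc ss; ring.
Qed.

(* Subtracting a first-order trigonometric polynomial makes f vanish at the four
   points t0 + k pi / 2; this is possible exactly when the alternating sum of the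
   values of f there is 0, which determines t0. *)
Lemma wirtinger f g : sobolev_on 0 (2 * pi) f g -> f 0 = f (2 * pi) ->
  ipp (cst 1) f = 0 -> ipp cos f = 0 -> ipp sin f = 0 ->
  4 * ipp f f <= ipp g g.
Proof.
move=> sfg f02 f1 fc fs.
have [pp pE] : exists p : R, p = pi by exists pi.
have p0 : 0 < pp by rewrite pE pi_gt0.
have [t0 [t00 t0p alt]] : exists t0, [/\ 0 <= t0, t0 <= pp / 2 &
    f t0 - f (t0 + pp / 2) + f (t0 + pp) - f (t0 + 3 * pp / 2) = 0].
  have cf := primitive_on_continuous two_pi_ge0 sfg.1; rewrite -pE in cf f02.
  pose D t := f (t + 0) - f (t + pp / 2) + f (t + pp) - f (t + 3 * pp / 2).
  have sh s : 0 <= s -> s <= 3 * pp / 2 ->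
      {within `[0, (pp / 2)], continuous (fun t => f (t + s))}.
    move=> s0 s3; apply: within_continuous_shift cf; clear - s0 s3 p0; lra.
  have cD : {within `[0, (pp / 2)], continuous D}.
    have h0 := sh 0 ltac:(clear - p0; lra) ltac:(clear - p0; lra).
    have h1 := sh (pp / 2) ltac:(clear - p0; lra) ltac:(clear - p0; lra).
    have h2 := sh pp ltac:(clear - p0; lra) ltac:(clear - p0; lra).
    have h3 := sh (3 * pp / 2) ltac:(clear - p0; lra) ltac:(clear - p0; lra).
    by move=> x; apply: cvgB; [apply: cvgD; [apply: cvgB|]|]; [exact: h0|exact: h1|exact: h2|exact: h3].
  (* A quarter turn permutes the four sample points cyclically, so it reverses the alternating sum,
     which must vanish in between. *)
  have DN : D (pp / 2) = - D 0.
    rewrite /D !add0r !addr0 -(splitr pp).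
    have -> : pp / 2 + pp = 3 * pp / 2 by clear; field.
    have -> : pp / 2 + 3 * pp / 2 = 2 * pp by clear; field.
    by rewrite f02; ring.
  have := @IVT R D 0 (pp / 2) 0 ltac:(clear - p0; lra) cD.
  rewrite DN; case.
    rewrite ge_min le_max oppr_le0 oppr_ge0.
    by case/orP: (le_total (D 0) 0) => ->; rewrite ?orbT.
  move=> t; rewrite in_itv/= => /andP[t0 t1] Dt; exists t; split => //.
  by rewrite -Dt /D addr0.
rewrite -pE in f02 f1 fc fs sfg *.
pose a0 := f t0; pose a1 := f (t0 + pp / 2); pose a2 := f (t0 + pp); pose a3 := f (t0 + 3 * pp / 2).
(* The polynomial is q + u cos(t - t0) + v sin(t - t0), expanded with coefficients r and w. Its
   values at the four points are q + u, q + v, q - u, q - v: three parameters fit four values once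
   the alternating sum is 0. *)
pose q := (a0 + a2) / 2; pose u := (a0 - a2) / 2; pose v := (a1 - a3) / 2.
pose r := u * cos t0 - v * sin t0; pose w := u * sin t0 + v * cos t0.
have tp0 : 0 <= 2 * pp by clear - p0; lra.
have sh : sobolev_on 0 (2 * pp) (fun t => f t + -1 * trig1 q r w t)
    (fun t => g t + -1 * trig1 0 w (- r) t).
  by apply: sobolev_onD => //; apply: sobolev_onZ; exact: sobolev_on_trig1.
have cs := cos2Dsin2 t0.
have pio2 : pp / 2 + pp = 3 * pp / 2 by clear; field.
have cos1 : cos (t0 + pp / 2) = - sin t0 by rewrite pE cosDpihalf.
have sin1 : sin (t0 + pp / 2) = cos t0 by rewrite pE sinDpihalf.
have cos2 : cos (t0 + pp) = - cos t0 by rewrite pE cosDpi.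
have sin2 : sin (t0 + pp) = - sin t0 by rewrite pE sinDpi.
have cos3 : cos (t0 + 3 * pp / 2) = sin t0 by rewrite -pio2 addrA {2}pE cosDpi cos1 opprK.
have sin3 : sin (t0 + 3 * pp / 2) = - cos t0 by rewrite -pio2 addrA {2}pE sinDpi sin1.
have e0 : trig1 q r w t0 = f t0.
  transitivity (q + u * (cos t0 ^+ 2 + sin t0 ^+ 2)).
    by rewrite /trig1 /r /w; generalize q u v (cos t0) (sin t0); clear; move=> *; ring.
  by rewrite cs /q /u /a0; field.
have e1 : trig1 q r w (t0 + pp / 2) = f (t0 + pp / 2).
  transitivity (q + v * (cos t0 ^+ 2 + sin t0 ^+ 2)).
    by rewrite /trig1 cos1 sin1 /r /w; generalize q u v (cos t0) (sin t0); clear; move=> *; ring.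
  by rewrite cs /q /v /a0 /a1 /a2 /a3; clear - alt; lra.
have e2 : trig1 q r w (t0 + pp) = f (t0 + pp).
  transitivity (q - u * (cos t0 ^+ 2 + sin t0 ^+ 2)).
    by rewrite /trig1 cos2 sin2 /r /w; generalize q u v (cos t0) (sin t0); clear; move=> *; ring.
  by rewrite cs /q /u /a0 /a2; field.
have e3 : trig1 q r w (t0 + 3 * pp / 2) = f (t0 + 3 * pp / 2).
  transitivity (q - v * (cos t0 ^+ 2 + sin t0 ^+ 2)).
    by rewrite /trig1 cos3 sin3 /r /w; generalize q u v (cos t0) (sin t0); clear; move=> *; ring.
  by rewrite cs /q /v /a0 /a1 /a2 /a3; clear - alt; lra.
have e02 : trig1 q r w 0 = trig1 q r w (2 * pp).
  by rewrite /trig1 pE cos_2pi sin_2pi cos0 sin0.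
have := wirtinger_vanishing pE t00 t0p sh.
rewrite e0 e1 e2 e3 e02 f02 !mulN1r !subrr => /(_ erefl erefl erefl erefl erefl).
have sf := sobolev_on_sqint tp0 sfg; have sg := sfg.2.
have [g1 gc gs] := ip_vanish (eq_ind pp (fun x => sobolev_on 0 (2 * x) f g) sfg _ pE)
  (eq_ind pp (fun x => f 0 = f (2 * x)) f02 _ pE).
rewrite -pE in g1 gc gs.
have st q' r' w' : sqint 0 (2 * pp) (trig1 q' r' w') by rewrite pE.
have tf q' r' w' : ip 0 (2 * pp) (trig1 q' r' w') f = 0.
  by move: sf; rewrite pE => ?; rewrite ip_trig1// -pE f1 fc fs !mulr0 !addr0.
have tg q' r' w' : ip 0 (2 * pp) (trig1 q' r' w') g = 0.
  by move: sg; rewrite pE => ?; rewrite ip_trig1// -pE g1 gc gs fs fc oppr0 !mulr0 !addr0.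
have tt q' r' w' : ip 0 (2 * pp) (trig1 q' r' w') (trig1 q' r' w') =
    pp * (2 * q' ^+ 2 + r' ^+ 2 + w' ^+ 2).
  by rewrite pE ip_trig1_trig1 !expr2.
have sZ q' r' w' : sqint 0 (2 * pp) (fun t => -1 * trig1 q' r' w' t) by exact: sqintZ.
have ex h q' r' w' : sqint 0 (2 * pp) h -> ip 0 (2 * pp) (trig1 q' r' w') h = 0 ->
    ip 0 (2 * pp) (fun t => h t + -1 * trig1 q' r' w' t) (fun t => h t + -1 * trig1 q' r' w' t)
    = ip 0 (2 * pp) h h + pp * (2 * q' ^+ 2 + r' ^+ 2 + w' ^+ 2).
  move=> hh h0; rewrite ipDl ?ipDr//; last exact: sqintD.
  by rewrite !ipZl// !ipZr// tt (ipC _ _ h) h0; ring.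
rewrite !ex// sqrrN expr0n/=.
move: (ip _ _ f f) (ip _ _ g g) => F G H.
(* By orthogonality, subtracting the polynomial adds 4 pp (2 q^2 + r^2 + w^2) on the left and only
   pp (r^2 + w^2) on the right, so the inequality for the difference is stronger than the one for f
   by this amount. *)
have : 0 <= pp * (8 * q ^+ 2 + 3 * r ^+ 2 + 3 * w ^+ 2).
  apply: mulr_ge0; first exact: ltW.
  have := sqr_ge0 q; have := sqr_ge0 r; have := sqr_ge0 w.
  by move: (q ^+ 2) (r ^+ 2) (w ^+ 2); clear; move=> *; lra.
move: H; rewrite !mulrDr; clear; lra.
Qed.

End Wirtinger.

(** * The quadratic form with constant coefficients and its first modes *)

Section KeplerForm.
Context {R : realType}.
Notation mu := (@lebesgue_measure R).
Implicit Types (f g h x y : R -> R) (A k : R).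
Notation ipp := (ip 0 (2 * pi)).
Hint Resolve two_pi_ge0 sqint_cos sqint_sin sqint_cst sqint_trig1 : core.

Definition trig_orth h := forall q r w : R, ipp (trig1 q r w) h = 0.

(** The first Fourier coefficients are explicit because they become the linear functionals that
    bound the index; the mean only enters a nonnegative term and stays existential. *)
Lemma trig_split x x' : sobolev_on 0 (2 * pi) x x' -> x 0 = x (2 * pi) ->
  exists q g g',
    let r := ipp cos x / pi in let w := ipp sin x / pi in
    [/\ sobolev_on 0 (2 * pi) g g' /\ g 0 = g (2 * pi), trig_orth g, trig_orth g',
      x = (fun t => trig1 q r w t + g t) &
      x' = (fun t => trig1 0 w (- r) t + g' t)].
Proof.
move=> sx x02; have ssx := sobolev_on_sqint (two_pi_ge0 (R := R)) sx.
pose q := ipp (cst 1) x / (2 * pi).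
pose r := ipp cos x / pi; pose w := ipp sin x / pi.
pose g t := x t + -1 * trig1 q r w t; pose g' t := x' t + -1 * trig1 0 w (- r) t.
have sg : sobolev_on 0 (2 * pi) g g'.
  by apply: sobolev_onD => //; apply: sobolev_onZ; exact: sobolev_on_trig1.
have g02 : g 0 = g (2 * pi).
  by rewrite /g /trig1 x02 cos_2pi sin_2pi cos0 sin0.
have pi0 : pi != 0 :> R by rewrite gt_eqF ?pi_gt0.
have perp q' r' w' : ipp (trig1 q' r' w') g = 0.
  rewrite ipDr ?ipZr ?ip_trig1_trig1 ?ip_trig1//; last exact: sqintZ.
  rewrite /q /r /w; move: (ipp (cst 1) x) (ipp cos x) (ipp sin x).
  by move: pi0; generalize (pi : R); clear => p p0 a b c; field.
exists q, g, g' => /=; split => //.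
- move=> q' r' w'; rewrite ip_trig1; last exact: sg.2.
  have [-> -> ->] := ip_vanish sg g02.
  have := perp 0 1 0; have := perp 0 0 1.
  rewrite !ip_trig1; try exact: (sobolev_on_sqint _ sg).
  by rewrite !(mul0r, mul1r, addr0, add0r) => -> ->; rewrite oppr0 !mulr0 !addr0.
- by apply/funext => t; rewrite /g; ring.
- by apply/funext => t; rewrite /g'; ring.
Qed.

Lemma ip_trig_split q r w q' r' w' g g1 : sqint 0 (2 * pi) g -> sqint 0 (2 * pi) g1 ->
  trig_orth g -> trig_orth g1 ->
  ipp (fun t => trig1 q r w t + g t) (fun t => trig1 q' r' w' t + g1 t) =
  pi * (2 * (q * q') + r * r' + w * w') + ipp g g1.
Proof.
move=> sg sg1 pg pg1.
have st1 := sqint_trig1 q r w; have st2 := sqint_trig1 q' r' w'.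
rewrite (ipDl st1 sg (sqintD st2 sg1)) (ipDr st2 sg1 st1) (ipDr st2 sg1 sg).
by rewrite ip_trig1_trig1 pg1 (ipC _ _ g) pg addr0 add0r.
Qed.

(* The integral of |z' + i z|^2 + (A - 1) |z|^2 + A Re (k z^2) for z = x + i y
   periodic, 2 (x y' - x' y) being integrated by parts. *)
Definition kepler_form A k1 k2 x x' y y' : R :=
  ipp x' x' + ipp y' y' + 4 * ipp x y' + A * (ipp x x + ipp y y) +
  A * (k1 * (ipp x x - ipp y y) - 2 * k2 * ipp x y).

(** On z = (n exp(it) + m exp(-it)) / 2, with m = m1 + i m2 and n = n1 + i n2, the form is pi times
    this. The operator z' + i z multiplies exp(it) by 2 i and kills exp(-it), whence the weights A +
    3 = 4 + (A - 1) and A - 1; the coupling is A Re (k m n). *)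
Definition kepler_mode A k1 k2 (m1 m2 n1 n2 : R) : R :=
  2^-1 * (A + 3) * (n1 ^+ 2 + n2 ^+ 2) + 2^-1 * (A - 1) * (m1 ^+ 2 + m2 ^+ 2) +
  A * (k1 * (m1 * n1 - m2 * n2) - k2 * (m1 * n2 + m2 * n1)).

(** Completing the square in n, whose weight A + 3 is positive, leaves a multiple of |m|^2 with the
    sign of (A + 3) (A - 1) - A^2 |k|^2. *)
Lemma kepler_mode_ge0 A k1 k2 (m1 m2 n1 n2 : R) : 1 <= A ->
  A ^+ 2 * (k1 ^+ 2 + k2 ^+ 2) <= (A + 3) * (A - 1) ->
  0 <= kepler_mode A k1 k2 m1 m2 n1 n2.
Proof.
move=> A1 H; have A3 : 0 < A + 3 by lra.
rewrite -(pmulr_rge0 _ A3).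
suff -> : (A + 3) * kepler_mode A k1 k2 m1 m2 n1 n2 =
  2^-1 * (((A + 3) * n1 + A * (k1 * m1 - k2 * m2)) ^+ 2 +
          ((A + 3) * n2 - A * (k1 * m2 + k2 * m1)) ^+ 2 +
   ((A + 3) * (A - 1) - A ^+ 2 * (k1 ^+ 2 + k2 ^+ 2)) * (m1 ^+ 2 + m2 ^+ 2)).
  by rewrite mulr_ge0// !addr_ge0 ?sqr_ge0// mulr_ge0 ?subr_ge0// addr_ge0 ?sqr_ge0.
by rewrite /kepler_mode; field.
Qed.

Lemma kepler_mode_ge0_codim2 A k1 k2 (n1 n2 : R) : 1 <= A ->
  0 <= kepler_mode A k1 k2 0 0 n1 n2.
Proof.
move=> A1; have -> : kepler_mode A k1 k2 0 0 n1 n2 = 2^-1 * (A + 3) * (n1 ^+ 2 + n2 ^+ 2).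
  by rewrite /kepler_mode; ring.
by rewrite mulr_ge0 ?addr_ge0 ?sqr_ge0// mulr_ge0 ?invr_ge0//; lra.
Qed.

(** At n = - A conj(k m) / (A + 3) the completed squares vanish and only the determinant term
    remains. *)
Lemma kepler_mode_lt0 A k1 k2 (m1 m2 : R) : 1 <= A ->
  (A + 3) * (A - 1) < A ^+ 2 * (k1 ^+ 2 + k2 ^+ 2) ->
  (m1 != 0) || (m2 != 0) ->
  kepler_mode A k1 k2 m1 m2 (- (A * (k1 * m1 - k2 * m2)) / (A + 3))
    (A * (k1 * m2 + k2 * m1) / (A + 3)) < 0.
Proof.
move=> A1 H m0; have A3 : 0 < A + 3 by lra.
rewrite -(pmulr_rlt0 _ A3).
have -> : (A + 3) * kepler_mode A k1 k2 m1 m2 (- (A * (k1 * m1 - k2 * m2)) / (A + 3))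
    (A * (k1 * m2 + k2 * m1) / (A + 3)) =
  2^-1 * (((A + 3) * (A - 1) - A ^+ 2 * (k1 ^+ 2 + k2 ^+ 2)) * (m1 ^+ 2 + m2 ^+ 2)).
  by rewrite /kepler_mode; field; rewrite gt_eqF.
have mp : 0 < m1 ^+ 2 + m2 ^+ 2.
  rewrite lt_neqAle addr_ge0 ?sqr_ge0// andbT eq_sym paddr_eq0 ?sqr_ge0//.
  by rewrite !sqrf_eq0 negb_and.
by rewrite pmulr_rlt0// nmulr_rlt0// subr_lt0.
Qed.

(** X, Y, Z form a Gram matrix, and the conclusion is the nonnegativity of |z|^2 + Re (k z^2) once
    integrated. Positivity is assumed as a pencil in order to be evaluated at (1 + k1, - k2): this
    value plus (1 - |k|^2) Y is 1 + k1 times the claim. If k1 = -1, then k2 = 0 and the claim is 2 Y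
    >= 0. *)
Lemma traceless_bound k1 k2 (X Y Z : R) : k1 ^+ 2 + k2 ^+ 2 <= 1 ->
  0 <= X -> 0 <= Y -> (forall u v : R, 0 <= u ^+ 2 * X + 2 * u * v * Z + v ^+ 2 * Y) ->
  0 <= X + Y + (k1 * (X - Y) - 2 * k2 * Z).
Proof.
move=> kk X0 Y0 H.
have k1b : -1 <= k1 by nra.
have [E|E] := eqVneq k1 (-1).
  have : k2 = 0 by apply/eqP; rewrite -sqrf_eq0; apply/eqP; have := sqr_ge0 k2; rewrite E in kk; lra.
  by move=> ->; rewrite E; lra.
have p0 : 0 < 1 + k1 by rewrite lt_neqAle; apply/andP; split; [apply/negP => /eqP ?; case/eqP: E; lra|lra].
rewrite -(pmulr_rge0 _ p0).
have := H (1 + k1) (- k2).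
have : 0 <= (1 - (k1 ^+ 2 + k2 ^+ 2)) * Y by rewrite mulr_ge0// subr_ge0.
lra.
Qed.

Lemma ip_pencil f g (u v : R) : sqint 0 (2 * pi) f -> sqint 0 (2 * pi) g ->
  0 <= u ^+ 2 * ipp f f + 2 * u * v * ipp f g + v ^+ 2 * ipp g g.
Proof.
move=> sf sg; have := ip_ge0 0 (2 * pi) (fun t => u * f t + v * g t).
have s1 := sqintZ u sf; have s2 := sqintZ v sg; have s3 := sqintD s1 s2.
rewrite ipDl// !ipDr// !ipZl// !ipZr// (ipC _ _ g f).
by apply: etrans; congr (0 <= _); ring.
Qed.

(** The term 4 x y' is completed to (2 x + y')^2 at the price of 4 x^2, which the Wirtinger
    inequality for x pays. *)
Lemma kepler_form_high A k1 k2 x x' y y' : 0 <= A -> k1 ^+ 2 + k2 ^+ 2 <= 1 ->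
  sobolev_on 0 (2 * pi) x x' -> sobolev_on 0 (2 * pi) y y' -> x 0 = x (2 * pi) ->
  trig_orth x -> 0 <= kepler_form A k1 k2 x x' y y'.
Proof.
move=> A0 kk sx sy x02 px.
have ssx := sobolev_on_sqint (two_pi_ge0 (R := R)) sx.
have ssy := sobolev_on_sqint (two_pi_ge0 (R := R)) sy.
have W : 4 * ipp x x <= ipp x' x'.
  apply: (wirtinger sx x02).
  - by have := px 1 0 0; rewrite ip_trig1// !mul0r mul1r !addr0.
  - by have := px 0 1 0; rewrite ip_trig1// !mul0r mul1r addr0 add0r.
  - by have := px 0 0 1; rewrite ip_trig1// !mul0r mul1r !add0r.
have T := traceless_bound kk (ip_ge0 _ _ x) (ip_ge0 _ _ y) (fun u v => ip_pencil u v ssx ssy).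
have S := ip_pencil 2 1 ssx sy.2.
have := mulr_ge0 A0 T; rewrite /kepler_form; move: W S.
move: (ipp x x) (ipp y y) (ipp x y) (ipp x' x') (ipp y' y') (ipp x y').
by clear; move=> *; lra.
Qed.

Definition kepler_density A k1 k2 (x x' y y' : R) : R :=
  (x' - y) ^+ 2 + (y' + x) ^+ 2 + (A - 1) * (x ^+ 2 + y ^+ 2) +
  A * (k1 * (x ^+ 2 - y ^+ 2) - 2 * k2 * (x * y)).

Lemma Rintegral_kepler_density A k1 k2 x x' y y' :
  sobolev_on 0 (2 * pi) x x' -> sobolev_on 0 (2 * pi) y y' ->
  x 0 = x (2 * pi) -> y 0 = y (2 * pi) ->
  let d t := kepler_density A k1 k2 (x t) (x' t) (y t) (y' t) in
  mu.-integrable `[0, 2 * pi] (EFin \o d) /\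
  \int[mu]_(t in `[0, 2 * pi]) d t = kepler_form A k1 k2 x x' y y'.
Proof.
move=> sx sy x02 y02 d.
have ssx := sobolev_on_sqint (two_pi_ge0 (R := R)) sx.
have ssy := sobolev_on_sqint (two_pi_ge0 (R := R)) sy.
have sx' := sx.2; have sy' := sy.2.
have P := ip_by_parts (two_pi_ge0 (R := R)) sx.1 sy.1.
rewrite x02 y02 subrr in P.
have i f g := @integrable_sqintM R 0 (2 * pi) f g.
pose e t := x' t * x' t + (y' t * y' t + (-2 * (x' t * y t) + (2 * (x t * y' t) +
  ((A + A * k1) * (x t * x t) + ((A - A * k1) * (y t * y t) + (-2 * A * k2) * (x t * y t)))))).
have de t : e t = d t by rewrite /d /e /kepler_density; ring.
split.
  apply: (@eq_integrable_itv _ _ _ e) => [t _|]; first exact: de.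
  by repeat (first [exact: i | exact/integrable_itvZ/i | apply: integrable_itvD]).
transitivity (ipp x' x' + (ipp y' y' + (-2 * ipp x' y + (2 * ipp x y' +
  ((A + A * k1) * ipp x x + ((A - A * k1) * ipp y y + (-2 * A * k2) * ipp x y)))))).
  rewrite /ip -!RintegralZl//; try exact: i.
  rewrite -!RintegralD//; try repeat (first [exact: i | exact/integrable_itvZ/i | apply: integrable_itvD]).
  by apply: eq_Rintegral => t _; rewrite -de.
have -> : ipp x' y = - ipp x y' by move/eqP: P; rewrite addr_eq0 => /eqP.
by rewrite /kepler_form; ring.
Qed.

Lemma kepler_form_trig1 A k1 k2 (q1 r1 w1 q2 r2 w2 : R) :
  kepler_form A k1 k2 (trig1 q1 r1 w1) (trig1 0 w1 (- r1)) (trig1 q2 r2 w2) (trig1 0 w2 (- r2)) =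
  pi * (2 * A * (q1 ^+ 2 + q2 ^+ 2 + (k1 * (q1 ^+ 2 - q2 ^+ 2) - 2 * k2 * (q1 * q2))) +
    kepler_mode A k1 k2 (r1 - w2) (w1 + r2) (r1 + w2) (r2 - w1)).
Proof. by rewrite /kepler_form !ip_trig1_trig1 /kepler_mode; field. Qed.

Lemma kepler_form_ge A k1 k2 x x' y y' : 0 <= A -> k1 ^+ 2 + k2 ^+ 2 <= 1 ->
  sobolev_on 0 (2 * pi) x x' -> sobolev_on 0 (2 * pi) y y' ->
  x 0 = x (2 * pi) -> y 0 = y (2 * pi) ->
  pi * kepler_mode A k1 k2 (ipp cos x / pi - ipp sin y / pi) (ipp sin x / pi + ipp cos y / pi)
    (ipp cos x / pi + ipp sin y / pi) (ipp cos y / pi - ipp sin x / pi) <=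
  kepler_form A k1 k2 x x' y y'.
Proof.
move=> A0 kk sx sy x02 y02.
have [q1 [gx [gx' [[sgx gx02] px px' xE xE']]]] := trig_split sx x02.
have [q2 [gy [gy' [[sgy gy02] py py' yE yE']]]] := trig_split sy y02.
move: xE xE' yE yE'.
set r1 := ipp cos x / pi; set w1 := ipp sin x / pi.
set r2 := ipp cos y / pi; set w2 := ipp sin y / pi.
move=> xE xE' yE yE'.
have H := kepler_form_high A0 kk sgx sgy gx02 px.
have ssx := sobolev_on_sqint (two_pi_ge0 (R := R)) sgx.
have ssy := sobolev_on_sqint (two_pi_ge0 (R := R)) sgy.
have sx' := sgx.2; have sy' := sgy.2.
have -> : kepler_form A k1 k2 x x' y y' =
   kepler_form A k1 k2 (trig1 q1 r1 w1) (trig1 0 w1 (- r1)) (trig1 q2 r2 w2) (trig1 0 w2 (- r2))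
   + kepler_form A k1 k2 gx gx' gy gy'.
  rewrite /kepler_form xE xE' yE yE' !ip_trig_split// !ip_trig1_trig1.
  by ring.
rewrite kepler_form_trig1 -[leLHS]addr0 lerD// ler_pM2l ?pi_gt0// lerDr -mulrA.
rewrite mulr_ge0// mulr_ge0//.
(* The two means have the degenerate Gram matrix with entries q1^2, q1 q2, q2^2. *)
apply: traceless_bound => //; rewrite ?sqr_ge0// => u v.
suff -> : u ^+ 2 * q1 ^+ 2 + 2 * u * v * (q1 * q2) + v ^+ 2 * q2 ^+ 2 = (u * q1 + v * q2) ^+ 2.
  exact: sqr_ge0.
by ring.
Qed.

End KeplerForm.

(** * Jacobi coordinates *)

Section Jacobi.
Context {R : realType}.
Variables (m0 m1 m2 h : R).
Hypothesis h2 : h ^+ 2 = 3.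

Let M := m0 + m1 + m2.
Let S := m0 * m1 + m0 * m2 + m1 * m2.
Let P := m0 * m1 * m2.

(* The sides of an equilateral triangle have the directions of the cube roots of
   unity u = (-1/2 + h/2 i, -1/2 - h/2 i, 1), h = +- sqrt 3, the side opposite to
   body i being directed along u_i (up to sign).  The displacement of body i is
   z1 (m_j u_k - m_k u_j) + z2 m_j m_k conj(u_i) for (i, j, k) cyclic: z1 constant
   and real is a homothety, z1 imaginary a rotation, and z2 deforms the triangle. *)
Definition side_re (i : nat) : R := match i with 2 => 1 | _ => - 2^-1 end.
Definition side_im (i : nat) : R := match i with 0 => h / 2 | 1 => - (h / 2) | _ => 0 end.

Definition homo_re (i : nat) : R := match i with
  | 0 => m1 + m2 / 2 | 1 => - m0 - m2 / 2 | _ => (m1 - m0) / 2 end.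
Definition homo_im (i : nat) : R := match i with
  | 0 => m2 * h / 2 | 1 => m2 * h / 2 | _ => - (m0 + m1) * h / 2 end.
Definition shape_re (i : nat) : R := match i with
  | 0 => - (m1 * m2) / 2 | 1 => - (m0 * m2) / 2 | _ => m0 * m1 end.
Definition shape_im (i : nat) : R := match i with
  | 0 => - (m1 * m2) * h / 2 | 1 => m0 * m2 * h / 2 | _ => 0 end.

Definition jac_re (i : nat) (x1 y1 x2 y2 : R) : R :=
  x1 * homo_re i - y1 * homo_im i + x2 * shape_re i - y2 * shape_im i.
Definition jac_im (i : nat) (x1 y1 x2 y2 : R) : R :=
  x1 * homo_im i + y1 * homo_re i + x2 * shape_im i + y2 * shape_re i.

Lemma jac_centered x1 y1 x2 y2 :
  m0 * jac_re 0 x1 y1 x2 y2 + m1 * jac_re 1 x1 y1 x2 y2 + m2 * jac_re 2 x1 y1 x2 y2 = 0 /\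
  m0 * jac_im 0 x1 y1 x2 y2 + m1 * jac_im 1 x1 y1 x2 y2 + m2 * jac_im 2 x1 y1 x2 y2 = 0.
Proof. by split; rewrite /jac_re /jac_im /=; field. Qed.

(** The two complex modes are orthogonal for the mass metric, so the kinetic energy splits with
    weights M S and P S. *)
Lemma jac_norm x1 y1 x2 y2 :
  m0 * (jac_re 0 x1 y1 x2 y2 ^+ 2 + jac_im 0 x1 y1 x2 y2 ^+ 2) +
  m1 * (jac_re 1 x1 y1 x2 y2 ^+ 2 + jac_im 1 x1 y1 x2 y2 ^+ 2) +
  m2 * (jac_re 2 x1 y1 x2 y2 ^+ 2 + jac_im 2 x1 y1 x2 y2 ^+ 2) =
  M * S * (x1 ^+ 2 + y1 ^+ 2) + P * S * (x2 ^+ 2 + y2 ^+ 2).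
Proof.
rewrite /jac_re /jac_im /M /S /P /=.
by field: h2.
Qed.

(** Lagrange's identity: without centring, the two sides differ by the square of the sum of the m_i
    a_i. *)
Lemma centered_norm (a0 a1 a2 : R) : m0 * a0 + m1 * a1 + m2 * a2 = 0 ->
  m0 * m1 * (a0 - a1) ^+ 2 + m0 * m2 * (a0 - a2) ^+ 2 + m1 * m2 * (a1 - a2) ^+ 2 =
  M * (m0 * a0 ^+ 2 + m1 * a1 ^+ 2 + m2 * a2 ^+ 2).
Proof.
move=> c; apply/eqP; rewrite -subr_eq0; apply/eqP.
transitivity (- (m0 * a0 + m1 * a1 + m2 * a2) ^+ 2); first by rewrite /M; ring.
by rewrite c expr0n/= oppr0.
Qed.

(** The number k = [kre] + i [kim] is the barycentre of masses m_i placed at the cube roots of unity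
    conj(u_i) = u_i^2, whence |k| <= 1. *)
Definition kre : R := (m2 - (m0 + m1) / 2) / M.
Definition kim : R := - (h / 2) * (m0 - m1) / M.

(** Here [d i j k] is the component of the relative displacement along side ij, whose direction is
    u_k. The rotation y1 has no such component, and no cross terms between the modes survive in the
    weighted sum; the shape mode picks up the phases u_i, which add up to k. *)
Lemma jac_side x1 y1 x2 y2 : M != 0 ->
  let d i j k := side_re k * (jac_re i x1 y1 x2 y2 - jac_re j x1 y1 x2 y2) +
                 side_im k * (jac_im i x1 y1 x2 y2 - jac_im j x1 y1 x2 y2) in
  m0 * m1 * d 0%N 1%N 2%N ^+ 2 + m0 * m2 * d 0%N 2%N 1%N ^+ 2 + m1 * m2 * d 1%N 2%N 0%N ^+ 2 =
  M * (M * S * x1 ^+ 2 + P * S / 2 * (x2 ^+ 2 + y2 ^+ 2 + kre * (x2 ^+ 2 - y2 ^+ 2) - 2 * kim * (x2 * y2))).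
Proof.
move=> M0 d.
have -> : M * (M * S * x1 ^+ 2 + P * S / 2 * (x2 ^+ 2 + y2 ^+ 2 + kre * (x2 ^+ 2 - y2 ^+ 2) - 2 * kim * (x2 * y2)))
  = M * M * S * x1 ^+ 2 + P * S / 2 * (M * (x2 ^+ 2 + y2 ^+ 2) + (m2 - (m0 + m1) / 2) * (x2 ^+ 2 - y2 ^+ 2)
    + h * (m0 - m1) * (x2 * y2)).
  by rewrite /kre /kim; field.
rewrite /d /jac_re /jac_im /M /S /P /=.
by field: h2.
Qed.

(** Distinct cube roots of unity have scalar product -1/2, so the sum of the m_i u_i has squared
    modulus M^2 - 3 S. *)
Lemma k_norm : M != 0 -> kre ^+ 2 + kim ^+ 2 = 1 - 3 * S / M ^+ 2.
Proof.
move=> M0; rewrite /kre /kim.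
have -> : ((m2 - (m0 + m1) / 2) / M) ^+ 2 + (- (h / 2) * (m0 - m1) / M) ^+ 2 =
  ((m2 - (m0 + m1) / 2) ^+ 2 + h ^+ 2 / 4 * (m0 - m1) ^+ 2) / M ^+ 2 by field.
rewrite h2 /S.
have -> : 1 - 3 * (m0 * m1 + m0 * m2 + m1 * m2) / M ^+ 2 =
   (M ^+ 2 - 3 * (m0 * m1 + m0 * m2 + m1 * m2)) / M ^+ 2 by field.
by congr (_ / _); rewrite /M; field.
Qed.

(** Mass-orthogonal projections onto the two modes, divided by the squared norms M S and P S. In the
    shape mode m_i times the displacement vector is P conj(u_i), so P cancels. *)
Definition co_x1 (a b : nat -> R) : R := (m0 * (homo_re 0 * a 0%N + homo_im 0 * b 0%N) +
  m1 * (homo_re 1 * a 1%N + homo_im 1 * b 1%N) + m2 * (homo_re 2 * a 2%N + homo_im 2 * b 2%N)) / (M * S).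
Definition co_y1 (a b : nat -> R) : R := (m0 * (homo_re 0 * b 0%N - homo_im 0 * a 0%N) +
  m1 * (homo_re 1 * b 1%N - homo_im 1 * a 1%N) + m2 * (homo_re 2 * b 2%N - homo_im 2 * a 2%N)) / (M * S).
Definition co_x2 (a b : nat -> R) : R := ((side_re 0 * a 0%N - side_im 0 * b 0%N) +
  (side_re 1 * a 1%N - side_im 1 * b 1%N) + (side_re 2 * a 2%N - side_im 2 * b 2%N)) / S.
Definition co_y2 (a b : nat -> R) : R := ((side_re 0 * b 0%N + side_im 0 * a 0%N) +
  (side_re 1 * b 1%N + side_im 1 * a 1%N) + (side_re 2 * b 2%N + side_im 2 * a 2%N)) / S.

Lemma jac_coK (a b : nat -> R) : M != 0 -> S != 0 -> m2 != 0 ->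
  m0 * a 0%N + m1 * a 1%N + m2 * a 2%N = 0 -> m0 * b 0%N + m1 * b 1%N + m2 * b 2%N = 0 ->
  forall i : nat, (i < 3)%N ->
  jac_re i (co_x1 a b) (co_y1 a b) (co_x2 a b) (co_y2 a b) = a i /\
  jac_im i (co_x1 a b) (co_y1 a b) (co_x2 a b) (co_y2 a b) = b i.
Proof.
move=> M0 S0 m20 ca cb.
have {}ca : a 2%N = - (m0 * a 0%N + m1 * a 1%N) / m2.
  by apply: (mulfI m20); rewrite mulrCA divff// mulr1; lra.
have {}cb : b 2%N = - (m0 * b 0%N + m1 * b 1%N) / m2.
  by apply: (mulfI m20); rewrite mulrCA divff// mulr1; lra.
rewrite /M /S in M0 S0.
by case=> [|[|[|//]]] _; rewrite /jac_re /jac_im /co_x1 /co_y1 /co_x2 /co_y2 /M /S /= ca cb;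
  split; field: h2; rewrite M0 S0 m20.
Qed.

End Jacobi.

(** * Differentiation under the integral *)

Section Differentiation.
Context {R : realType}.
Notation mu := (@lebesgue_measure R).
Implicit Types (f g h B C : R -> R) (a b s t : R).

Lemma is_derive_under_integral (f f1 : R -> R -> R) (a b e K s : R) :
  (forall s, `|s| < e -> {within `[a, b], continuous (f s)}) ->
  (forall s t, `|s| < e -> a <= t <= b -> is_derive s 1 (f ^~ t) (f1 s t)) ->
  (forall s t, `|s| < e -> a <= t <= b -> `|f1 s t| <= K) ->
  `|s| < e ->
  is_derive s 1 (fun s => \int[mu]_(t in `[a, b]) f s t) (\int[mu]_(t in `[a, b]) f1 s t).
Proof.
move=> cf df bf se.
have Ise (x : R) : `]- e, e[%classic x -> `|x| < e.
  by rewrite /= in_itv/= ltr_norml.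
have Is : `]- e, e[%classic s by rewrite /= in_itv/= -ltr_norml.
have mI : measurable (`[a, b]%classic : set (measurableTypeR R)) by exact: measurable_itv.
have intf x : `]- e, e[%classic x -> mu.-integrable `[a, b] (EFin \o f x).
  by move=> /Ise xe; apply: integrable_within_continuous; exact: cf.
have derf x t : `]- e, e[%classic x -> `[a, b]%classic t -> derivable (f ^~ t) x 1.
  move=> /Ise xe; rewrite /= in_itv/= => abt.
  by have [] : is_derive x 1 (f ^~ t) (f1 x t) by exact: df.
have E x t : `]- e, e[%classic x -> `[a, b]%classic t -> partial1of2 f x t = f1 x t.
  move=> /Ise xe; rewrite /= in_itv/= => abt.
  by rewrite partial1of2E; apply: derive_val; exact: df.
have intK : mu.-integrable `[a, b] (EFin \o cst `|K|).
  by apply: integrable_within_continuous => x; exact: cvg_cst.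
have ub x t : `]- e, e[%classic x -> `[a, b]%classic t -> `|partial1of2 f x t| <= cst `|K| t.
  move=> xe abt; rewrite E//; move: abt; rewrite /= in_itv/= => abt.
  by rewrite (le_trans (bf _ _ (Ise _ xe) abt))// ler_norm.
have D := derivable_under_integral mI Is intf derf (fun=> normr_ge0 K) intK ub.
apply: DeriveDef => //.
rewrite -derive1E (differentiation_under_integral mI Is intf derf (fun=> normr_ge0 K) intK ub).
by apply: eq_Rintegral => t /set_mem abt; exact: E.
Qed.

Lemma within_continuous_comp a b (phi : R -> R) f :
  {within `[a, b], continuous f} -> (forall t, a <= t <= b -> {for f t, continuous phi}) ->
  {within `[a, b], continuous (phi \o f)}.
Proof.
move=> cf cphi; rewrite continuous_subspace_in => t /set_mem/=; rewrite in_itv/= => abt.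
have H : {for (t : subspace `[a, b]), continuous (f : subspace `[a, b] -> R)} by exact: cf.
by have := continuous_comp H (cphi _ abt); exact.
Qed.

Lemma is_derive_continuous (phi : R -> R) (x k : R) : is_derive x 1 phi k -> {for x, continuous phi}.
Proof. by move=> d; apply: differentiable_continuous; apply/derivable1_diffP. Qed.

(** Squared length of a vector moved by s times a variation: A is its initial value, B the scalar
    product with the variation and C the squared length of the variation. A is constant in time
    because the triangle keeps its size. *)
Definition quad (A : R) B C (s t : R) : R := A + 2 * s * B t + s ^+ 2 * C t.
Definition dquad B C (s t : R) : R := 2 * B t + 2 * s * C t.

Lemma is_derive_quad A B C s t : is_derive s 1 (quad A B C ^~ t) (dquad B C s t).
Proof.
have d1 : is_derive s 1 (fun s : R => 2 * s * B t) (2 * B t).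
  under eq_fun do rewrite mulrAC.
  by have := is_derive1_affine (2 * B t) 0 s; under eq_fun do rewrite addr0.
have d2 : is_derive s 1 (fun s : R => s ^+ 2 * C t) (2 * s * C t).
  have := is_derive1Z (C t) (is_derive1M (is_derive_id s 1) (is_derive_id s 1)).
  have -> : C t * (1 * s + s * 1) = 2 * s * C t by ring.
  by under eq_fun do rewrite -expr2 mulrC.
have := is_derive1D (is_derive1D (is_derive_cst A s 1) d1) d2.
by rewrite add0r.
Qed.

Lemma is_derive_dquad B C s t : is_derive s 1 (dquad B C ^~ t) (2 * C t).
Proof.
have d1 : is_derive s 1 (fun s : R => 2 * s * C t) (2 * C t).
  under eq_fun do rewrite mulrAC.
  by have := is_derive1_affine (2 * C t) 0 s; under eq_fun do rewrite addr0.
have := is_derive1D (is_derive_cst (2 * B t) s 1) d1.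
by rewrite add0r.
Qed.

Lemma within_continuousD a b f g : {within `[a, b], continuous f} ->
  {within `[a, b], continuous g} -> {within `[a, b], continuous (fun t => f t + g t)}.
Proof. by move=> cf cg x; apply: cvgD; [exact: cf|exact: cg]. Qed.

Lemma within_continuousM a b f g : {within `[a, b], continuous f} ->
  {within `[a, b], continuous g} -> {within `[a, b], continuous (fun t => f t * g t)}.
Proof. by move=> cf cg x; apply: cvgM; [exact: cf|exact: cg]. Qed.

Lemma within_continuous_cst a b (k : R) : {within `[a, b], continuous (fun _ : R => k)}.
Proof. by move=> x; exact: cvg_cst. Qed.

Lemma within_continuous_quad a b A B C s : {within `[a, b], continuous B} ->
  {within `[a, b], continuous C} -> {within `[a, b], continuous (quad A B C s)}.
Proof.
move=> cB cC; apply: within_continuousD; last first.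
  by apply: within_continuousM => //; exact: within_continuous_cst.
apply: within_continuousD; first exact: within_continuous_cst.
by apply: within_continuousM => //; exact: within_continuous_cst.
Qed.

Lemma within_continuous_dquad a b B C s : {within `[a, b], continuous B} ->
  {within `[a, b], continuous C} -> {within `[a, b], continuous (dquad B C s)}.
Proof.
move=> cB cC; apply: within_continuousD.
  by apply: within_continuousM => //; exact: within_continuous_cst.
by apply: within_continuousM => //; exact: within_continuous_cst.
Qed.

Lemma within_continuous_ubound a b f : {within `[a, b], continuous f} ->
  exists2 K, 0 < K & forall t, a <= t <= b -> `|f t| <= K.
Proof.
move=> /within_continuous_bounded [K [_ bK]].
exists (Num.max (K + 1) 1); first by rewrite lt_max ltr01 orbT.
move=> t abt; apply: bK; last by rewrite /= in_itv.
by rewrite lt_max ltrDl ltr01.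
Qed.

Lemma quad_bounds a b (A : R) B C : 0 < A -> {within `[a, b], continuous B} ->
  {within `[a, b], continuous C} ->
  exists e L, [/\ 0 < e, 0 < L & forall s t, `|s| < e -> a <= t <= b ->
    [/\ A / 2 <= quad A B C s t <= L, `|dquad B C s t| <= L & `|2 * C t| <= L]].
Proof.
move=> A0 /within_continuous_ubound[K1 K10 B1] /within_continuous_ubound[K2 K20 C2].
pose K := K1 + K2.
have K0 : 0 < K by exact: addr_gt0.
(* For |s| < 1 the value moves by at most 2 |s| K + |s| K, less than A / 2 as soon as |s| < A / (6
   K). The bound A + 4 K also covers both derivatives. *)
exists (Num.min 1 (A / (6 * K))), (A + 4 * K); split.
- by rewrite lt_min ltr01 divr_gt0// mulr_gt0.
- by rewrite addr_gt0// mulr_gt0.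
move=> s t; rewrite lt_min => /andP[s1 s2] abt.
have Bt := B1 t abt; have Ct := C2 t abt.
have sK : `|s| * (6 * K) < A by rewrite -ltr_pdivlMr// mulr_gt0.
have s0 := normr_ge0 s.
have b1 : `|2 * s * B t| <= 2 * `|s| * K.
  rewrite !normrM normr_nat ler_wpM2l ?mulr_ge0//.
  by rewrite (le_trans Bt)// /K lerDl ltW.
have b2 : `|s ^+ 2 * C t| <= `|s| * K.
  rewrite normrM normrX expr2 -mulrA ler_wpM2l//.
  rewrite (le_trans (ler_wpM2r (normr_ge0 _) (ltW s1)))// mul1r.
  by rewrite (le_trans Ct)// /K lerDr ltW.
have b3 : `|2 * s * C t| <= 2 * K.
  rewrite !normrM normr_nat -mulrA ler_wpM2l//.
  rewrite (le_trans (ler_wpM2r (normr_ge0 _) (ltW s1)))// mul1r.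
  by rewrite (le_trans Ct)// /K lerDr ltW.
have b4 : `|2 * B t| <= 2 * K.
  by rewrite normrM normr_nat ler_wpM2l// (le_trans Bt)// /K lerDl ltW.
have b5 : `|2 * C t| <= 2 * K.
  by rewrite normrM normr_nat ler_wpM2l// (le_trans Ct)// /K lerDr ltW.
have s3 : `|s| * K <= K by rewrite ler_piMl// ltW.
split; last by lra.
- rewrite /quad; move: b1 b2; rewrite !ler_norml => /andP[? ?] /andP[? ?].
  by apply/andP; split; lra.
- by rewrite /dquad (le_trans (ler_normD _ _))//; lra.
Qed.

(** For small s the values of [quad] stay in a compact interval of positive numbers, where phi' and
    phi'' are bounded; constants thus dominate both differentiations. Since phi takes a squared
    length, which is polynomial in s, no square root is ever differentiated. *)
Lemma second_derivative_under_integral a b (A : R) B C (phi phi1 phi2 : R -> R) : 0 < A ->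
  {within `[a, b], continuous B} -> {within `[a, b], continuous C} ->
  (forall x : R, 0 < x -> is_derive x 1 phi (phi1 x)) ->
  (forall x : R, 0 < x -> is_derive x 1 phi1 (phi2 x)) ->
  (forall x : R, 0 < x -> {for x, continuous phi2}) ->
  exists (e : R) (V1 : R -> R), [/\ 0 < e,
    forall s : R, `|s| < e -> (forall t, a <= t <= b -> 0 < quad A B C s t) /\
       mu.-integrable `[a, b] (EFin \o (fun t => phi (quad A B C s t))),
    forall s : R, `|s| < e ->
      is_derive s 1 (fun s => \int[mu]_(t in `[a, b]) phi (quad A B C s t)) (V1 s) &
    is_derive (0 : R) (1 : R) V1
      (\int[mu]_(t in `[a, b]) (phi2 A * (2 * B t) ^+ 2 + phi1 A * (2 * C t)))].
Proof.
move=> A0 cB cC d0 d1 c2.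
have [e [L [e0 L0 bd]]] := quad_bounds A0 cB cC.
have pos s t : `|s| < e -> a <= t <= b -> 0 < quad A B C s t.
  by move=> se abt; have [/andP[+ _] _ _] := bd _ _ se abt; apply: lt_le_trans; rewrite divr_gt0.
have cphi (psi : R -> R) : (forall x : R, 0 < x -> {for x, continuous psi}) -> forall s : R, `|s| < e ->
    {within `[a, b], continuous (fun t => psi (quad A B C s t))}.
  move=> cpsi s se; apply: (@within_continuous_comp a b psi (quad A B C s)).
    exact: within_continuous_quad.
  by move=> t abt; apply: cpsi; exact: pos.
have bphi (psi : R -> R) : (forall x : R, 0 < x -> {for x, continuous psi}) ->
    exists2 K, 0 < K & forall s t, `|s| < e -> a <= t <= b -> `|psi (quad A B C s t)| <= K.
  move=> cpsi.
  have : {within `[(A / 2), L], continuous psi}.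
    apply: continuous_in_subspaceT => x /set_mem/=; rewrite in_itv/= => /andP[Ax _].
    by apply: cpsi; apply: lt_le_trans Ax; rewrite divr_gt0.
  move=> /within_continuous_ubound[K K0 bK]; exists K => // s t se abt.
  by apply: bK; have [] := bd _ _ se abt.
have c0 x : 0 < x -> {for x, continuous phi} by move=> /d0; exact: is_derive_continuous.
have c1 x : 0 < x -> {for x, continuous phi1} by move=> /d1; exact: is_derive_continuous.
have [K1 K10 bK1] := bphi _ c1; have [K2 K20 bK2] := bphi _ c2.
pose f1 s t := phi1 (quad A B C s t) * dquad B C s t.
pose f2 s t := phi2 (quad A B C s t) * dquad B C s t ^+ 2 + phi1 (quad A B C s t) * (2 * C t).
have df s t : `|s| < e -> a <= t <= b ->
    is_derive s 1 (fun s => phi (quad A B C s t)) (f1 s t).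
  by move=> se abt; apply: is_derive1_comp; [exact: d0 (pos _ _ se abt)|exact: is_derive_quad].
have df1 s t : `|s| < e -> a <= t <= b -> is_derive s 1 (f1 ^~ t) (f2 s t).
  move=> se abt.
  have D1 : is_derive s 1 (fun s => phi1 (quad A B C s t)) (phi2 (quad A B C s t) * dquad B C s t).
    by apply: is_derive1_comp; [exact: d1 (pos _ _ se abt)|exact: is_derive_quad].
  have := is_derive1M D1 (is_derive_dquad B C s t).
  by rewrite -mulrA -expr2.
exists e, (fun s => \int[mu]_(t in `[a, b]) f1 s t); split => //.
- move=> s se; split; first by move=> t; exact: pos.
  by apply: integrable_within_continuous; exact: cphi.
- move=> s se.
  apply: (@is_derive_under_integral (fun s t => phi (quad A B C s t)) f1 a b e (K1 * L)) => //.
    by move=> s' s'e; exact: cphi.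
  move=> s' t s'e abt; rewrite /f1 normrM ler_pM//; first exact: bK1.
  by have [] := bd _ _ s'e abt.
- have -> : \int[mu]_(t in `[a, b]) (phi2 A * (2 * B t) ^+ 2 + phi1 A * (2 * C t)) =
            \int[mu]_(t in `[a, b]) f2 0 t.
    apply: eq_Rintegral => t _; rewrite /f2 /quad /dquad.
    by rewrite mulr0 !mul0r expr0n/= mul0r !addr0.
  apply: (@is_derive_under_integral f1 f2 a b e (K2 * L ^+ 2 + K1 * L)) => //.
  + move=> s' s'e; apply: within_continuousM; first exact: cphi.
    exact: within_continuous_dquad.
  + move=> s' t s'e abt; have [_ b1 b2] := bd _ _ s'e abt.
    rewrite /f2 (le_trans (ler_normD _ _))// lerD// normrM ler_pM//.
    * exact: bK2.
    * by rewrite normrX lerXn2r// nnegrE ?ltW.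
    * exact: bK1.
  + by rewrite normr0.
Qed.

End Differentiation.

(** * Second variation of the action *)

Section Potential.
Context {R : realType}.
Implicit Types (alpha x r s t w : R) (m : 'I_3 -> R) (q v : config R).

Definition body (n : nat) : 'I_3 := inord n.
Definition axis (n : nat) : 'I_2 := inord n.

Lemma sum_bodies (V : nmodType) (F : 'I_3 -> V) :
  \sum_i F i = F (body 0) + F (body 1) + F (body 2).
Proof.
rewrite !big_ord_recl big_ord0 addr0 addrA.
by congr (F _ + F _ + F _); apply: val_inj; rewrite /= inordK.
Qed.

Lemma sum_pairs (V : nmodType) (F : 'I_3 -> 'I_3 -> V) :
  \sum_(i < 3) \sum_(j < 3 | (i < j)%N) F i j =
  F (body 0) (body 1) + F (body 0) (body 2) + F (body 1) (body 2).
Proof.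
have E (i : 'I_3) : \sum_(j < 3 | (i < j)%N) F i j = (if (i < body 0)%N then F i (body 0) else 0) +
    (if (i < body 1)%N then F i (body 1) else 0) + (if (i < body 2)%N then F i (body 2) else 0).
  by rewrite big_mkcond sum_bodies.
by rewrite sum_bodies !E /= !inordK//= !add0r !addr0.
Qed.

Lemma sum_axes (V : nmodType) (F : 'I_2 -> V) : \sum_k F k = F (axis 0) + F (axis 1).
Proof.
rewrite !big_ord_recl big_ord0 addr0.
by congr (F _ + F _); apply: val_inj; rewrite /= inordK.
Qed.

Lemma body_cases (P : 'I_3 -> Prop) : P (body 0) -> P (body 1) -> P (body 2) -> forall i, P i.
Proof.
move=> p0 p1 p2 i; have -> : i = body i by apply: val_inj; rewrite /= inordK.
by case: i => -[|[|[|//]]].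
Qed.

Lemma axis_cases (P : 'I_2 -> Prop) : P (axis 0) -> P (axis 1) -> forall i, P i.
Proof.
move=> p0 p1 i; have -> : i = axis i by apply: val_inj; rewrite /= inordK.
by case: i => -[|[|//]].
Qed.

Definition sqdist q (i j : 'I_3) : R := \sum_k (q i k - q j k) ^+ 2.
Definition dotdiff q v (i j : 'I_3) : R := \sum_k (q i k - q j k) * (v i k - v j k).

Lemma body_distE q i j : body_dist q i j = Num.sqrt (sqdist q i j).
Proof. by rewrite /body_dist /enorm; congr Num.sqrt; apply: eq_bigr => k _; rewrite !mxE. Qed.

Definition pot alpha x : R := if alpha == 0 then - 2^-1 * ln x else x `^ (- alpha / 2).
(** With 1 in place of alpha for the logarithm, a single formula covers the derivatives in both
    cases. *)
Definition pot_coef alpha : R := if alpha == 0 then 1 else alpha.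
Definition dpot alpha x : R := - (pot_coef alpha / 2) * x `^ (- alpha / 2 - 1).
Definition ddpot alpha x : R :=
  pot_coef alpha / 2 * (alpha / 2 + 1) * x `^ (- alpha / 2 - 1 - 1).

Lemma is_derive_pot alpha x : 0 < x -> is_derive x 1 (pot alpha) (dpot alpha x).
Proof.
move=> x0; rewrite /pot /dpot /pot_coef; case: eqP => [->|_].
  have := is_derive1Z (- 2^-1) (is_derive1_ln x0).
  by rewrite oppr0 mul0r sub0r powR_inv1 ?ltW// mul1r.
have := is_derive1_powR (- alpha / 2) x0.
by have -> : - (alpha / 2) = - alpha / 2 by rewrite mulNr.
Qed.

Lemma is_derive_dpot alpha x : 0 < x -> is_derive x 1 (dpot alpha) (ddpot alpha x).
Proof.
move=> x0; have := is_derive1Z (- (pot_coef alpha / 2)) (is_derive1_powR (- alpha / 2 - 1) x0).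
rewrite /ddpot; have -> : - (pot_coef alpha / 2) * ((- alpha / 2 - 1) * x `^ (- alpha / 2 - 1 - 1)) =
  pot_coef alpha / 2 * (alpha / 2 + 1) * x `^ (- alpha / 2 - 1 - 1).
  by move: (x `^ _) => y; field.
by [].
Qed.

Lemma continuous_ddpot alpha x : 0 < x -> {for x, continuous (ddpot alpha)}.
Proof.
move=> x0.
have d := is_derive1Z (pot_coef alpha / 2 * (alpha / 2 + 1))
  (is_derive1_powR (- alpha / 2 - 1 - 1) x0).
exact: (is_derive_continuous d).
Qed.

(** Homogeneity of the first derivative, of degree - alpha / 2 - 1 for the logarithm too: the origin
    of the constant A. *)
Lemma ddpotE alpha x : 0 < x -> x * ddpot alpha x = - (alpha / 2 + 1) * dpot alpha x.
Proof.
move=> x0; rewrite /ddpot /dpot.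
have -> : x `^ (- alpha / 2 - 1) = x * x `^ (- alpha / 2 - 1 - 1).
  rewrite -{2}(powRr1 (ltW x0)) -powRD; first by congr powR; ring.
  by rewrite (gt_eqF x0) implybT.
by ring.
Qed.

Definition pair_sum m (f : 'I_3 -> 'I_3 -> R) : R :=
  m (body 0) * m (body 1) * f (body 0) (body 1) +
  m (body 0) * m (body 2) * f (body 0) (body 2) +
  m (body 1) * m (body 2) * f (body 1) (body 2).

Lemma potentialE m alpha q : (forall i j, i != j -> 0 < sqdist q i j) ->
  potential m alpha q = pair_sum m (fun i j => pot alpha (sqdist q i j)).
Proof.
move=> pos; rewrite /potential /pair_sum /pot.
have p01 := pos (body 0) (body 1); have p02 := pos (body 0) (body 2).
have p12 := pos (body 1) (body 2).
have {}p01 := p01 _; have {}p02 := p02 _; have {}p12 := p12 _.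
case: eqP => [_|_]; rewrite sum_pairs !body_distE.
  have L x : 0 < x -> ln (Num.sqrt x) = 2^-1 * ln x.
    by move=> x0; rewrite -powR12_sqrt ?ln_powR// ltW.
  by rewrite !L ?p01 ?p02 ?p12 -?(inj_eq val_inj) /= ?inordK//; ring.
have L x : 0 < x -> Num.sqrt x `^ (- alpha) = x `^ (- alpha / 2).
  by move=> x0; rewrite -powR12_sqrt ?ltW// -powRrM mulrC.
by rewrite !L ?p01 ?p02 ?p12 -?(inj_eq val_inj) /= ?inordK.
Qed.

Lemma sqdist_line q v s i j :
  sqdist (q + s *: v) i j = quad (sqdist q i j) (fun=> dotdiff q v i j) (fun=> sqdist v i j) s 0.
Proof. by rewrite /sqdist /dotdiff /quad !sum_axes !mxE; ring. Qed.

Lemma is_derive1_sum3 (c1 c2 c3 : R) (f1 f2 f3 : R -> R) (d1 d2 d3 s : R) :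
  is_derive s 1 f1 d1 -> is_derive s 1 f2 d2 -> is_derive s 1 f3 d3 ->
  is_derive s 1 (fun s => c1 * f1 s + c2 * f2 s + c3 * f3 s) (c1 * d1 + c2 * d2 + c3 * d3).
Proof.
move=> h1 h2 h3.
exact: (is_derive1D (is_derive1D (is_derive1Z c1 h1) (is_derive1Z c2 h2)) (is_derive1Z c3 h3)).
Qed.

(** A directional derivative only sees a line, which reduces Newton's equations to calculus in one
    variable. *)
Lemma derive_line (f : config R -> R) q v (d : R) :
  is_derive (0 : R) (1 : R) (fun s : R => f (q + s *: v)) d -> 'D_v f q = d.
Proof.
move=> H; have <- := @derive_val _ _ _ _ _ _ _ H.
rewrite /derive.
have -> : (fun h : R => h^-1 *: (((fun s : R => f (q + s *: v)) \o shift 0) (h *: (1 : R)) -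
    f (q + 0 *: v))) = (fun h : R => h^-1 *: ((f \o shift q) (h *: v) - f q)).
  by apply/funext => h /=; rewrite addr0 scale0r addr0 (addrC q) /GRing.scale/= mulr1.
by [].
Qed.

Lemma derive_potential m alpha q v (r2 : R) : 0 < r2 ->
  (forall i j, i != j -> sqdist q i j = r2) ->
  'D_v (potential m alpha) q = pair_sum m (fun i j => dpot alpha r2 * (2 * dotdiff q v i j)).
Proof.
move=> r0 qr; apply: derive_line.
have cst_cont (k : R) : {within `[0, 0], continuous (fun _ : R => k)}.
  exact: within_continuous_cst.
have bd i j : i != j -> exists2 e : R, 0 < e & forall s, `|s| < e -> 0 < sqdist (q + s *: v) i j.
  move=> ij; have [e [L [e0 _ bd]]] := quad_bounds r0 (cst_cont (dotdiff q v i j)) (cst_cont (sqdist v i j)).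
  exists e => // s se; rewrite sqdist_line qr//.
  have [/andP[+ _] _ _] := bd s 0 se ltac:(by rewrite lexx).
  by apply: lt_le_trans; rewrite divr_gt0.
have dE i j : i != j -> is_derive (0 : R) (1 : R) (fun s : R => pot alpha (sqdist (q + s *: v) i j))
    (dpot alpha r2 * (2 * dotdiff q v i j)).
  move=> ij; have -> : (fun s : R => pot alpha (sqdist (q + s *: v) i j)) =
    pot alpha \o (fun s => quad r2 (fun=> dotdiff q v i j) (fun=> sqdist v i j) s 0).
    by apply/funext => s /=; rewrite sqdist_line qr.
  have Q := is_derive_quad r2 (fun=> dotdiff q v i j) (fun=> sqdist v i j) 0 0.
  have -> : 2 * dotdiff q v i j = dquad (fun=> dotdiff q v i j) (fun=> sqdist v i j) 0 0.
    by rewrite /dquad mulr0 mul0r addr0.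
  apply: is_derive1_comp Q.
  have -> : quad r2 (fun=> dotdiff q v i j) (fun=> sqdist v i j) 0 0 = r2.
    by rewrite /quad mulr0 mul0r expr0n/= mul0r !addr0.
  exact: is_derive_pot.
have n01 : body 0 != body 1 by rewrite -(inj_eq val_inj) /= !inordK.
have n02 : body 0 != body 2 by rewrite -(inj_eq val_inj) /= !inordK.
have n12 : body 1 != body 2 by rewrite -(inj_eq val_inj) /= !inordK.
have [e1 e10 b1] := bd _ _ n01; have [e2 e20 b2] := bd _ _ n02; have [e3 e30 b3] := bd _ _ n12.
have sym u i j : sqdist u i j = sqdist u j i.
  by apply: eq_bigr => k _; rewrite -sqrrN opprB.
have D := is_derive1_sum3 (m (body 0) * m (body 1)) (m (body 0) * m (body 2))
  (m (body 1) * m (body 2)) (dE _ _ n01) (dE _ _ n02) (dE _ _ n12).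
(* [potentialE] requires positive distances, which hold along the line only for small s. *)
apply: near_eq_is_derive D.
near=> s.
have s1 : `|s| < e1.
  by near: s; apply/nbhs_ballP; exists e1 => // x; rewrite /ball/= sub0r normrN.
have s2 : `|s| < e2.
  by near: s; apply/nbhs_ballP; exists e2 => // x; rewrite /ball/= sub0r normrN.
have s3 : `|s| < e3.
  by near: s; apply/nbhs_ballP; exists e3 => // x; rewrite /ball/= sub0r normrN.
rewrite potentialE// => i j.
have p1 := b1 s s1; have p2 := b2 s s2; have p3 := b3 s s3.
elim/body_cases: i; elim/body_cases: j; rewrite ?eqxx// => _; rewrite ?p1 ?p2 ?p3// sym.
- exact: p1.
- exact: p2.
- exact: p3.
Unshelve. all: by end_near. Qed.

Lemma is_derive_trig1 (a b c t : R) : is_derive t 1 (trig1 a b c) (trig1 0 c (- b) t).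
Proof.
have := is_derive1D (is_derive_cst a t 1)
  (is_derive1D (is_derive1Z b (is_derive_cos t)) (is_derive1Z c (is_derive_sin t))).
by have -> : 0 + (b * - sin t + c * cos t) = trig1 0 c (- b) t by rewrite /trig1; ring.
Qed.

(** Because |w| = 1, the factor w comes out of the sine, and every coordinate is a trigonometric
    polynomial of order one for either sense of rotation. *)
Definition circular q w (i : 'I_3) (k : nat) : R -> R :=
  if k is 0 then trig1 0 (q i (axis 0)) (- w * q i (axis 1))
  else trig1 0 (q i (axis 1)) (w * q i (axis 0)).

Lemma cosM_unit w t : `|w| = 1 -> cos (w * t) = cos t.
Proof.
move=> w1; have [w0|w0] := leP 0 w.
  by rewrite -(ger0_norm w0) w1 mul1r.
have -> : w = - 1 by rewrite -[LHS]opprK -(ltr0_norm w0) w1.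
by rewrite mulN1r cosN.
Qed.

Lemma sinM_unit w t : `|w| = 1 -> sin (w * t) = w * sin t.
Proof.
move=> w1; have [w0|w0] := leP 0 w.
  by rewrite -(ger0_norm w0) w1 !mul1r.
have -> : w = - 1 by rewrite -[LHS]opprK -(ltr0_norm w0) w1.
by rewrite !mulN1r sinN.
Qed.

Lemma axis_neq : axis 0 != axis 1.
Proof. by rewrite -(inj_eq val_inj) /= !inordK. Qed.

Lemma axis0 : axis 0 = 0. Proof. by apply: val_inj; rewrite /= inordK. Qed.

Lemma rotation_circular q w t (i : 'I_3) : `|w| = 1 ->
  (q *m (rotation (w * t))^T) i (axis 0) = circular q w i 0 t /\
  (q *m (rotation (w * t))^T) i (axis 1) = circular q w i 1 t.
Proof.
move=> w1; rewrite !mxE !sum_axes !mxE /= !eqxx.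
rewrite (eq_sym (axis 1)) (negbTE axis_neq) axis0 eqxx.
rewrite -axis0 (eq_sym (axis 1)) (negbTE axis_neq) cosM_unit// sinM_unit// /trig1.
by split; ring.
Qed.

End Potential.

(** * Size of the triangle and second derivative of the action *)

Section Newton.
Context {R : realType}.
Notation mu := (@lebesgue_measure R).
Implicit Types (alpha x r s t w : R) (m : 'I_3 -> R) (q v : config R).

Lemma body_neq01 : body 0 != body 1. Proof. by rewrite -(inj_eq val_inj) /= !inordK. Qed.
Lemma body_neq02 : body 0 != body 2. Proof. by rewrite -(inj_eq val_inj) /= !inordK. Qed.
Lemma body_neq12 : body 1 != body 2. Proof. by rewrite -(inj_eq val_inj) /= !inordK. Qed.

Lemma dotdiff_delta q (i a b : 'I_3) (k : 'I_2) :
  dotdiff q (delta_mx i k) a b = (q a k - q b k) * ((a == i)%:R - (b == i)%:R).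
Proof.
rewrite /dotdiff (bigD1 k)//= big1 ?addr0; last first.
  by move=> l /negbTE lk; rewrite !mxE lk !andbF subrr mulr0.
by rewrite !mxE eqxx !andbT.
Qed.

Lemma trig1_derive2 (a b c : R) : ((trig1 a b c)^`(2))%classic 0 = - b.
Proof.
have D (x y z : R) : ((trig1 x y z)^`())%classic = trig1 0 z (- y).
  by apply/funext => t; rewrite derive1E; apply: derive_val; exact: is_derive_trig1.
by rewrite derive1nS derive1n1 !D /trig1 cos0 sin0 mulr0 mulr1 addr0 add0r.
Qed.

Lemma circular_derive2 q w (i : 'I_3) (k : nat) : (k < 2)%N ->
  ((circular q w i k)^`(2))%classic 0 = - q i (axis k).
Proof. by case: k => [|[|//]] _; rewrite /circular trig1_derive2. Qed.

Lemma rotation_circularE q w (gamma : R -> config R) : `|w| = 1 ->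
  (forall t, gamma t = q *m (rotation (w * t))^T) ->
  forall i (k : nat), (k < 2)%N -> (fun t => gamma t i (axis k)) = circular q w i k.
Proof.
move=> w1 gE i k k2; apply/funext => t; rewrite gE.
by have [] := rotation_circular q t i w1; case: k k2 => [|[|//]].
Qed.

Lemma circular0 q w (i : 'I_3) (k : nat) : (k < 2)%N -> circular q w i k 0 = q i (axis k).
Proof. by case: k => [|[|//]] _; rewrite /circular /trig1 cos0 sin0; ring. Qed.

(** With equal sides and barycentre 0, Newton's equation at time 0 reads - q_i = 2 phi'(r2) M q_i.
    If the scalar were not -1, two bodies would sit at the origin and their distance would be 0. *)
Lemma circular_size m alpha gamma q w (r2 : R) : (forall i, 0 < m i) ->
  newton_solution m alpha gamma -> centered m q -> `|w| = 1 -> 0 < r2 ->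
  (forall i j, i != j -> sqdist q i j = r2) ->
  (forall t, gamma t = q *m (rotation (w * t))^T) ->
  2 * dpot alpha r2 * (m (body 0) + m (body 1) + m (body 2)) = -1.
Proof.
move=> m0 [_ newton] cq w1 r0 qr gE.
have cqk k : m (body 0) * q (body 0) k + m (body 1) * q (body 1) k + m (body 2) * q (body 2) k = 0.
  by move: cq; rewrite /centered /= sum_bodies => /matrixP/(_ 0 k); rewrite !mxE.
have g0 : gamma 0 = q.
  apply/matrixP => i k; elim/axis_cases: k.
  - by have /(congr1 (fun f => f 0)) := rotation_circularE w1 gE i (isT : (0 < 2)%N); rewrite circular0.
  - by have /(congr1 (fun f => f 0)) := rotation_circularE w1 gE i (isT : (1 < 2)%N); rewrite circular0.
have N i (k : nat) : (k < 2)%N -> m i * - q i (axis k) =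
    pair_sum m (fun a b => dpot alpha r2 * (2 * dotdiff q (delta_mx i (axis k)) a b)).
  move=> k2; have [_ _] := newton 0 i (axis k).
  rewrite (rotation_circularE w1 gE i k2) circular_derive2// => ->.
  by rewrite g0 (derive_potential _ _ _ r0 qr).
set M := (X in _ * X = _); apply/eqP; apply: contraT => E.
have Z k i : (i == 0%N) || (i == 1%N) -> (k < 2)%N -> q (body i) (axis k) = 0.
  move=> i01 k2; have := N (body i) k k2; rewrite /pair_sum !dotdiff_delta.
  have c := cqk (axis k).
  move: i01 => /orP[]/eqP ->; rewrite !eqxx ?(negbTE body_neq01) ?(negbTE body_neq02) ?(negbTE body_neq12)
    ?[body 1 == body 0]eq_sym ?[body 2 == body 0]eq_sym ?[body 2 == body 1]eq_sym
    ?(negbTE body_neq01) ?(negbTE body_neq02) ?(negbTE body_neq12) /= => H.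
  - have : m (body 0) * (q (body 0) (axis k) * (2 * dpot alpha r2 * M + 1)) = 0.
      have -> : q (body 0) (axis k) * (2 * dpot alpha r2 * M + 1) = q (body 0) (axis k) +
        2 * dpot alpha r2 * (M * q (body 0) (axis k) - (m (body 0) * q (body 0) (axis k) +
          m (body 1) * q (body 1) (axis k) + m (body 2) * q (body 2) (axis k))).
        by rewrite c subr0; ring.
      by rewrite /M; move: H; lra.
    move/eqP; rewrite !mulf_eq0 gt_eqF//= => /orP[/eqP//|].
    by rewrite addr_eq0 (negbTE E).
  - have : m (body 1) * (q (body 1) (axis k) * (2 * dpot alpha r2 * M + 1)) = 0.
      have -> : q (body 1) (axis k) * (2 * dpot alpha r2 * M + 1) = q (body 1) (axis k) +
        2 * dpot alpha r2 * (M * q (body 1) (axis k) - (m (body 0) * q (body 0) (axis k) +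
          m (body 1) * q (body 1) (axis k) + m (body 2) * q (body 2) (axis k))).
        by rewrite c subr0; ring.
      by rewrite /M; move: H; lra.
    move/eqP; rewrite !mulf_eq0 gt_eqF//= => /orP[/eqP//|].
    by rewrite addr_eq0 (negbTE E).
have := qr _ _ body_neq01; rewrite /sqdist sum_axes !Z// subrr expr0n/= addr0 => r20.
by rewrite -r20 ltxx in r0.
Qed.

Lemma near_norm_lt (e s : R) : `|s| < e -> \forall x \near s, `|x| < e.
Proof.
move=> se; apply/nbhs_ballP; exists (e - `|s|); first by rewrite /= subr_gt0.
move=> x; rewrite /ball/= => sx; have := ler_normB s (s - x).
by rewrite opprB addrCA subrr addr0; lra.
Qed.

Lemma derive2_eval (F V1 : R -> R) (e d : R) : 0 < e ->
  (forall s : R, `|s| < e -> is_derive s 1 F (V1 s)) -> is_derive (0 : R) (1 : R) V1 d ->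
  (F^`(2))%classic 0 = d.
Proof.
move=> e0 dF dV; rewrite derive1nS derive1n1 derive1E.
rewrite (@near_eq_derive _ _ _ _ V1); first exact: derive_val.
have : \forall x \near (0 : R), `|x| < e by apply: near_norm_lt; rewrite normr0.
by apply: filterS => x xe; rewrite derive1E; apply: derive_val; exact: dF.
Qed.

Lemma weak_deriv_sobolev (f g : R -> R) : sobolev_on 0 (2 * pi) f g ->
  sqint 0 (2 * pi) (weak_deriv f) /\ ae_eq mu `[0, (2 * pi)]%classic g (weak_deriv f).
Proof.
move=> [pf sg].
have pw : primitive_on 0 (2 * pi) f (weak_deriv f).
  by have := @xgetPex _ (cst 0) [set g | is_weak_deriv f g] (ex_intro _ g pf).
have ae := primitive_on_ae_unique pf pw.
split=> //; apply: sqint_ae ae sg.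
by have /measurable_int/measurable_EFinP := pw.1.
Qed.

Lemma ip_ae a b (f g : R -> R) : sqint a b f -> sqint a b g ->
  ae_eq mu `[a, b]%classic f g -> ip a b f f = ip a b g g.
Proof.
move=> sf sg fg; rewrite /ip /Rintegral; congr fine.
apply: (@ae_eq_integral _ (measurableTypeR R) R mu `[a, b]%classic) => //.
- by apply/measurable_EFinP; apply: measurable_funM; exact: sf.1.
- by apply/measurable_EFinP; apply: measurable_funM; exact: sg.1.
- by apply: (@filterS _ _ (ae_filter_ringOfSetsType mu)) fg => t /= + abt => ->.
Qed.

Lemma enorm_sqr (v : 'rV[R]_2) : enorm v ^+ 2 = v 0 (axis 0) ^+ 2 + v 0 (axis 1) ^+ 2.
Proof. by rewrite /enorm sqr_sqrtr ?sum_axes// addr_ge0 ?sqr_ge0. Qed.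

Definition kinetic m (f : 'I_3 -> 'I_2 -> R) : R :=
  m (body 0) * (f (body 0) (axis 0) + f (body 0) (axis 1)) +
  m (body 1) * (f (body 1) (axis 0) + f (body 1) (axis 1)) +
  m (body 2) * (f (body 2) (axis 0) + f (body 2) (axis 1)).

Lemma Rintegral_kinetic m a b (f : 'I_3 -> 'I_2 -> R -> R) :
  (forall i k, mu.-integrable `[a, b] (EFin \o f i k)) ->
  mu.-integrable `[a, b] (EFin \o (fun t => kinetic m (fun i k => f i k t))) /\
  \int[mu]_(t in `[a, b]) kinetic m (fun i k => f i k t) =
  kinetic m (fun i k => \int[mu]_(t in `[a, b]) f i k t).
Proof.
move=> fi.
have D i : mu.-integrable `[a, b] (EFin \o (fun t => f i (axis 0) t + f i (axis 1) t)).
  exact: integrable_itvD.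
have Z i : mu.-integrable `[a, b] (EFin \o (fun t => m i * (f i (axis 0) t + f i (axis 1) t))).
  exact: integrable_itvZ.
have DZ := integrable_itvD (Z (body 0)) (Z (body 1)).
split; first exact: (integrable_itvD DZ (Z (body 2))).
rewrite /kinetic RintegralD// RintegralD// !RintegralZl// !RintegralD//.
Qed.

Lemma Rintegral_pair_sum m a b (f : 'I_3 -> 'I_3 -> R -> R) :
  mu.-integrable `[a, b] (EFin \o f (body 0) (body 1)) ->
  mu.-integrable `[a, b] (EFin \o f (body 0) (body 2)) ->
  mu.-integrable `[a, b] (EFin \o f (body 1) (body 2)) ->
  mu.-integrable `[a, b] (EFin \o (fun t => pair_sum m (fun i j => f i j t))) /\
  \int[mu]_(t in `[a, b]) pair_sum m (fun i j => f i j t) =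
  pair_sum m (fun i j => \int[mu]_(t in `[a, b]) f i j t).
Proof.
move=> f01 f02 f12.
have Z01 := integrable_itvZ (m (body 0) * m (body 1)) f01.
have Z02 := integrable_itvZ (m (body 0) * m (body 2)) f02.
have Z12 := integrable_itvZ (m (body 1) * m (body 2)) f12.
have DZ := integrable_itvD Z01 Z02.
split; first exact: (integrable_itvD DZ Z12).
by rewrite /pair_sum RintegralD// RintegralD// !RintegralZl.
Qed.

(** The velocity of [gamma + s *: xi] is chosen anew for each s and is affine in s only almost
    everywhere, which is enough for the integral of its square. As the kinetic part is already
    integrated, [quad] is used with constant functions and the dummy time 0. *)
Lemma action_line m alpha (gamma xi : R -> config R) (dg dx : 'I_3 -> 'I_2 -> R -> R) (s : R) :
  (forall i k, sobolev_on 0 (2 * pi) (fun t => gamma t i k) (dg i k)) ->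
  (forall i k, sobolev_on 0 (2 * pi) (fun t => xi t i k) (dx i k)) ->
  mu.-integrable `[0, 2 * pi] (EFin \o (fun t => potential m alpha (gamma t + s *: xi t))) ->
  action m alpha (gamma + s *: xi) =
  quad (2^-1 * kinetic m (fun i k => ip 0 (2 * pi) (dg i k) (dg i k)))
    (fun=> 2^-1 * kinetic m (fun i k => ip 0 (2 * pi) (dg i k) (dx i k)))
    (fun=> 2^-1 * kinetic m (fun i k => ip 0 (2 * pi) (dx i k) (dx i k))) s 0 +
  \int[mu]_(t in `[0, 2 * pi]) potential m alpha (gamma t + s *: xi t).
Proof.
move=> sg sx ip_.
pose v i k := weak_deriv (fun t => (gamma + s *: xi) t i k).
have sD i k : sobolev_on 0 (2 * pi) (fun t => (gamma + s *: xi) t i k) (fun t => dg i k t + s * dx i k t).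
  have -> : (fun t => (gamma + s *: xi) t i k) = (fun t => gamma t i k + s * xi t i k).
    by apply/funext => t; rewrite !mxE.
  by apply: sobolev_onD => //; exact: sobolev_onZ.
have sv i k : sqint 0 (2 * pi) (v i k) by have [] := weak_deriv_sobolev (sD i k).
have vE i k : ip 0 (2 * pi) (v i k) (v i k) = ip 0 (2 * pi) (dg i k) (dg i k) +
    2 * s * ip 0 (2 * pi) (dg i k) (dx i k) + s ^+ 2 * ip 0 (2 * pi) (dx i k) (dx i k).
  rewrite -(ip_ae (sD i k).2 (sv i k)); last by have [] := weak_deriv_sobolev (sD i k).
  have s1 := (sg i k).2; have s2 := (sx i k).2; have s3 := sqintZ s s2.
  rewrite (ipDl s1 s3 (sqintD s1 s3)) (ipDr s1 s3 s1) (ipDr s1 s3 s3).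
  by rewrite !ipZl// !ipZr// (ipC _ _ (dx i k) (dg i k)); ring.
have iv i k : mu.-integrable `[0, 2 * pi] (EFin \o (fun t => v i k t * v i k t)).
  exact: integrable_sqintM.
have [ik iE] := Rintegral_kinetic m iv.
have ik2 := integrable_itvZ 2^-1 ik.
rewrite /action.
transitivity (\int[mu]_(t in `[0, 2 * pi]) (2^-1 * kinetic m (fun i k => v i k t * v i k t) +
    potential m alpha (gamma t + s *: xi t))).
  apply: eq_Rintegral => t _; rewrite /lagrangian; congr (_ * _ + _).
  by rewrite sum_bodies !enorm_sqr !mxE /kinetic !expr2.
rewrite RintegralD//; congr (_ + _).
rewrite RintegralZl// iE /kinetic -!/(ip _ _ _ _) !vE /quad.
by move: (ip 0 (2 * pi)) => I; ring.
Qed.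

Lemma within_continuous_coord a b (gamma xi : R -> config R) :
  (forall i k, {within `[a, b], continuous (fun t => gamma t i k)}) ->
  (forall i k, {within `[a, b], continuous (fun t => xi t i k)}) ->
  forall i j, {within `[a, b], continuous (fun t => dotdiff (gamma t) (xi t) i j)} /\
    {within `[a, b], continuous (fun t => sqdist (xi t) i j)}.
Proof.
move=> cg cx i j.
have D (z : R -> config R) k : (forall i k, {within `[a, b], continuous (fun t => z t i k)}) ->
    {within `[a, b], continuous (fun t => z t i k - z t j k)}.
  by move=> cz x; apply: cvgB; exact: cz.
split.
  have -> : (fun t => dotdiff (gamma t) (xi t) i j) = (fun t =>
     (gamma t i (axis 0) - gamma t j (axis 0)) * (xi t i (axis 0) - xi t j (axis 0)) +
     (gamma t i (axis 1) - gamma t j (axis 1)) * (xi t i (axis 1) - xi t j (axis 1))).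
    by apply/funext => t; rewrite /dotdiff sum_axes.
  by apply: within_continuousD; apply: within_continuousM; exact: D.
have -> : (fun t => sqdist (xi t) i j) = (fun t =>
   (xi t i (axis 0) - xi t j (axis 0)) * (xi t i (axis 0) - xi t j (axis 0)) +
   (xi t i (axis 1) - xi t j (axis 1)) * (xi t i (axis 1) - xi t j (axis 1))).
  by apply/funext => t; rewrite /sqdist sum_axes !expr2.
by apply: within_continuousD; apply: within_continuousM; exact: D.
Qed.

(** The action is computed along the line only for s so small that no collision occurs, which
    suffices for a second derivative at 0. Equal constant sides make the coefficients independent of
    time and of the pair. *)
Lemma second_variation_eq m alpha (gamma xi : R -> config R) (dg dx : 'I_3 -> 'I_2 -> R -> R) (r2 : R) :
  0 < r2 -> (forall t i j, i != j -> sqdist (gamma t) i j = r2) ->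
  (forall i k, sobolev_on 0 (2 * pi) (fun t => gamma t i k) (dg i k)) ->
  (forall i k, sobolev_on 0 (2 * pi) (fun t => xi t i k) (dx i k)) ->
  second_variation m alpha gamma xi =
  kinetic m (fun i k => ip 0 (2 * pi) (dx i k) (dx i k)) +
  pair_sum m (fun i j => \int[mu]_(t in `[0, 2 * pi])
    (ddpot alpha r2 * (2 * dotdiff (gamma t) (xi t) i j) ^+ 2 + dpot alpha r2 * (2 * sqdist (xi t) i j))).
Proof.
move=> r0 gr sg sx.
have cg i k := primitive_on_continuous (two_pi_ge0 (R := R)) (sg i k).1.
have cx i k := primitive_on_continuous (two_pi_ge0 (R := R)) (sx i k).1.
pose B i j t := dotdiff (gamma t) (xi t) i j; pose C i j t := sqdist (xi t) i j.
have cBC := within_continuous_coord cg cx.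
have SD i j := @second_derivative_under_integral R 0 (2 * pi) r2 (B i j) (C i j) _ _ _ r0
  (cBC i j).1 (cBC i j).2 (@is_derive_pot R alpha) (@is_derive_dpot R alpha)
  (@continuous_ddpot R alpha).
have [e1 [V1 [e10 P1 D1 DD1]]] := SD (body 0) (body 1).
have [e2 [V2 [e20 P2 D2 DD2]]] := SD (body 0) (body 2).
have [e3 [V3 [e30 P3 D3 DD3]]] := SD (body 1) (body 2).
pose e := Num.min e1 (Num.min e2 e3).
have e0 : 0 < e by rewrite !lt_min e10 e20 e30.
have el (s : R) : `|s| < e -> [/\ `|s| < e1, `|s| < e2 & `|s| < e3].
  by rewrite !lt_min => /and3P[].
have sq t s i j : i != j -> sqdist (gamma t + s *: xi t) i j = quad r2 (B i j) (C i j) s t.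
  by move=> ij; rewrite sqdist_line gr.
have sym u i j : sqdist u i j = sqdist u j i.
  by apply: eq_bigr => k _; rewrite -sqrrN opprB.
have pos s t : `|s| < e -> 0 <= t <= 2 * pi -> forall i j, i != j -> 0 < sqdist (gamma t + s *: xi t) i j.
  move=> /el[s1 s2 s3] t2.
  have p1 := (P1 s s1).1 t t2; have p2 := (P2 s s2).1 t t2; have p3 := (P3 s s3).1 t t2.
  elim/body_cases; elim/body_cases; rewrite ?eqxx// => n; rewrite ?[sqdist _ (body 1) (body 0)]sym
    ?[sqdist _ (body 2) (body 0)]sym ?[sqdist _ (body 2) (body 1)]sym sq ?body_neq01 ?body_neq02 ?body_neq12//.
pose G (s : R) := quad (2^-1 * kinetic m (fun i k => ip 0 (2 * pi) (dg i k) (dg i k)))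
    (fun=> 2^-1 * kinetic m (fun i k => ip 0 (2 * pi) (dg i k) (dx i k)))
    (fun=> 2^-1 * kinetic m (fun i k => ip 0 (2 * pi) (dx i k) (dx i k))) s 0 +
  pair_sum m (fun i j => \int[mu]_(t in `[0, 2 * pi]) pot alpha (quad r2 (B i j) (C i j) s t)).
have actE s : `|s| < e -> action m alpha (gamma + s *: xi) = G s.
  move=> se; have [s1 s2 s3] := el s se.
  have [iP EP] := @Rintegral_pair_sum m 0 (2 * pi)
    (fun i j t => pot alpha (quad r2 (B i j) (C i j) s t)) (P1 s s1).2 (P2 s s2).2 (P3 s s3).2.
  have pE t : 0 <= t <= 2 * pi -> pair_sum m (fun i j => pot alpha (quad r2 (B i j) (C i j) s t)) =
      potential m alpha (gamma t + s *: xi t).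
    move=> t2; rewrite potentialE; last exact: pos.
    by rewrite /pair_sum !sq ?body_neq01 ?body_neq02 ?body_neq12.
  rewrite (action_line sg sx); last exact: eq_integrable_itv pE iP.
  congr (_ + _); rewrite -EP; apply: eq_Rintegral => t /set_mem/=; rewrite in_itv/= => t2.
  by rewrite pE.
pose G1 (s : R) := dquad (fun=> 2^-1 * kinetic m (fun i k => ip 0 (2 * pi) (dg i k) (dx i k)))
    (fun=> 2^-1 * kinetic m (fun i k => ip 0 (2 * pi) (dx i k) (dx i k))) s 0 +
  (m (body 0) * m (body 1) * V1 s + m (body 0) * m (body 2) * V2 s + m (body 1) * m (body 2) * V3 s).
rewrite /second_variation.
apply: (derive2_eval (V1 := G1) e0).
  move=> s se; have [s1 s2 s3] := el s se.
  apply: (@near_eq_is_derive _ _ _ G).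
    by apply: filterS (near_norm_lt se) => x xe; rewrite actE.
  apply: is_derive1D; first exact: is_derive_quad.
  exact: (is_derive1_sum3 _ _ _ (D1 s s1) (D2 s s2) (D3 s s3)).
have := is_derive1D (is_derive_dquad (fun=> 2^-1 * kinetic m (fun i k => ip 0 (2 * pi) (dg i k) (dx i k)))
    (fun=> 2^-1 * kinetic m (fun i k => ip 0 (2 * pi) (dx i k) (dx i k))) 0 0)
  (is_derive1_sum3 (m (body 0) * m (body 1)) (m (body 0) * m (body 2)) (m (body 1) * m (body 2)) DD1 DD2 DD3).
by rewrite mulrA divff ?mul1r// pnatr_eq0.
Qed.

End Newton.

(** * Rotating frame *)

Section LagrangeFrame.
Context {R : realType}.
Notation mu := (@lebesgue_measure R).
Notation ipp := (ip 0 (2 * pi)).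
Variables (m : 'I_3 -> R) (h p0 p1 w : R).
Hypotheses (h2 : h ^+ 2 = 3) (w2 : w ^+ 2 = 1) (p2 : p0 ^+ 2 + p1 ^+ 2 = 1).
Implicit Types (x y f g : R -> R).

Let m0 := m (body 0).
Let m1 := m (body 1).
Let m2 := m (body 2).
Let M := m0 + m1 + m2.
Let S := m0 * m1 + m0 * m2 + m1 * m2.
Let P := m0 * m1 * m2.

(* (frame0 t, frame1 t) is the direction of the first side at time t, and
   (- w * frame1 t, w * frame0 t) its image under the rotation by w * pi / 2. *)
Definition frame0 : R -> R := trig1 0 p0 (- w * p1).
Definition frame1 : R -> R := trig1 0 p1 (w * p0).

Lemma frame_unit t : frame0 t ^+ 2 + frame1 t ^+ 2 = 1.
Proof.
rewrite /frame0 /frame1 /trig1.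
have -> : (0 + (p0 * cos t + - w * p1 * sin t)) ^+ 2 + (0 + (p1 * cos t + w * p0 * sin t)) ^+ 2 =
  (p0 ^+ 2 + p1 ^+ 2) * (cos t ^+ 2 + w ^+ 2 * sin t ^+ 2) by ring.
by rewrite p2 w2 !mul1r cos2Dsin2.
Qed.

Lemma sobolev_on_frame : sobolev_on 0 (2 * pi) frame0 (fun t => - w * frame1 t) /\
  sobolev_on 0 (2 * pi) frame1 (fun t => w * frame0 t).
Proof.
have w2' : w * w = 1 by rewrite -expr2.
split.
  have -> : (fun t => - w * frame1 t) = trig1 0 (- w * p1) (- p0).
    by apply/funext => t; rewrite /frame1 /trig1 -[p0 in RHS]mul1r -w2'; ring.
  exact: (sobolev_on_trig1 0 p0 (- w * p1) (two_pi_ge0 (R := R))).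
have -> : (fun t => w * frame0 t) = trig1 0 (w * p0) (- p1).
  by apply/funext => t; rewrite /frame0 /trig1 -[p1 in RHS]mul1r -w2'; ring.
exact: (sobolev_on_trig1 0 p1 (w * p0) (two_pi_ge0 (R := R))).
Qed.

Definition from_frame (a b : R) (t : R) (k : 'I_2) : R :=
  if k == axis 0 then a * frame0 t - w * b * frame1 t else a * frame1 t + w * b * frame0 t.

Lemma from_frame_norm a b t :
  from_frame a b t (axis 0) ^+ 2 + from_frame a b t (axis 1) ^+ 2 = a ^+ 2 + b ^+ 2.
Proof.
rewrite /from_frame eqxx (eq_sym (axis 1)) (negbTE axis_neq).
have -> : (a * frame0 t - w * b * frame1 t) ^+ 2 + (a * frame1 t + w * b * frame0 t) ^+ 2 =
  (a ^+ 2 + w ^+ 2 * b ^+ 2) * (frame0 t ^+ 2 + frame1 t ^+ 2) by ring.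
by rewrite w2 frame_unit mul1r mulr1.
Qed.

Lemma from_frame_dot a b c d t :
  from_frame a b t (axis 0) * from_frame c d t (axis 0) +
  from_frame a b t (axis 1) * from_frame c d t (axis 1) = a * c + b * d.
Proof.
rewrite /from_frame eqxx (eq_sym (axis 1)) (negbTE axis_neq).
have -> : (a * frame0 t - w * b * frame1 t) * (c * frame0 t - w * d * frame1 t) +
  (a * frame1 t + w * b * frame0 t) * (c * frame1 t + w * d * frame0 t) =
  (a * c + w ^+ 2 * (b * d)) * (frame0 t ^+ 2 + frame1 t ^+ 2) by ring.
by rewrite w2 frame_unit mul1r mulr1.
Qed.

Lemma from_frameB a b c d t k :
  from_frame a b t k - from_frame c d t k = from_frame (a - c) (b - d) t k.
Proof. by rewrite /from_frame; case: ifP => _; ring. Qed.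

(** The frame vectors satisfy e1' = e2 and e2' = - e1 for either sense of rotation, since e2 carries
    w. Differentiation thus becomes z' + i z, the source of the first square in [kepler_form]. *)
Lemma sobolev_from_frame (a b a' b' : R -> R) k :
  sobolev_on 0 (2 * pi) a a' -> sobolev_on 0 (2 * pi) b b' ->
  sobolev_on 0 (2 * pi) (fun t => from_frame (a t) (b t) t k)
    (fun t => from_frame (a' t - b t) (b' t + a t) t k).
Proof.
move=> sa sb; have [s0 s1] := sobolev_on_frame.
have tp := two_pi_ge0 (R := R).
have w2' : w * w = 1 by rewrite -expr2.
rewrite /from_frame; case: (k == axis 0).
  have := sobolev_onD (sobolev_onM tp sa s0) (sobolev_onZ (- w) (sobolev_onM tp sb s1)).
  have -> : (fun t => a t * frame0 t + - w * (b t * frame1 t)) =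
    (fun t => a t * frame0 t - w * b t * frame1 t) by apply/funext => t; ring.
  have -> // : (fun t => a' t * frame0 t + a t * (- w * frame1 t) +
     - w * (b' t * frame1 t + b t * (w * frame0 t))) =
    (fun t => (a' t - b t) * frame0 t - w * (b' t + a t) * frame1 t).
  apply/funext => t; rewrite [in RHS](_ : a' t - b t = a' t - (w * w) * b t); first by ring.
  by rewrite w2' mul1r.
have := sobolev_onD (sobolev_onM tp sa s1) (sobolev_onZ w (sobolev_onM tp sb s0)).
have -> : (fun t => a t * frame1 t + w * (b t * frame0 t)) =
  (fun t => a t * frame1 t + w * b t * frame0 t) by apply/funext => t; ring.
have -> // : (fun t => a' t * frame1 t + a t * (w * frame0 t) +
   w * (b' t * frame0 t + b t * (- w * frame1 t))) =
  (fun t => (a' t - b t) * frame1 t + w * (b' t + a t) * frame0 t).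
apply/funext => t; rewrite [in RHS](_ : a' t - b t = a' t - (w * w) * b t); first by ring.
by rewrite w2' mul1r.
Qed.

Definition embed (x1 y1 x2 y2 : R -> R) : R -> config R := fun t =>
  \matrix_(i, k) from_frame (jac_re m0 m1 m2 h i (x1 t) (y1 t) (x2 t) (y2 t))
    (jac_im m0 m1 m2 h i (x1 t) (y1 t) (x2 t) (y2 t)) t k.

(** Jacobi coordinates are complex linear, so the operator z' + i z acts on the two modes
    separately. *)
Definition embed_deriv (x1 x1' y1 y1' x2 x2' y2 y2' : R -> R) (i : 'I_3) (k : 'I_2) : R -> R :=
  fun t => from_frame
    (jac_re m0 m1 m2 h i (x1' t - y1 t) (y1' t + x1 t) (x2' t - y2 t) (y2' t + x2 t))
    (jac_im m0 m1 m2 h i (x1' t - y1 t) (y1' t + x1 t) (x2' t - y2 t) (y2' t + x2 t)) t k.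

Lemma sobolev_on_lin4 (a b c d : R) (x x' y y' z z' u u' : R -> R) :
  sobolev_on 0 (2 * pi) x x' -> sobolev_on 0 (2 * pi) y y' ->
  sobolev_on 0 (2 * pi) z z' -> sobolev_on 0 (2 * pi) u u' ->
  sobolev_on 0 (2 * pi) (fun t => x t * a - y t * b + z t * c - u t * d)
    (fun t => x' t * a - y' t * b + z' t * c - u' t * d).
Proof.
move=> sx sy sz su.
have E (f g e r : R -> R) : (fun t => f t * a - g t * b + e t * c - r t * d) =
   (fun t => a * f t + (- b * g t + (c * e t + - d * r t))).
  by apply/funext => t; ring.
rewrite !E; apply: sobolev_onD; first exact: sobolev_onZ.
apply: sobolev_onD; first exact: sobolev_onZ.
by apply: sobolev_onD; exact: sobolev_onZ.
Qed.

Lemma sobolev_on_embed (x1 x1' y1 y1' x2 x2' y2 y2' : R -> R) :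
  sobolev_on 0 (2 * pi) x1 x1' -> sobolev_on 0 (2 * pi) y1 y1' ->
  sobolev_on 0 (2 * pi) x2 x2' -> sobolev_on 0 (2 * pi) y2 y2' ->
  forall i k, sobolev_on 0 (2 * pi) (fun t => embed x1 y1 x2 y2 t i k)
    (embed_deriv x1 x1' y1 y1' x2 x2' y2 y2' i k).
Proof.
move=> sx1 sy1 sx2 sy2 i k.
have sre := sobolev_on_lin4 (homo_re m0 m1 m2 i) (homo_im m0 m1 m2 h i)
  (shape_re m0 m1 m2 i) (shape_im m0 m1 m2 h i) sx1 sy1 sx2 sy2.
have := sobolev_on_lin4 (homo_im m0 m1 m2 h i) (- homo_re m0 m1 m2 i)
  (shape_im m0 m1 m2 h i) (- shape_re m0 m1 m2 i) sx1 sy1 sx2 sy2.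
have E (f g e r : R -> R) : (fun t => f t * homo_im m0 m1 m2 h i - g t * - homo_re m0 m1 m2 i +
    e t * shape_im m0 m1 m2 h i - r t * - shape_re m0 m1 m2 i) =
  (fun t => jac_im m0 m1 m2 h i (f t) (g t) (e t) (r t)).
  by apply/funext => t; rewrite /jac_im; ring.
rewrite !E => sim.
have := sobolev_from_frame k sre sim.
have -> : (fun t => from_frame (x1 t * homo_re m0 m1 m2 i - y1 t * homo_im m0 m1 m2 h i +
     x2 t * shape_re m0 m1 m2 i - y2 t * shape_im m0 m1 m2 h i)
     (jac_im m0 m1 m2 h i (x1 t) (y1 t) (x2 t) (y2 t)) t k) = (fun t => embed x1 y1 x2 y2 t i k).
  by apply/funext => t; rewrite /embed mxE.
congr sobolev_on; apply/funext => t; rewrite /embed_deriv; congr from_frame.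
  by rewrite /jac_re /jac_im; ring.
by rewrite /jac_re /jac_im; ring.
Qed.

Lemma embed_centered x1 y1 x2 y2 t : centered m (embed x1 y1 x2 y2 t).
Proof.
rewrite /centered /=; apply/matrixP => i k; rewrite sum_bodies !mxE.
have [cre cim] := jac_centered m0 m1 m2 h (x1 t) (y1 t) (x2 t) (y2 t).
have i0 : nat_of_ord (body 0) = 0%N by rewrite inordK.
have i1 : nat_of_ord (body 1) = 1%N by rewrite inordK.
have i2 : nat_of_ord (body 2) = 2%N by rewrite inordK.
pose re n := jac_re m0 m1 m2 h n (x1 t) (y1 t) (x2 t) (y2 t).
pose im n := jac_im m0 m1 m2 h n (x1 t) (y1 t) (x2 t) (y2 t).
rewrite i0 i1 i2 -/m0 -/m1 -/m2 /from_frame; case: ifP => _.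
  transitivity (frame0 t * (m0 * re 0%N + m1 * re 1%N + m2 * re 2%N) -
      w * frame1 t * (m0 * im 0%N + m1 * im 1%N + m2 * im 2%N)).
    by rewrite /re /im; ring.
  by rewrite /re /im cre cim !mulr0 subrr.
transitivity (frame1 t * (m0 * re 0%N + m1 * re 1%N + m2 * re 2%N) +
    w * frame0 t * (m0 * im 0%N + m1 * im 1%N + m2 * im 2%N)).
  by rewrite /re /im; ring.
by rewrite /re /im cre cim !mulr0 addr0.
Qed.

Definition frame_re (xi : R -> config R) (i : 'I_3) (t : R) : R :=
  xi t i (axis 0) * frame0 t + xi t i (axis 1) * frame1 t.
Definition frame_im (xi : R -> config R) (i : 'I_3) (t : R) : R :=
  w * (xi t i (axis 1) * frame0 t - xi t i (axis 0) * frame1 t).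

Lemma from_frameK xi i t k : from_frame (frame_re xi i t) (frame_im xi i t) t k = xi t i k.
Proof.
have fu := frame_unit t; elim/axis_cases: k.
  rewrite /from_frame eqxx -[RHS]mulr1 -fu /frame_re /frame_im.
  transitivity ((xi t i (axis 0) * frame0 t + xi t i (axis 1) * frame1 t) * frame0 t -
     w ^+ 2 * (xi t i (axis 1) * frame0 t - xi t i (axis 0) * frame1 t) * frame1 t); first by ring.
  by rewrite w2; ring.
rewrite /from_frame (eq_sym (axis 1)) (negbTE axis_neq) -[RHS]mulr1 -fu /frame_re /frame_im.
transitivity ((xi t i (axis 0) * frame0 t + xi t i (axis 1) * frame1 t) * frame1 t +
   w ^+ 2 * (xi t i (axis 1) * frame0 t - xi t i (axis 0) * frame1 t) * frame0 t); first by ring.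
by rewrite w2; ring.
Qed.

(* The inverse of [embed]: its four components are of the form [coord u v]. *)
Definition coord (u v : nat -> R) (xi : R -> config R) (t : R) : R :=
  u 0%N * frame_re xi (body 0) t + v 0%N * frame_im xi (body 0) t +
  (u 1%N * frame_re xi (body 1) t + v 1%N * frame_im xi (body 1) t) +
  (u 2 * frame_re xi (body 2) t + v 2 * frame_im xi (body 2) t).

Definition mass_of (n : nat) : R := m (body n).
Definition homo_x : (R -> config R) -> R -> R :=
  coord (fun n => mass_of n * homo_re m0 m1 m2 n / (M * S))
    (fun n => mass_of n * homo_im m0 m1 m2 h n / (M * S)).
Definition homo_y : (R -> config R) -> R -> R :=
  coord (fun n => - (mass_of n * homo_im m0 m1 m2 h n) / (M * S))
    (fun n => mass_of n * homo_re m0 m1 m2 n / (M * S)).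
Definition shape_x : (R -> config R) -> R -> R :=
  coord (fun n => side_re n / S) (fun n => - side_im h n / S).
Definition shape_y : (R -> config R) -> R -> R :=
  coord (fun n => side_im h n / S) (fun n => side_re n / S).

Lemma coordK xi t : M != 0 -> S != 0 -> m2 != 0 -> centered m (xi t) ->
  embed (homo_x xi) (homo_y xi) (shape_x xi) (shape_y xi) t = xi t.
Proof.
move=> M0 S0 m20 cxi; have cxik k : m0 * xi t (body 0) k + m1 * xi t (body 1) k + m2 * xi t (body 2) k = 0.
  by move: cxi; rewrite /centered /= sum_bodies => /matrixP/(_ 0 k); rewrite !mxE.
pose a n := frame_re xi (body n) t; pose b n := frame_im xi (body n) t.
have ca : m0 * a 0%N + m1 * a 1%N + m2 * a 2 = 0.
  transitivity ((m0 * xi t (body 0) (axis 0) + m1 * xi t (body 1) (axis 0) + m2 * xi t (body 2) (axis 0)) * frame0 t +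
    (m0 * xi t (body 0) (axis 1) + m1 * xi t (body 1) (axis 1) + m2 * xi t (body 2) (axis 1)) * frame1 t).
    by rewrite /a /frame_re; ring.
  by rewrite !cxik !mul0r addr0.
have cb : m0 * b 0%N + m1 * b 1%N + m2 * b 2 = 0.
  transitivity (w * ((m0 * xi t (body 0) (axis 1) + m1 * xi t (body 1) (axis 1) + m2 * xi t (body 2) (axis 1)) * frame0 t -
    (m0 * xi t (body 0) (axis 0) + m1 * xi t (body 1) (axis 0) + m2 * xi t (body 2) (axis 0)) * frame1 t)).
    by rewrite /b /frame_im; ring.
  by rewrite !cxik !mul0r subrr mulr0.
have hx : homo_x xi t = co_x1 m0 m1 m2 h a b.
  rewrite /homo_x /coord /co_x1 /mass_of -/m0 -/m1 -/m2 -/M -/S /a /b.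
  by move: (M * S)^-1 (frame_re xi) (frame_im xi) => iMS fr fi; ring.
have hy : homo_y xi t = co_y1 m0 m1 m2 h a b.
  rewrite /homo_y /coord /co_y1 /mass_of -/m0 -/m1 -/m2 -/M -/S /a /b.
  by move: (M * S)^-1 (frame_re xi) (frame_im xi) => iMS fr fi; ring.
have sx : shape_x xi t = co_x2 m0 m1 m2 h a b.
  rewrite /shape_x /coord /co_x2 -/S /a /b.
  by move: S^-1 (frame_re xi) (frame_im xi) => iS fr fi; ring.
have sy : shape_y xi t = co_y2 m0 m1 m2 h a b.
  rewrite /shape_y /coord /co_y2 -/S /a /b.
  by move: S^-1 (frame_re xi) (frame_im xi) => iS fr fi; ring.
apply/matrixP => i k; rewrite mxE hx hy sx sy.
have [-> ->] := jac_coK h2 M0 S0 m20 ca cb (ltn_ord i).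
by rewrite /a /b /body inord_val from_frameK.
Qed.

Lemma coord_sum (u v : nat -> R) (n : nat) (c : 'I_n -> R) (e : 'I_n -> R -> config R) t :
  coord u v (\sum_i c i *: e i) t = \sum_i c i * coord u v (e i) t.
Proof.
have E i k : (\sum_i c i *: e i) t i k = \sum_j c j * e j t i k.
  rewrite -[LHS]/((fun f : R -> config R => f t i k) (\sum_j c j *: e j)).
  by elim/big_ind2 : _ => [|x f y g <- <-|j _]; rewrite ?mxE.
have F i : frame_re (\sum_i c i *: e i) i t = \sum_j c j * frame_re (e j) i t.
  rewrite /frame_re !E !mulr_suml -big_split /=; apply: eq_bigr => j _; ring.
have G i : frame_im (\sum_i c i *: e i) i t = \sum_j c j * frame_im (e j) i t.
  rewrite /frame_im !E !mulr_suml -sumrB mulr_sumr /=; apply: eq_bigr => j _; ring.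
rewrite /coord !F !G !mulr_sumr -!big_split /=; apply: eq_bigr => j _; ring.
Qed.

Lemma coord_sobolev (u v : nat -> R) (xi : R -> config R) (dxi : 'I_3 -> 'I_2 -> R -> R) :
  (forall i k, sobolev_on 0 (2 * pi) (fun t => xi t i k) (dxi i k)) ->
  exists g, sobolev_on 0 (2 * pi) (coord u v xi) g.
Proof.
move=> sxi; have [s0 s1] := sobolev_on_frame; have tp := two_pi_ge0 (R := R).
have re i := sobolev_onD (sobolev_onM tp (sxi i (axis 0)) s0) (sobolev_onM tp (sxi i (axis 1)) s1).
have im i := sobolev_onZ w (sobolev_onD (sobolev_onM tp (sxi i (axis 1)) s0)
  (sobolev_onZ (-1) (sobolev_onM tp (sxi i (axis 0)) s1))).
have imE i : (fun t => w * (xi t i (axis 1) * frame0 t + -1 * (xi t i (axis 0) * frame1 t))) = frame_im xi i.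
  by apply/funext => t; rewrite /frame_im mulN1r.
have {}im i := im i; eexists.
apply: sobolev_onD; first apply: sobolev_onD.
all: apply: sobolev_onD; apply: sobolev_onZ; [exact: re|rewrite -imE; exact: im].
Qed.

Lemma frame_periodic : frame0 0 = frame0 (2 * pi) /\ frame1 0 = frame1 (2 * pi).
Proof. by rewrite /frame0 /frame1 /trig1 cos_2pi sin_2pi cos0 sin0. Qed.

Lemma coord_periodic (u v : nat -> R) xi : xi 0 = xi (2 * pi) ->
  coord u v xi 0 = coord u v xi (2 * pi).
Proof. by move=> xip; have [f0 f1] := frame_periodic; rewrite /coord /frame_re /frame_im xip f0 f1. Qed.

Lemma trig1D2pi (a b c t : R) : trig1 a b c (t + 2 * pi) = trig1 a b c t.
Proof. by rewrite /trig1 cosD sinD cos_2pi sin_2pi; ring. Qed.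

Lemma embed_variation (x1 x1' y1 y1' x2 x2' y2 y2' : R -> R) :
  sobolev_on 0 (2 * pi) x1 x1' -> sobolev_on 0 (2 * pi) y1 y1' ->
  sobolev_on 0 (2 * pi) x2 x2' -> sobolev_on 0 (2 * pi) y2 y2' ->
  periodic x1 (2 * pi) -> periodic y1 (2 * pi) -> periodic x2 (2 * pi) -> periodic y2 (2 * pi) ->
  variations m (embed x1 y1 x2 y2).
Proof.
move=> sx1 sy1 sx2 sy2 px1 py1 px2 py2; split; last by move=> t; exact: embed_centered.
move=> i k; have [pe [me se]] := sobolev_on_embed sx1 sy1 sx2 sy2 i k.
split; last by exists (embed_deriv x1 x1' y1 y1' x2 x2' y2 y2' i k).
move=> t; rewrite !mxE px1 py1 px2 py2 /from_frame /frame0 /frame1 !trig1D2pi.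
by [].
Qed.

Variables (alpha r : R) (gamma : R -> config R).
Hypotheses (M0 : M != 0) (r0 : 0 < r).
Hypothesis size : 2 * dpot alpha (r ^+ 2) * M = -1.
Hypothesis side01 : forall t k,
  gamma t (body 0) k - gamma t (body 1) k = r * from_frame (side_re 2) (side_im h 2) t k.
Hypothesis side02 : forall t k,
  gamma t (body 0) k - gamma t (body 2) k = - r * from_frame (side_re 1) (side_im h 1) t k.
Hypothesis side12 : forall t k,
  gamma t (body 1) k - gamma t (body 2) k = r * from_frame (side_re 0) (side_im h 0) t k.
Hypothesis gamma_sqdist : forall t i j, i != j -> sqdist (gamma t) i j = r ^+ 2.
Variable dgamma : 'I_3 -> 'I_2 -> R -> R.
Hypothesis sgamma : forall i k, sobolev_on 0 (2 * pi) (fun t => gamma t i k) (dgamma i k).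

Let A := alpha / 2 + 1.

(** [ddpotE] turns r^2 phi'' into - A phi', and [size] turns phi' into - 1 / (2 M). Only e^2
    matters, which allows for the side traversed backwards in [side02]. *)
Lemma embed_pair_term (xi : R -> config R) (a b : 'I_3 -> R) t i j (e u v : R) :
  (forall i k, xi t i k = from_frame (a i) (b i) t k) ->
  (forall k, gamma t i k - gamma t j k = e * from_frame u v t k) -> e ^+ 2 = r ^+ 2 ->
  ddpot alpha (r ^+ 2) * (2 * dotdiff (gamma t) (xi t) i j) ^+ 2 +
    dpot alpha (r ^+ 2) * (2 * sqdist (xi t) i j) =
  M^-1 * (2 * A * (u * (a i - a j) + v * (b i - b j)) ^+ 2 -
    ((a i - a j) ^+ 2 + (b i - b j) ^+ 2)).
Proof.
move=> xiE gE e2.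
have -> : dotdiff (gamma t) (xi t) i j = e * (u * (a i - a j) + v * (b i - b j)).
  rewrite /dotdiff sum_axes !gE !xiE !from_frameB -!mulrA -mulrDr; congr (_ * _).
  exact: from_frame_dot.
have -> : sqdist (xi t) i j = (a i - a j) ^+ 2 + (b i - b j) ^+ 2.
  by rewrite /sqdist sum_axes !xiE !from_frameB from_frame_norm.
set d := u * _ + _; set n := (a i - a j) ^+ 2 + _.
have -> : ddpot alpha (r ^+ 2) * (2 * (e * d)) ^+ 2 = 4 * ((e ^+ 2) * ddpot alpha (r ^+ 2)) * d ^+ 2.
  by ring.
rewrite e2 ddpotE ?exprn_gt0//.
have -> : dpot alpha (r ^+ 2) = - (2 * M)^-1.
  apply: (mulfI (x := 2 * M)); first by rewrite mulf_neq0.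
  by rewrite mulrN divff ?mulf_neq0// -size; ring.
by rewrite /A; field.
Qed.

Lemma second_variation_embed (x1 x1' y1 y1' x2 x2' y2 y2' : R -> R) :
  sobolev_on 0 (2 * pi) x1 x1' -> sobolev_on 0 (2 * pi) y1 y1' ->
  sobolev_on 0 (2 * pi) x2 x2' -> sobolev_on 0 (2 * pi) y2 y2' ->
  x1 0 = x1 (2 * pi) -> y1 0 = y1 (2 * pi) -> x2 0 = x2 (2 * pi) -> y2 0 = y2 (2 * pi) ->
  second_variation m alpha gamma (embed x1 y1 x2 y2) =
  M * S * kepler_form A 1 0 x1 x1' y1 y1' +
  P * S * kepler_form A (kre m0 m1 m2) (kim m0 m1 m2 h) x2 x2' y2 y2'.
Proof.
move=> sx1 sy1 sx2 sy2 x1p y1p x2p y2p.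
have se := sobolev_on_embed sx1 sy1 sx2 sy2.
have r20 : 0 < r ^+ 2 by exact: exprn_gt0.
rewrite (second_variation_eq m alpha r20 gamma_sqdist sgamma se).
have cg i k := primitive_on_continuous (two_pi_ge0 (R := R)) (sgamma i k).1.
have cx i k := primitive_on_continuous (two_pi_ge0 (R := R)) (se i k).1.
pose D (i j : 'I_3) (t : R) :=
    ddpot alpha (r ^+ 2) * (2 * dotdiff (gamma t) (embed x1 y1 x2 y2 t) i j) ^+ 2 +
    dpot alpha (r ^+ 2) * (2 * sqdist (embed x1 y1 x2 y2 t) i j).
have iD (i j : 'I_3) : mu.-integrable `[0, 2 * pi] (EFin \o D i j).
  have [cB cC] := within_continuous_coord cg cx i j.
  have c2B := within_continuousM (@within_continuous_cst R 0 (2 * pi) 2) cB.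
  have c2C := within_continuousM (@within_continuous_cst R 0 (2 * pi) 2) cC.
  have := integrable_itvD
    (integrable_itvZ (ddpot alpha (r ^+ 2)) (integrable_within_continuous (within_continuousM c2B c2B)))
    (integrable_itvZ (dpot alpha (r ^+ 2)) (integrable_within_continuous c2C)).
  by apply: eq_integrable_itv => t _; rewrite /D expr2.
have [iP <-] := @Rintegral_pair_sum R m 0 (2 * pi) D (iD _ _) (iD _ _) (iD _ _).
have iK0 i k : mu.-integrable `[0, 2 * pi] (EFin \o (fun t =>
   embed_deriv x1 x1' y1 y1' x2 x2' y2 y2' i k t * embed_deriv x1 x1' y1 y1' x2 x2' y2 y2' i k t)).
  by apply: integrable_sqintM; exact: (se i k).2.
have [iK] := Rintegral_kinetic m iK0.
rewrite /ip => <-.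
have [i1 e1] := Rintegral_kepler_density A 1 0 sx1 sy1 x1p y1p.
have [i2 e2] := Rintegral_kepler_density A (kre m0 m1 m2) (kim m0 m1 m2 h) sx2 sy2 x2p y2p.
rewrite -RintegralD// -e1 -e2 -!RintegralZl// -RintegralD//; last 2 first.
- exact: integrable_itvZ.
- exact: integrable_itvZ.
(* What remains is a pointwise algebraic identity: the integration by parts is inside
   [Rintegral_kepler_density]. *)
apply: eq_Rintegral => t _.
have i0' : nat_of_ord (body 0) = 0%N by rewrite inordK.
have i1' : nat_of_ord (body 1) = 1%N by rewrite inordK.
have i2' : nat_of_ord (body 2) = 2%N by rewrite inordK.
have xiE (i : 'I_3) k : embed x1 y1 x2 y2 t i k =
   from_frame (jac_re m0 m1 m2 h i (x1 t) (y1 t) (x2 t) (y2 t))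
    (jac_im m0 m1 m2 h i (x1 t) (y1 t) (x2 t) (y2 t)) t k by rewrite mxE.
rewrite /pair_sum /D (embed_pair_term xiE (side01 t) erefl)
  (embed_pair_term xiE (side02 t) (sqrrN r)) (embed_pair_term xiE (side12 t) erefl).
rewrite /kinetic /embed_deriv -!expr2 !from_frame_norm i0' i1' i2' -/m0 -/m1 -/m2.
rewrite jac_norm//.
have JS := jac_side h2 (x1 t) (y1 t) (x2 t) (y2 t) M0.
have [cre cim] := jac_centered m0 m1 m2 h (x1 t) (y1 t) (x2 t) (y2 t).
have CR := centered_norm cre; have CI := centered_norm cim.
have JN := jac_norm m0 m1 m2 h2 (x1 t) (y1 t) (x2 t) (y2 t).
move: JS CR CI JN => /=.
rewrite -/M -/S -/P.
move: (jac_re m0 m1 m2 h 0 _ _ _ _) (jac_re m0 m1 m2 h 1 _ _ _ _) (jac_re m0 m1 m2 h 2 _ _ _ _).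
move: (jac_im m0 m1 m2 h 0 _ _ _ _) (jac_im m0 m1 m2 h 1 _ _ _ _) (jac_im m0 m1 m2 h 2 _ _ _ _).
move=> b0 b1 b2 a0 a1 a2 JS CR CI JN.
set d01 := (1 * (a0 - a1) + 0 * (b0 - b1)) in JS *.
set d02 := (- 2^-1 * (a0 - a2) + - (h / 2) * (b0 - b2)) in JS *.
set d12 := (- 2^-1 * (a1 - a2) + h / 2 * (b1 - b2)) in JS *.
set K := M * S * (_ + _) + P * S * (_ + _).
(* Components along the sides are grouped for [jac_side] and full relative displacements for
   [centered_norm]; the latter give minus the mass norm, which is the - 1 in A - 1. *)
transitivity (K + M^-1 * (2 * A * (m0 * m1 * d01 ^+ 2 + m0 * m2 * d02 ^+ 2 + m1 * m2 * d12 ^+ 2) -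
  ((m0 * m1 * (a0 - a1) ^+ 2 + m0 * m2 * (a0 - a2) ^+ 2 + m1 * m2 * (a1 - a2) ^+ 2) +
   (m0 * m1 * (b0 - b1) ^+ 2 + m0 * m2 * (b0 - b2) ^+ 2 + m1 * m2 * (b1 - b2) ^+ 2)))).
  by move: (M^-1) K => iM K; clear JS; ring.
rewrite JS CR CI -mulrDr.
have -> : (m0 * a0 ^+ 2 + m1 * a1 ^+ 2 + m2 * a2 ^+ 2) + (m0 * b0 ^+ 2 + m1 * b1 ^+ 2 + m2 * b2 ^+ 2) =
  M * S * (x1 t ^+ 2 + y1 t ^+ 2) + P * S * (x2 t ^+ 2 + y2 t ^+ 2) by rewrite -JN; ring.
rewrite /K /kepler_density.
move: (x1 t) (y1 t) (x2 t) (y2 t) (x1' t) (y1' t) (x2' t) (y2' t) (kre _ _ _) (kim _ _ _ _).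
by move: M0; generalize M S P A => M' S' P' A' M0' *; field.
Qed.

End LagrangeFrame.

(** * Morse index *)

Section MorseIndex.
Context {R : realType}.
Notation mu := (@lebesgue_measure R).
Notation ipp := (ip 0 (2 * pi)).

(** More than n vectors have a nontrivial combination killed by n functionals, found in the kernel
    of the matrix of values; there the form would be both negative and nonnegative. Linearity is
    asked only on variations because the functionals are integrals. *)
Lemma negative_subspace_le (m : 'I_3 -> R) (alpha : R) (gamma : R -> config R) (n : nat)
    (L : 'I_n -> (R -> config R) -> R) :
  (forall j p (c : 'I_p -> R) (e : 'I_p -> R -> config R), (forall i, variations m (e i)) ->
     L j (\sum_i c i *: e i) = \sum_i c i * L j (e i)) ->
  (forall xi, variations m xi -> (forall j, L j xi = 0) ->
     0 <= second_variation m alpha gamma xi) ->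
  forall p, has_negative_subspace m alpha gamma p -> (p <= n)%N.
Proof.
move=> Llin Lpos p [E [[e [free EE]] Evar Eneg]]; rewrite leqNgt; apply/negP => np.
have Ee i : E (e i).
  rewrite EE; exists (fun j => (j == i)%:R).
  by rewrite (bigD1 i)//= eqxx scale1r big1 ?addr0// => j /negbTE ->; rewrite scale0r.
pose B : 'M[R]_(p, n) := \matrix_(i, j) L j (e i).
have kB : kermx B != 0.
  rewrite -mxrank_eq0 mxrank_ker subn_eq0 -ltnNge.
  by apply: leq_ltn_trans np; exact: rank_leq_col.
have /rowV0Pn[c /sub_kermxP cB c0] := kB.
pose xi := \sum_i c 0 i *: e i.
have Exi : E xi by rewrite EE; exists (fun i => c 0 i).
have xi0 : xi != 0.
  apply/negP => /eqP xi0; case/negP: c0; apply/eqP/rowP => i.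
  by rewrite mxE; exact: free xi0 i.
have := Eneg _ Exi xi0; rewrite ltNge => /negP; apply; apply: Lpos; first exact: Evar.
move=> j; rewrite Llin; last by move=> i; exact/Evar/Ee.
have := congr1 (fun A : 'rV_n => A 0 j) cB; rewrite [LHS]mxE [RHS]mxE => cB0.
by rewrite -[RHS]cB0; apply: eq_bigr => i _; rewrite mxE.
Qed.

(** Independence follows from negativity: a nontrivial relation would make the second variation at 0
    negative. *)
Lemma negative_subspace_intro (m : 'I_3 -> R) (alpha : R) (gamma : R -> config R) (n : nat)
    (e : 'I_n -> R -> config R) :
  (forall c : 'I_n -> R, variations m (\sum_i c i *: e i)) ->
  (forall c : 'I_n -> R, (exists i, c i != 0) ->
    second_variation m alpha gamma (\sum_i c i *: e i) < 0) ->
  0 <= second_variation m alpha gamma 0 ->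
  has_negative_subspace m alpha gamma n.
Proof.
move=> var neg nneg; exists [set v | exists c : 'I_n -> R, v = \sum_i c i *: e i]; split.
- exists e; split=> // c c0 i; apply/eqP; apply: contraT => ci.
  by have := neg c (ex_intro _ i ci); rewrite c0 ltNge nneg.
- by move=> _ [c ->]; exact: var.
- move=> _ [c ->] c0; apply: neg; apply/not_existsP => H.
  case/eqP: c0; apply: big1 => i _.
  by have /negP/negPn/eqP -> := H i; rewrite scale0r.
Qed.

Lemma W12_sobolev (f : R -> R) : W12 f -> sobolev_on 0 (2 * pi) f (weak_deriv f).
Proof.
move=> [_ [g pg sg]].
have sfg : sobolev_on 0 (2 * pi) f g.
  by split => //; split => //; have /measurable_int/measurable_EFinP := pg.1.
split; last by have [] := weak_deriv_sobolev sfg.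
exact: (@xgetPex _ (cst 0) [set g | is_weak_deriv f g] (ex_intro _ g pg)).
Qed.

Lemma variation_sobolev (m : 'I_3 -> R) (xi : R -> config R) : variations m xi ->
  (forall i k, sobolev_on 0 (2 * pi) (fun t => xi t i k) (weak_deriv (fun t => xi t i k))) /\
  xi 0 = xi (2 * pi).
Proof.
move=> [W _]; split; first by move=> i k; apply: W12_sobolev; exact: W.
by apply/matrixP => i k; have [/(_ 0) + _] := W i k; rewrite add0r.
Qed.

Lemma ip_sum a b (f : R -> R) (n : nat) (c : 'I_n -> R) (g : 'I_n -> R -> R) : sqint a b f ->
  (forall i, sqint a b (g i)) ->
  ip a b f (fun t => \sum_i c i * g i t) = \sum_i c i * ip a b f (g i).
Proof.
move=> sf sg.
suff [] : sqint a b (fun t => \sum_i c i * g i t) /\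
  ip a b f (fun t => \sum_i c i * g i t) = \sum_i c i * ip a b f (g i) by [].
elim: n c g sg => [|n IH] c g sg.
  rewrite big_ord0; under eq_fun do rewrite big_ord0.
  by split; [exact: sqint_cst|rewrite ipC ip0l].
rewrite big_ord_recl; under eq_fun do rewrite big_ord_recl.
have [s E] := IH (fun i => c (lift ord0 i)) (fun i => g (lift ord0 i)) (fun i => sg _).
have s0 := sqintZ (c ord0) (sg ord0).
by split; [exact: sqintD|rewrite ipDr// E ipZr].
Qed.

(* (neg_mode_re, neg_mode_im) minimizes [kepler_mode A k1 k2 a b]. *)
Definition neg_mode_re (A k1 k2 a b : R) : R := - (A * (k1 * a - k2 * b)) / (A + 3).
Definition neg_mode_im (A k1 k2 a b : R) : R := A * (k1 * b + k2 * a) / (A + 3).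
Definition neg_x (A k1 k2 a b : R) : R -> R :=
  trig1 0 ((a + neg_mode_re A k1 k2 a b) / 2) ((b - neg_mode_im A k1 k2 a b) / 2).
Definition neg_x' (A k1 k2 a b : R) : R -> R :=
  trig1 0 ((b - neg_mode_im A k1 k2 a b) / 2) (- ((a + neg_mode_re A k1 k2 a b) / 2)).
Definition neg_y (A k1 k2 a b : R) : R -> R :=
  trig1 0 ((b + neg_mode_im A k1 k2 a b) / 2) ((neg_mode_re A k1 k2 a b - a) / 2).
Definition neg_y' (A k1 k2 a b : R) : R -> R :=
  trig1 0 ((neg_mode_re A k1 k2 a b - a) / 2) (- ((b + neg_mode_im A k1 k2 a b) / 2)).

Lemma kepler_form_neg (A k1 k2 a b : R) :
  kepler_form A k1 k2 (neg_x A k1 k2 a b) (neg_x' A k1 k2 a b) (neg_y A k1 k2 a b) (neg_y' A k1 k2 a b) =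
  pi * kepler_mode A k1 k2 a b (neg_mode_re A k1 k2 a b) (neg_mode_im A k1 k2 a b).
Proof.
rewrite kepler_form_trig1; congr (_ * _).
set n1 := neg_mode_re _ _ _ _ _; set n2 := neg_mode_im _ _ _ _ _.
have -> : (a + n1) / 2 - (n1 - a) / 2 = a by field.
have -> : (b - n2) / 2 + (b + n2) / 2 = b by field.
have -> : (a + n1) / 2 + (n1 - a) / 2 = n1 by field.
have -> : (b + n2) / 2 - (b - n2) / 2 = n2 by field.
by ring.
Qed.

Lemma neg_x0 (A k1 k2 t : R) : neg_x A k1 k2 0 0 t = 0.
Proof. by rewrite /neg_x /neg_mode_re /neg_mode_im /trig1; move: (A + 3)^-1 => i; ring. Qed.

Lemma neg_y0 (A k1 k2 t : R) : neg_y A k1 k2 0 0 t = 0.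
Proof. by rewrite /neg_y /neg_mode_re /neg_mode_im /trig1; move: (A + 3)^-1 => i; ring. Qed.

Lemma neg_xD (A k1 k2 a b t : R) :
  neg_x A k1 k2 a b t = a * neg_x A k1 k2 1 0 t + b * neg_x A k1 k2 0 1 t.
Proof. by rewrite /neg_x /neg_mode_re /neg_mode_im /trig1; move: (A + 3)^-1 => i; ring. Qed.

Lemma neg_yD (A k1 k2 a b t : R) :
  neg_y A k1 k2 a b t = a * neg_y A k1 k2 1 0 t + b * neg_y A k1 k2 0 1 t.
Proof. by rewrite /neg_y /neg_mode_re /neg_mode_im /trig1; move: (A + 3)^-1 => i; ring. Qed.

End MorseIndex.

(** * Upper and lower bounds for the index *)

Section LagrangeIndex.
Context {R : realType}.
Notation ipp := (ip 0 (2 * pi)).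
Variables (m : 'I_3 -> R) (h p0 p1 w alpha r : R) (gamma : R -> config R).
Variable dgamma : 'I_3 -> 'I_2 -> R -> R.

Let m0 := m (body 0).
Let m1 := m (body 1).
Let m2 := m (body 2).
Let M := m0 + m1 + m2.
Let S := m0 * m1 + m0 * m2 + m1 * m2.
Let P := m0 * m1 * m2.
Let A := alpha / 2 + 1.
Let k1 := kre m0 m1 m2.
Let k2 := kim m0 m1 m2 h.

Hypotheses (mpos : forall i, 0 < m i) (h2 : h ^+ 2 = 3) (w2 : w ^+ 2 = 1).
Hypotheses (p2 : p0 ^+ 2 + p1 ^+ 2 = 1) (r0 : 0 < r) (alpha0 : 0 <= alpha).
Hypothesis size : 2 * dpot alpha (r ^+ 2) * M = -1.
Hypothesis side01 : forall t k,
  gamma t (body 0) k - gamma t (body 1) k = r * from_frame p0 p1 w (side_re 2) (side_im h 2) t k.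
Hypothesis side02 : forall t k,
  gamma t (body 0) k - gamma t (body 2) k = - r * from_frame p0 p1 w (side_re 1) (side_im h 1) t k.
Hypothesis side12 : forall t k,
  gamma t (body 1) k - gamma t (body 2) k = r * from_frame p0 p1 w (side_re 0) (side_im h 0) t k.
Hypothesis gamma_sqdist : forall t i j, i != j -> sqdist (gamma t) i j = r ^+ 2.
Hypothesis sgamma : forall i k, sobolev_on 0 (2 * pi) (fun t => gamma t i k) (dgamma i k).

Let m00 : 0 < m0. Proof. exact: mpos. Qed.
Let m10 : 0 < m1. Proof. exact: mpos. Qed.
Let m20 : 0 < m2. Proof. exact: mpos. Qed.
Let M0 : 0 < M. Proof. by rewrite !addr_gt0. Qed.
Let S0 : 0 < S. Proof. by rewrite !addr_gt0// mulr_gt0. Qed.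
Let P0 : 0 < P. Proof. by rewrite !mulr_gt0. Qed.
Let A1 : 1 <= A. Proof. by rewrite /A lerDr divr_ge0. Qed.
Let k_le1 : k1 ^+ 2 + k2 ^+ 2 <= 1.
Proof.
rewrite /k1 /k2 k_norm ?gt_eqF// gerDl oppr_le0 divr_ge0 ?sqr_ge0//.
by rewrite mulr_ge0// ltW.
Qed.

Let hx := homo_x m h p0 p1 w.
Let hy := homo_y m h p0 p1 w.
Let sx := shape_x m h p0 p1 w.
Let sy := shape_y m h p0 p1 w.

(** The [low] pair is twice the coefficient of exp(-it) in x + i y, the only mode that can make the
    form negative; the [high] pair is twice that of exp(it). *)
Definition low_re (x y : R -> R) : R := ipp cos x / pi - ipp sin y / pi.
Definition low_im (x y : R -> R) : R := ipp sin x / pi + ipp cos y / pi.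
Definition high_re (x y : R -> R) : R := ipp cos x / pi + ipp sin y / pi.
Definition high_im (x y : R -> R) : R := ipp cos y / pi - ipp sin x / pi.

(** By [coordK] every variation is an [embed], so the splitting into two forms applies; each is then
    bounded below by its first modes. *)
Lemma second_variation_ge xi : variations m xi ->
  M * S * (pi * kepler_mode A 1 0 (low_re (hx xi) (hy xi)) (low_im (hx xi) (hy xi))
    (high_re (hx xi) (hy xi)) (high_im (hx xi) (hy xi))) +
  P * S * (pi * kepler_mode A k1 k2 (low_re (sx xi) (sy xi)) (low_im (sx xi) (sy xi))
    (high_re (sx xi) (sy xi)) (high_im (sx xi) (sy xi))) <= second_variation m alpha gamma xi.
Proof.
move=> vxi; have [sxi xip] := variation_sobolev vxi.
have xiE : xi = embed m h p0 p1 w (hx xi) (hy xi) (sx xi) (sy xi).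
  apply/funext => t; rewrite coordK ?gt_eqF//; exact: (vxi.2 t).
have [g1 s1] : exists g, sobolev_on 0 (2 * pi) (hx xi) g by exact: (coord_sobolev p0 p1 w2 _ _ sxi).
have [g2 s2] : exists g, sobolev_on 0 (2 * pi) (hy xi) g by exact: (coord_sobolev p0 p1 w2 _ _ sxi).
have [g3 s3] : exists g, sobolev_on 0 (2 * pi) (sx xi) g by exact: (coord_sobolev p0 p1 w2 _ _ sxi).
have [g4 s4] : exists g, sobolev_on 0 (2 * pi) (sy xi) g by exact: (coord_sobolev p0 p1 w2 _ _ sxi).
have q1 : hx xi 0 = hx xi (2 * pi) by exact: (coord_periodic p0 p1 w _ _ xip).
have q2 : hy xi 0 = hy xi (2 * pi) by exact: (coord_periodic p0 p1 w _ _ xip).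
have q3 : sx xi 0 = sx xi (2 * pi) by exact: (coord_periodic p0 p1 w _ _ xip).
have q4 : sy xi 0 = sy xi (2 * pi) by exact: (coord_periodic p0 p1 w _ _ xip).
have M0' : M != 0 by rewrite gt_eqF.
rewrite [X in _ <= second_variation _ _ _ X]xiE.
rewrite (second_variation_embed h2 w2 p2 M0' r0 size side01 side02 side12 gamma_sqdist sgamma
  s1 s2 s3 s4 q1 q2 q3 q4).
have A0 : 0 <= A by apply: le_trans A1.
have k1le : (1 : R) ^+ 2 + 0 ^+ 2 <= 1 by rewrite expr1n expr0n/= addr0.
have MS0 : 0 <= M * S := ltW (mulr_gt0 M0 S0).
have PS0 : 0 <= P * S := ltW (mulr_gt0 P0 S0).
apply: lerD; apply: ler_wpM2l => //.
  exact: (kepler_form_ge A0 k1le s1 s2 q1 q2).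
exact: (kepler_form_ge A0 k_le1 s3 s4 q3 q4).
Qed.

Definition low_mode (j : nat) (xi : R -> config R) : R :=
  match j with
  | 0 => low_re (hx xi) (hy xi) | 1 => low_im (hx xi) (hy xi)
  | 2 => low_re (sx xi) (sy xi) | _ => low_im (sx xi) (sy xi)
  end.

Lemma low_mode_sum j (n : nat) (c : 'I_n -> R) (e : 'I_n -> R -> config R) :
  (forall i, variations m (e i)) ->
  low_mode j (\sum_i c i *: e i) = \sum_i c i * low_mode j (e i).
Proof.
move=> ve.
have tp := two_pi_ge0 (R := R).
have sq u v i : sqint 0 (2 * pi) (coord p0 p1 w u v (e i)).
  have [se _] := variation_sobolev (ve i).
  by have [g sg] := coord_sobolev p0 p1 w2 u v se; exact: (sobolev_on_sqint tp sg).
have I (f : R -> R) u v : sqint 0 (2 * pi) f -> ipp f (coord p0 p1 w u v (\sum_i c i *: e i)) =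
    \sum_i c i * ipp f (coord p0 p1 w u v (e i)).
  move=> sf; rewrite -(ip_sum c sf (sq u v)); congr (ip _ _ f _).
  by apply/funext => t; exact: coord_sum.
have sc := @sqint_cos R; have ss := @sqint_sin R.
case: j => [|[|[|j]]]; rewrite /low_mode /low_re /low_im /hx /hy /sx /sy !I// !mulr_suml
  -?sumrB -?big_split /=; apply: eq_bigr => i _; ring.
Qed.

Let homo_stable : Prop := A ^+ 2 * (1 ^+ 2 + 0 ^+ 2) <= (A + 3) * (A - 1).
Let shape_stable : Prop := A ^+ 2 * (k1 ^+ 2 + k2 ^+ 2) <= (A + 3) * (A - 1).

Lemma weighted_ge0 x y : 0 <= x -> 0 <= y -> 0 <= M * S * (pi * x) + P * S * (pi * y).
Proof.
move=> x0 y0; have MS0 : 0 <= M * S := ltW (mulr_gt0 M0 S0).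
have PS0 : 0 <= P * S := ltW (mulr_gt0 P0 S0).
by apply: addr_ge0; apply: mulr_ge0 => //; apply: mulr_ge0 => //; exact: pi_ge0.
Qed.

Lemma index_le0 p : homo_stable -> shape_stable ->
  has_negative_subspace m alpha gamma p -> (p <= 0)%N.
Proof.
move=> hs ss; apply: (@negative_subspace_le R m alpha gamma 0 (fun j => low_mode j)).
  by case.
move=> xi vxi _; apply: le_trans (second_variation_ge vxi).
by apply: weighted_ge0; exact: kepler_mode_ge0.
Qed.

Lemma index_le2 p : shape_stable -> has_negative_subspace m alpha gamma p -> (p <= 2)%N.
Proof.
move=> ss; apply: (@negative_subspace_le R m alpha gamma 2 (fun j => low_mode j)).
  by move=> j q c e; exact: low_mode_sum.
move=> xi vxi L0; apply: le_trans (second_variation_ge vxi).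
have -> : low_re (hx xi) (hy xi) = 0 := L0 (Ordinal (isT : (0 < 2)%N)).
have -> : low_im (hx xi) (hy xi) = 0 := L0 (Ordinal (isT : (1 < 2)%N)).
by apply: weighted_ge0; [exact: kepler_mode_ge0_codim2|exact: kepler_mode_ge0].
Qed.

Lemma index_le4 p : has_negative_subspace m alpha gamma p -> (p <= 4)%N.
Proof.
apply: (@negative_subspace_le R m alpha gamma 4 (fun j => low_mode j)).
  by move=> j q c e; exact: low_mode_sum.
move=> xi vxi L0; apply: le_trans (second_variation_ge vxi).
have -> : low_re (hx xi) (hy xi) = 0 := L0 (Ordinal (isT : (0 < 4)%N)).
have -> : low_im (hx xi) (hy xi) = 0 := L0 (Ordinal (isT : (1 < 4)%N)).
have -> : low_re (sx xi) (sy xi) = 0 := L0 (Ordinal (isT : (2 < 4)%N)).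
have -> : low_im (sx xi) (sy xi) = 0 := L0 (Ordinal (isT : (3 < 4)%N)).
by apply: weighted_ge0; exact: kepler_mode_ge0_codim2.
Qed.

Definition neg_field (a b c d : R) : R -> config R := embed m h p0 p1 w
  (neg_x A 1 0 a b) (neg_y A 1 0 a b) (neg_x A k1 k2 c d) (neg_y A k1 k2 c d).

Lemma neg_field_variation a b c d : variations m (neg_field a b c d).
Proof.
have tp := two_pi_ge0 (R := R).
apply: (embed_variation m h p0 p1 w2); try exact: (sobolev_on_trig1 _ _ _ tp);
  by move=> t; exact: trig1D2pi.
Qed.

Lemma second_variation_neg_field a b c d : second_variation m alpha gamma (neg_field a b c d) =
  M * S * (pi * kepler_mode A 1 0 a b (neg_mode_re A 1 0 a b) (neg_mode_im A 1 0 a b)) +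
  P * S * (pi * kepler_mode A k1 k2 c d (neg_mode_re A k1 k2 c d) (neg_mode_im A k1 k2 c d)).
Proof.
have M0' : M != 0 by rewrite gt_eqF.
have tp := two_pi_ge0 (R := R).
have s x y z := sobolev_on_trig1 x y z tp.
have q x y z : trig1 x y z 0 = trig1 x y z (2 * pi) :> R.
  by rewrite /trig1 cos_2pi sin_2pi cos0 sin0.
rewrite (second_variation_embed h2 w2 p2 M0' r0 size side01 side02 side12 gamma_sqdist sgamma
  (s _ _ _) (s _ _ _) (s _ _ _) (s _ _ _) (q _ _ _) (q _ _ _) (q _ _ _) (q _ _ _)).
by rewrite -!kepler_form_neg.
Qed.

(** The minimizing coefficient of exp(it) is real linear in that of exp(-it), so these variations
    form a linear family. *)
Lemma neg_fieldD a b c d : neg_field a b c d =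
  a *: neg_field 1 0 0 0 + b *: neg_field 0 1 0 0 + c *: neg_field 0 0 1 0 + d *: neg_field 0 0 0 1.
Proof.
apply/funext => t; apply/matrixP => i k; rewrite !mxE.
rewrite (neg_xD _ _ _ a) (neg_yD _ _ _ a) (neg_xD _ _ _ c) (neg_yD _ _ _ c).
rewrite !neg_x0 !neg_y0 /jac_re /jac_im /from_frame; case: (k == axis 0); ring.
Qed.

Lemma neg_field0 : neg_field 0 0 0 0 = 0.
Proof. by rewrite neg_fieldD !scale0r !addr0. Qed.

Lemma second_variation0 : second_variation m alpha gamma 0 = 0.
Proof.
rewrite -neg_field0 second_variation_neg_field /neg_mode_re /neg_mode_im /kepler_mode.
by move: (A + 3)^-1 => i; ring.
Qed.

Let homo_unstable : Prop := (A + 3) * (A - 1) < A ^+ 2 * (1 ^+ 2 + 0 ^+ 2).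
Let shape_unstable : Prop := (A + 3) * (A - 1) < A ^+ 2 * (k1 ^+ 2 + k2 ^+ 2).

Lemma neg_mode_le0 (j1 j2 a b : R) : (A + 3) * (A - 1) < A ^+ 2 * (j1 ^+ 2 + j2 ^+ 2) ->
  kepler_mode A j1 j2 a b (neg_mode_re A j1 j2 a b) (neg_mode_im A j1 j2 a b) <= 0.
Proof.
move=> u; have [/andP[/eqP -> /eqP ->]|] := boolP ((a == 0) && (b == 0)).
  rewrite /neg_mode_re /neg_mode_im /kepler_mode; move: (A + 3)^-1 => i.
  by rewrite (_ : _ + _ = 0)//; ring.
by rewrite negb_and => ab; apply: ltW; exact: kepler_mode_lt0.
Qed.

(** The alternative serves both the whole family (index 4) and its plane c = d = 0 (index 2). A
    vanishing block contributes 0, so one nonzero block in an unstable form is enough. *)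
Lemma neg_field_lt0 a b c d : homo_unstable -> shape_unstable \/ (c = 0 /\ d = 0) ->
  [|| a != 0, b != 0, c != 0 | d != 0] ->
  second_variation m alpha gamma (neg_field a b c d) < 0.
Proof.
move=> hu su abcd; rewrite second_variation_neg_field.
have MS0 := mulr_gt0 M0 S0; have PS0 := mulr_gt0 P0 S0; have pp := pi_gt0 R.
rewrite !mulrA; have w1 := mulr_gt0 MS0 pp; have w2' := mulr_gt0 PS0 pp.
have [ab|/norP[/negPn/eqP a0 /negPn/eqP b0]] := boolP ((a != 0) || (b != 0)).
  have l1 := kepler_mode_lt0 A1 hu ab.
  have l2 : kepler_mode A k1 k2 c d (neg_mode_re A k1 k2 c d) (neg_mode_im A k1 k2 c d) <= 0.
    case: su => [su|[-> ->]]; first exact: neg_mode_le0.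
    rewrite /neg_mode_re /neg_mode_im /kepler_mode; move: (A + 3)^-1 => i.
    by rewrite (_ : _ + _ = 0)//; ring.
  by rewrite ltr_wnDr// ?mulr_ge0_le0 ?(ltW w2')// pmulr_rlt0.
move: abcd; rewrite a0 b0 eqxx/= => cd.
case: su => [su|[c0 d0]]; last by move: cd; rewrite c0 d0 eqxx.
have l2 := kepler_mode_lt0 A1 su cd.
have l1 := neg_mode_le0 0 0 hu.
by rewrite ltr_wnDl// ?mulr_ge0_le0 ?(ltW w1)// pmulr_rlt0.
Qed.

Lemma neg_subspace0 : has_negative_subspace m alpha gamma 0.
Proof.
apply: (@negative_subspace_intro R m alpha gamma 0 (fun=> 0)).
- by move=> c; rewrite big_ord0 -neg_field0; exact: neg_field_variation.
- by move=> c [[]].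
- by rewrite second_variation0.
Qed.

Lemma neg_subspace2 : homo_unstable -> has_negative_subspace m alpha gamma 2.
Proof.
move=> hu; pose e (i : 'I_2) := if i == axis 0 then neg_field 1 0 0 0 else neg_field 0 1 0 0.
have E (c : 'I_2 -> R) : \sum_i c i *: e i = neg_field (c (axis 0)) (c (axis 1)) 0 0.
  by rewrite sum_axes /e eqxx (eq_sym (axis 1)) (negbTE axis_neq)
    (neg_fieldD (c _)) !scale0r !addr0.
apply: (@negative_subspace_intro R m alpha gamma 2 e).
- by move=> c; rewrite E; exact: neg_field_variation.
- move=> c [i]; rewrite E => ci; apply: neg_field_lt0 => //; first by right.
  by move: ci; elim/axis_cases: i => ->; rewrite ?orbT.
- by rewrite second_variation0.
Qed.

Lemma neg_subspace4 : homo_unstable -> shape_unstable -> has_negative_subspace m alpha gamma 4.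
Proof.
move=> hu su; pose e (i : 'I_4) := match val i with
  | 0%N => neg_field 1 0 0 0 | 1%N => neg_field 0 1 0 0
  | 2 => neg_field 0 0 1 0 | _ => neg_field 0 0 0 1 end.
have E (c : 'I_4 -> R) : \sum_i c i *: e i =
    neg_field (c (inord 0)) (c (inord 1)) (c (inord 2)) (c (inord 3)).
  rewrite !big_ord_recl big_ord0 addr0 (neg_fieldD (c _)) /e /= !addrA.
  by congr (c _ *: _ + c _ *: _ + c _ *: _ + c _ *: _); apply: val_inj; rewrite /= inordK.
apply: (@negative_subspace_intro R m alpha gamma 4 e).
- by move=> c; rewrite E; exact: neg_field_variation.
- move=> c [i]; rewrite E => ci; apply: neg_field_lt0 => //; first by left.
  have I k (lt : (k < 4)%N) : inord k = Ordinal lt by apply: val_inj; rewrite /= inordK.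
  by case: i ci => -[|[|[|[|//]]]] lt; rewrite -(I _ lt) => ->; rewrite ?orbT.
- by rewrite second_variation0.
Qed.

End LagrangeIndex.

(** * The rotating frame attached to an equilateral triangle *)

Section Circular.
Context {R : realType}.

(** Unit vectors with a unit sum have scalar product -1/2, hence make an angle of 120 degrees; d is
    the sine of the oriented angle. *)
Lemma unit_equilateral (p0 p1 s0 s1 d : R) : p0 ^+ 2 + p1 ^+ 2 = 1 -> s0 ^+ 2 + s1 ^+ 2 = 1 ->
  (p0 + s0) ^+ 2 + (p1 + s1) ^+ 2 = 1 -> d = p0 * s1 - p1 * s0 ->
  [/\ 4 * d ^+ 2 = 3, s0 = - 2^-1 * p0 - d * p1 & s1 = - 2^-1 * p1 + d * p0].
Proof.
move=> p s ps dE.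
have ip : p0 * s0 + p1 * s1 = - 2^-1.
  have : (p0 + s0) ^+ 2 + (p1 + s1) ^+ 2 =
    (p0 ^+ 2 + p1 ^+ 2) + (s0 ^+ 2 + s1 ^+ 2) + 2 * (p0 * s0 + p1 * s1) by ring.
  by rewrite ps p s => E; lra.
split.
- have -> : 4 * d ^+ 2 = 4 * ((p0 ^+ 2 + p1 ^+ 2) * (s0 ^+ 2 + s1 ^+ 2) - (p0 * s0 + p1 * s1) ^+ 2).
    by rewrite dE; ring.
  by rewrite p s ip; field.
- have -> : s0 = (p0 ^+ 2 + p1 ^+ 2) * s0 by rewrite p mul1r.
  by rewrite -ip dE; ring.
- have -> : s1 = (p0 ^+ 2 + p1 ^+ 2) * s1 by rewrite p mul1r.
  by rewrite -ip dE; ring.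
Qed.

Lemma circularB (q : config R) (p0 p1 w r a b : R) (i j : 'I_3) :
  q i (axis 0) - q j (axis 0) = r * (a * p0 - w * b * p1) ->
  q i (axis 1) - q j (axis 1) = r * (a * p1 + w * b * p0) ->
  forall t, circular q w i 0 t - circular q w j 0 t = r * from_frame p0 p1 w a b t (axis 0) /\
    circular q w i 1 t - circular q w j 1 t = r * from_frame p0 p1 w a b t (axis 1).
Proof.
move=> d0 d1 t; rewrite /from_frame eqxx (eq_sym (axis 1)) (negbTE axis_neq).
rewrite /circular /frame0 /frame1 /trig1; split.
- transitivity ((q i (axis 0) - q j (axis 0)) * cos t - w * (q i (axis 1) - q j (axis 1)) * sin t).
    by ring.
  by rewrite d0 d1; ring.
- transitivity ((q i (axis 1) - q j (axis 1)) * cos t + w * (q i (axis 0) - q j (axis 0)) * sin t).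
    by ring.
  by rewrite d0 d1; ring.
Qed.

Variables (q : config R) (w : R) (gamma : R -> config R).
Hypothesis w1 : `|w| = 1.
Hypothesis gammaE : forall t, gamma t = q *m (rotation (w * t))^T.

Lemma circular_coord t i : gamma t i (axis 0) = circular q w i 0 t /\
  gamma t i (axis 1) = circular q w i 1 t.
Proof. by rewrite gammaE; exact: rotation_circular. Qed.

Lemma sqr_speed : w ^+ 2 = 1.
Proof. by rewrite -(real_normK (num_real w)) w1 expr1n. Qed.

Lemma rotation_sqdist t i j : sqdist (gamma t) i j = sqdist q i j.
Proof.
rewrite /sqdist !sum_axes; have [-> ->] := circular_coord t i.
have [-> ->] := circular_coord t j; rewrite /circular /trig1.
have cs : cos t ^+ 2 = 1 - sin t ^+ 2 by rewrite -(cos2Dsin2 t) addrK.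
by ring: cs sqr_speed.
Qed.

Lemma rotation_side p0 p1 r a b (i j : 'I_3) :
  q i (axis 0) - q j (axis 0) = r * (a * p0 - w * b * p1) ->
  q i (axis 1) - q j (axis 1) = r * (a * p1 + w * b * p0) ->
  forall t k, gamma t i k - gamma t j k = r * from_frame p0 p1 w a b t k.
Proof.
move=> d0 d1 t; have [c0 c1] := circularB d0 d1 t.
have [i0 i1] := circular_coord t i; have [j0 j1] := circular_coord t j.
by elim/axis_cases; rewrite ?i0 ?j0 ?i1 ?j1.
Qed.

Lemma rotation_sobolev : exists dg : 'I_3 -> 'I_2 -> R -> R,
  forall i k, sobolev_on 0 (2 * pi) (fun t => gamma t i k) (dg i k).
Proof.
exists (fun i k => if k == axis 0 then trig1 0 (- w * q i (axis 1)) (- q i (axis 0))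
  else trig1 0 (w * q i (axis 0)) (- q i (axis 1))) => i.
have tp := two_pi_ge0 (R := R).
elim/axis_cases.
- have -> : (fun t => gamma t i (axis 0)) = circular q w i 0.
    by apply/funext => t; have [] := circular_coord t i.
  by rewrite eqxx; exact: (sobolev_on_trig1 _ _ _ tp).
- have -> : (fun t => gamma t i (axis 1)) = circular q w i 1.
    by apply/funext => t; have [] := circular_coord t i.
  by rewrite (eq_sym (axis 1)) (negbTE axis_neq); exact: (sobolev_on_trig1 _ _ _ tp).
Qed.

Lemma equilateral_sqdist : equilateral q ->
  exists2 r, 0 < r & forall i j, i != j -> sqdist q i j = r ^+ 2.
Proof.
move=> [r r0 qr]; exists r => // i j ij; rewrite -(qr _ _ ij) body_distE sqr_sqrtr//.
by apply: sumr_ge0 => k _; exact: sqr_ge0.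
Qed.

Lemma equilateral_frame r : 0 < r -> (forall i j, i != j -> sqdist q i j = r ^+ 2) ->
  exists p0 p1 h, [/\ p0 ^+ 2 + p1 ^+ 2 = 1, h ^+ 2 = 3,
    forall t k, gamma t (body 0) k - gamma t (body 1) k =
      r * from_frame p0 p1 w (side_re 2) (side_im h 2) t k,
    forall t k, gamma t (body 0) k - gamma t (body 2) k =
      - r * from_frame p0 p1 w (side_re 1) (side_im h 1) t k &
    forall t k, gamma t (body 1) k - gamma t (body 2) k =
      r * from_frame p0 p1 w (side_re 0) (side_im h 0) t k].
Proof.
move=> r0 qr; have rN0 : r != 0 by rewrite gt_eqF.
pose p k := (q (body 0) k - q (body 1) k) / r.
pose s k := (q (body 1) k - q (body 2) k) / r.
have pE k : q (body 0) k - q (body 1) k = r * p k by rewrite /p mulrC divfK.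
have sE k : q (body 1) k - q (body 2) k = r * s k by rewrite /s mulrC divfK.
have psE k : q (body 0) k - q (body 2) k = r * (p k + s k).
  by rewrite mulrDr -pE -sE addrA subrK.
have cancel_r (x y : R) : (r * x) ^+ 2 + (r * y) ^+ 2 = r ^+ 2 -> x ^+ 2 + y ^+ 2 = 1.
  rewrite !exprMn -mulrDr -[RHS]mulr1 => /mulfI; apply.
  by rewrite expf_neq0.
have [||| d2 s0E s1E] := @unit_equilateral (p (axis 0)) (p (axis 1)) (s (axis 0)) (s (axis 1)) _ _ _ _ erefl.
- by have := qr _ _ body_neq01; rewrite /sqdist sum_axes !pE; exact: cancel_r.
- by have := qr _ _ body_neq12; rewrite /sqdist sum_axes !sE; exact: cancel_r.
- by have := qr _ _ body_neq02; rewrite /sqdist sum_axes !psE; exact: cancel_r.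
move: d2 s0E s1E; set d := _ - _ => d2 s0E s1E.
(* The second frame vector already carries w, so h / 2 = w d is needed to recover w (h / 2) = d. The
   sign of h compares the orientation of the triangle with the sense of rotation. *)
exists (p (axis 0)), (p (axis 1)), (2 * w * d).
have w2 := sqr_speed.
split.
- by have := qr _ _ body_neq01; rewrite /sqdist sum_axes !pE; exact: cancel_r.
- by rewrite !exprMn w2 mulr1 -d2; ring.
- by apply: rotation_side; rewrite pE /side_re /side_im; ring.
- by apply: rotation_side; rewrite psE ?s0E ?s1E /side_re /side_im; field: w2.
- by apply: rotation_side; rewrite sE ?s0E ?s1E /side_re /side_im; field: w2.
Qed.

End Circular.

(** * The mass parameter and the stability thresholds *)

Section MassParameter.
Context {R : realType}.
Variables (m : 'I_3 -> R) (alpha : R).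
Hypotheses (mpos : forall i, 0 < m i) (alpha0 : 0 <= alpha).
Let m0 := m (body 0).
Let m1 := m (body 1).
Let m2 := m (body 2).
Let A := alpha / 2 + 1.
Let beta := mass_param m.

Lemma mass_paramE : beta = 27 * (m0 * m1 + m0 * m2 + m1 * m2) / (m0 + m1 + m2) ^+ 2.
Proof. by rewrite /beta /mass_param sum_pairs sum_bodies. Qed.

Lemma k_norm_mass_param h : h ^+ 2 = 3 -> kre m0 m1 m2 ^+ 2 + kim m0 m1 m2 h ^+ 2 = 1 - beta / 9.
Proof.
move=> h2; rewrite k_norm ?gt_eqF ?addr_gt0//; try exact: mpos.
by rewrite mass_paramE; move: (_ ^- 2) => i; field.
Qed.

Lemma mass_param_bounds : 0 < beta <= 9.
Proof.
have M0 : 0 < m0 + m1 + m2 by rewrite !addr_gt0//; exact: mpos.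
have S0 : 0 < m0 * m1 + m0 * m2 + m1 * m2 by rewrite !addr_gt0// mulr_gt0//; exact: mpos.
rewrite mass_paramE divr_gt0 ?mulr_gt0 ?exprn_gt0//= ler_pdivrMr ?exprn_gt0//.
rewrite -subr_ge0.
have -> : 9 * (m0 + m1 + m2) ^+ 2 - 27 * (m0 * m1 + m0 * m2 + m1 * m2) =
  9 / 2 * ((m0 - m1) ^+ 2 + (m0 - m2) ^+ 2 + (m1 - m2) ^+ 2) by field.
by rewrite mulr_ge0// !addr_ge0// sqr_ge0.
Qed.

(** As 2 A = alpha + 2, the two inequalities agree up to the factor 36. Here k stands for beta and
    is left free: its value 0 is the homothetic block. *)
Lemma shape_stableE k : (A ^+ 2 * (1 - k / 9) <= (A + 3) * (A - 1)) =
  (36 * (1 - alpha) / (alpha + 2) ^+ 2 <= k).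
Proof.
have a2 : 0 < (alpha + 2) ^+ 2 by rewrite exprn_gt0// ltr_wpDl.
rewrite ler_pdivrMr// -subr_ge0 -[RHS]subr_ge0.
have -> : k * (alpha + 2) ^+ 2 - 36 * (1 - alpha) =
  36 * ((A + 3) * (A - 1) - A ^+ 2 * (1 - k / 9)) by rewrite /A; field.
by rewrite pmulr_rge0.
Qed.

Lemma homo_stableE : (A ^+ 2 * (1 ^+ 2 + 0 ^+ 2) <= (A + 3) * (A - 1)) = (1 <= alpha).
Proof.
have := shape_stableE 0; rewrite mul0r subr0 expr1n expr0n addr0 => ->.
have a2 : 0 < (alpha + 2) ^+ 2 by rewrite exprn_gt0// ltr_wpDl.
by rewrite pmulr_lle0 ?invr_gt0// pmulr_rle0// subr_le0.
Qed.

End MassParameter.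


Theorem mainTheorem2 (R : realType) (m : 'I_3 -> R) (alpha : R)
    (gamma : R -> config R) :
  (forall i, 0 < m i) ->
  0 <= alpha < 2 ->
  lagrangian_circular m alpha gamma ->
  let beta := mass_param m in
  0 < beta <= 9 /\
  [/\ 1 <= alpha < 2 -> morse_index m alpha gamma 0,
      36 * (1 - alpha) / (alpha + 2) ^+ 2 <= beta -> 0 <= alpha < 1 ->
        morse_index m alpha gamma 2 &
      0 < beta < 36 * (1 - alpha) / (alpha + 2) ^+ 2 ->
        morse_index m alpha gamma 4].
Proof.
move=> mpos /andP[alpha0 _] [newton [q [w [eq_q cq w1 gammaE]]]] beta.
have beta_bounds := mass_param_bounds mpos; split=> //.
have [beta0 _] := andP beta_bounds; rewrite -/beta in beta0.
have [r r0 qr] := equilateral_sqdist eq_q.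
have w2 := sqr_speed w1.
have [p0 [p1 [h [p2 h2 s01 s02 s12]]]] := equilateral_frame w1 gammaE r0 qr.
have r2 : 0 < r ^+ 2 by rewrite exprn_gt0.
have size := circular_size mpos newton cq w1 r2 qr gammaE.
have gqr t i j : i != j -> sqdist (gamma t) i j = r ^+ 2.
  by move=> ij; rewrite (rotation_sqdist w1 gammaE); exact: qr.
have [dg sg] := rotation_sobolev w1 gammaE.
have hs := homo_stableE alpha0; have ss := shape_stableE alpha0 beta.
rewrite -(k_norm_mass_param mpos h2) in ss.
have up0 := index_le0 mpos h2 w2 p2 r0 alpha0 size s01 s02 s12 gqr sg.
have up2 := index_le2 mpos h2 w2 p2 r0 alpha0 size s01 s02 s12 gqr sg.
have up4 := index_le4 mpos h2 w2 p2 r0 alpha0 size s01 s02 s12 gqr sg.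
split.
- move=> /andP[alpha1 _]; split; first exact: (neg_subspace0 mpos h2 w2 p2 r0 size s01 s02 s12 gqr sg).
  move=> p; apply: up0; first by rewrite hs.
  (* For alpha >= 1 the threshold is at most 0, hence below beta. *)
  rewrite ss; apply: le_trans (ltW beta0).
  by rewrite mulr_le0_ge0// ?invr_ge0 ?sqr_ge0// mulr_ge0_le0// subr_le0.
- move=> beta_ge /andP[_ alpha1]; split.
    by apply: (neg_subspace2 mpos h2 w2 p2 r0 alpha0 size s01 s02 s12 gqr sg); rewrite ltNge hs -ltNge.
  by move=> p; apply: up2; rewrite ss.
- move=> /andP[_ beta_lt].
  (* A threshold above the positive beta is positive, which forces alpha < 1: the homothetic block
     is then unstable as well. *)
  have alpha1 : alpha < 1.
    have a2 : 0 < (alpha + 2) ^+ 2 by rewrite exprn_gt0// ltr_wpDl.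
    have := lt_trans beta0 beta_lt.
    by rewrite pmulr_lgt0 ?invr_gt0// pmulr_rgt0// subr_gt0.
  split; last by move=> p; exact: up4.
  apply: (neg_subspace4 mpos h2 w2 p2 r0 alpha0 size s01 s02 s12 gqr sg).
    by rewrite ltNge hs -ltNge.
  by rewrite ltNge ss -ltNge.
Qed.
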